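(* Let $V$ be a Euclidean Jordan algebra, or a (unital, real) Jordan-Banach algebra (JB-algebra), and let $X=X(V)\supset V$ be its Jordan geometry. Then the interval topology on $X$ coincides with the usual topology on $X$, and by restriction to $V$ it also coincides with the usual topology on $V$.
   Context: **Algebras.** A (linear, unital) real Jordan algebra is a real vector space $V$ with a commutative bilinear product and unit $e\ne 0$ satisfying $a(a^2b)=a^2(ab)$. Put $L_a(x)=ax$, $Q_a=2L_a^2-L_{a^2}$, $D_{a,x}(b)=(Q_{a+b}-Q_a-Q_b)(x)$; $a$ is invertible if $Q_a$ is bijective, and then $a^{-1}=Q_a^{-1}(a)$; $V^\times$ is the set of invertible elements. $V$ is Euclidean if it is finite-dimensional and admits an inner product for which all $L_a$ are self-adjoint. A JB-algebra is a real Jordan algebra with a complete norm such that $\|ab\|\le\|a\|\|b\|$, $\|a^2\|=\|a\|^2$, $\|a^2\|\le\|a^2+b^2\|$. The symmetric cone is $\Omega=\{x^2\mid x\in V^\times\}$, and $a<b$ iff $b-a\in\Omega$. The usual topology of $V$ is the norm topology. **Jordan geometry $X(V)$.** Let $L=V\oplus L_0\oplus V$ (the Kantor–Koecher–Tits Lie algebra of $V$), where $L_0\subset\mathrm{End}(V)\times\mathrm{End}(V)$ is spanned by $(\mathrm{id},-\mathrm{id})$ and all $(D_{x,y},-D_{y,x})$, $x,y\in V$. Write $v^+$, $v^-$ for $v$ in the first, resp. last summand. The bracket is the commutator on $L_0$, $[(A,B),u^+]=(Au)^+$, $[(A,B),v^-]=(Bv)^-$, $[x^+,y^-]=-(D_{x,y},-D_{y,x})$,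 and $[u^+,v^+]=0=[u^-,v^-]$. The swap $\theta(u^++(A,B)+v^-)=v^++(B,A)+u^-$ is an automorphism of $L$. For $v\in V$ let $t_v=\exp(\mathrm{ad}\,v^+)\in\mathrm{Aut}(L)$ and $\tilde t_v=\theta t_v\theta$. Let $G_0$ be the subgroup of $\mathrm{Aut}(L)$ generated by all $t_v,\tilde t_w$ ($v,w\in V$). For $y\in V^\times$, the pair $(Q_y,Q_y^{-1})$ defines an element of $G_0$ acting by $u^++(A,B)+v^-\mapsto(Q_yu)^++(Q_yAQ_y^{-1},Q_y^{-1}BQ_y)+(Q_y^{-1}v)^-$. Let $P\subset G_0$ be the subgroup generated by all $\tilde t_v$ ($v\in V$) and all these elements. Then $X=X(V)=G_0/P$ with its $G_0$-action, $o=P$, $V$ is identified with the subset $\{t_v.o\mid v\in V\}$ of $X$ via $v\mapsto t_v.o$, and $\infty=w.o$, where $w=t_e\tilde t_{-e}t_e$ (which extends $x\mapsto-x^{-1}$ on $V^\times$). **Usual topology on $X$.** A subset $U\subset X$ is open iff for every $g\in G_0$ the set $\{v\in V\mid g(v)\in U\}$ is open in the norm topology of $V$. (With this topology $V$ is open in $X$, carries its norm topology as subspace topology, and $G_0$ acts by homeomorphisms.) **Interval topology.** Put $R=\{(a,x,b)\in X^3\mid\exists g\in G_0:\ g(a)=o,\ g(b)=\infty,\ g(x)\in\Omega\}$ (a $G_0$-invariant partial cyclic order on $X$) and $]a,b[\,=\{x\in X\mid(a,x,b)\in R\}$. Write $a\top b$ if $(a,b)=(g(o),g(\infty))$ for some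 $g\in G_0$. The interval topology on $X$ is the topology generated by all intervals $]a,b[$ with $(a,b)\in X^2$, $a\top b$.
   Formalization: The point ∞ = w.o is taken with w = t_e t̃_e t_e, the element that extends x ↦ −x^{-1} for the stated bracket; the formula w = t_e t̃_{-e} t_e has a sign inconsistent with that bracket and would make the claim false for V = R. *)

(* Defs.v *)
From HB Require Import structures.
From mathcomp Require Import all_boot all_order all_algebra.
From mathcomp Require Import all_classical all_reals all_analysis.
From mathcomp Require Import ring.
Import Order.TTheory GRing.Theory Num.Theory.
Import numFieldNormedType.Exports.

Set Implicit Arguments.
Unset Strict Implicit.
Unset Printing Implicit Defensive.

Local Open Scope classical_set_scope.
Local Open Scope ring_scope.

Record jordan_algebra (R : realType) (V : lmodType R) := JordanAlgebra {
  jmul : V -> V -> V;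
  junit : V;
  jmulC : forall a b, jmul a b = jmul b a;
  jmul_linear : forall (k : R) a b c,
    jmul (k *: a + b) c = k *: jmul a c + jmul b c;
  junitP : forall a, jmul junit a = a;
  junit_neq0 : junit != 0;
  jordan_identity : forall a b,
    jmul a (jmul (jmul a a) b) = jmul (jmul a a) (jmul a b)
}.

Section JordanAlgebra.
Context (R : realType) (V : lmodType R) (J : jordan_algebra V).
Implicit Types a b x y : V.

Definition jquad a b : V := 2 *: jmul J a (jmul J a b) - jmul J (jmul J a a) b.

Definition jD a x b : V := jquad (a + b) x - jquad a x - jquad b x.

Definition jinvertible : set V := [set a | bijective (jquad a)].

Definition jcone : set V := [set jmul J x x | x in jinvertible].

End JordanAlgebra.

(* No norm occurs here: all norms on a finite-dimensional space define the same
   topology. *)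
Record euclidean (R : realType) (V : lmodType R) (J : jordan_algebra V) : Prop
  := Euclidean {
  euclidean_findim :
    exists n (f : {linear V -> 'rV[R]_n}), bijective f;
  euclidean_dot : exists dot : V -> V -> R,
    [/\ forall x y, dot x y = dot y x,
        forall (k : R) x y z, dot (k *: x + y) z = k * dot x z + dot y z,
        forall x, x != 0 -> 0 < dot x x
      & forall a x y, dot (jmul J a x) y = dot x (jmul J a y)]
}.

Record JB_algebra (R : realType) (V : normedModType R) (J : jordan_algebra V)
  : Prop := JBAlgebra {
  JB_complete : forall F : set_system V, ProperFilter F -> cauchy F -> cvg F;
  JB_normM : forall a b, `|jmul J a b| <= `|a| * `|b|;
  JB_norm_sqr : forall a, `|jmul J a a| = `|a| ^+ 2;
  JB_norm_sqrD : forall a b, `|jmul J a a| <= `|jmul J a a + jmul J b b|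
}.

Inductive lin_span (R : realType) (U : lmodType R) (S : set U) : U -> Prop :=
| lin_span0 : lin_span S 0
| lin_spanD (k : R) s u : S s -> lin_span S u -> lin_span S (k *: s + u).

Inductive generated (T : Type) (S : set (T -> T)) : (T -> T) -> Prop :=
| generated_mem f : S f -> generated S f
| generated_id : generated S id
| generated_comp f g : generated S f -> generated S g -> generated S (f \o g)
| generated_inv f g :
    generated S f -> cancel f g -> cancel g f -> generated S g.

Definition exp_nilpotent (R : realType) (U : lmodType R) (n : nat) (f : U -> U)
  (x : U) : U := \sum_(k < n) (k`!%:R : R)^-1 *: iter k f x.

Ltac zmod_remove s c :=
  match s with
  | ?f ?r ?d => let _ := match goal with _ => unify d c end in r
  | ?f ?r ?x => let r' := zmod_remove r c in constr:(f r' x)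
  end.

Ltac zmod_cancel_with f s c lem :=
  first [rewrite lem | let r := zmod_remove s c in
  rewrite (_ : s = f r c); last first;
  [repeat (first [reflexivity | rewrite [RHS]addrAC; congr (_ + _)]) | rewrite lem]].

Ltac zmod_cancel :=
  match goal with
  | |- ?f ?s (- ?x) = 0 => zmod_cancel_with f s x addrK
  | |- ?f ?s ?x = 0 =>
    match s with context [@Algebra.opp ?Z ?y] =>
      unify x y; zmod_cancel_with f s (@Algebra.opp Z y) subrK end
  end.

Ltac zmod :=
  apply/eqP; rewrite -subr_eq0 -[eqbLHS]add0r; apply/eqP;
  rewrite !(opprD, opprK, addrA); repeat zmod_cancel; reflexivity.

Lemma zmod_lincomb (V : zmodType) (a b a' b' x y : V) :
  a = b -> a' = b' -> x - y = a - b - (a' - b') -> x = y.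
Proof. by move=> -> ->; rewrite !subrr => /eqP; rewrite subr_eq0 => /eqP. Qed.

Section Identities.
Context (R : realType) (V : lmodType R) (J : jordan_algebra V).
Local Notation "x ∘ y" := (jmul J x y) (at level 40, left associativity).
Implicit Types a b c d k x y : V.

Lemma jmulDl a b c : (a + b) ∘ c = a ∘ c + b ∘ c.
Proof. by have := jmul_linear J 1 a b c; rewrite !scale1r. Qed.

Lemma jmul0l a : 0 ∘ a = 0.
Proof. by apply: (addrI (0 ∘ a)); rewrite -jmulDl !addr0. Qed.

Lemma jmulZl (k : R) a b : (k *: a) ∘ b = k *: (a ∘ b).
Proof. by have := jmul_linear J k a 0 b; rewrite jmul0l !addr0. Qed.

Lemma jmulDr a b c : a ∘ (b + c) = a ∘ b + a ∘ c.
Proof. by rewrite !(jmulC J a) jmulDl. Qed.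

Lemma jmulZr (k : R) a b : a ∘ (k *: b) = k *: (a ∘ b).
Proof. by rewrite !(jmulC J a) jmulZl. Qed.

Lemma jmulNl a b : (- a) ∘ b = - (a ∘ b).
Proof. by rewrite -scaleN1r jmulZl scaleN1r. Qed.

Lemma jmulNr a b : a ∘ (- b) = - (a ∘ b).
Proof. by rewrite !(jmulC J a) jmulNl. Qed.


Lemma jordan_polarized a b c d :
  a ∘ ((b ∘ c) ∘ d) + b ∘ ((c ∘ a) ∘ d) + c ∘ ((a ∘ b) ∘ d) =
  (b ∘ c) ∘ (a ∘ d) + (c ∘ a) ∘ (b ∘ d) + (a ∘ b) ∘ (c ∘ d).
Proof.
pose F x y z := x ∘ ((y ∘ z) ∘ d) - (y ∘ z) ∘ (x ∘ d).
have FDl x x' y z : F (x + x') y z = F x y z + F x' y z.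
  by rewrite /F !(jmulDl, jmulDr); zmod.
have FDm x y y' z : F x (y + y') z = F x y z + F x y' z.
  by rewrite /F !(jmulDl, jmulDr); zmod.
have FC x y z : F x y z = F x z y by rewrite /F (jmulC J y).
have FDr x y z z' : F x y (z + z') = F x y z + F x y z'.
  by rewrite !(FC x y) FDm.
have F0 x : F x x x = 0 by rewrite /F jordan_identity subrr.
have half x : x + x = 0 -> x = 0.
  by rewrite -mulr2n => /eqP; rewrite -scaler_nat scaler_eq0 pnatr_eq0 => /eqP.
pose G x y := F y x x + F x x y + F x y x.
have GE x y : F (x + y) (x + y) (x + y) = F x x x + F y y y + G x y + G y x.
  by rewrite /G !(FDl, FDm, FDr); zmod.
have GN x y : G x (- y) = - G x y.
  by rewrite /G /F !(jmulNl, jmulNr); zmod.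
have NG x y : G (- x) y = G x y.
  by rewrite /G /F !(jmulNl, jmulNr); zmod.
have G0 x y : G x y = 0.
  apply: half.
  have := GE x y; rewrite !F0 !add0r => E1.
  have := GE (- x) y; rewrite !F0 !add0r NG GN => E2.
  have -> : G x y + G x y = (G x y + G y x) + (G x y - G y x) by zmod.
  by rewrite -E1 -E2 addr0.
have H : F a b c + F b c a + F c a b = 0.
  apply: half.
  have := G0 (a + b) c; have := G0 a c; have := G0 b c.
  rewrite /G !(FDl, FDm, FDr) (FC b a c) (FC a c b) (FC c b a) => E1 E2 E3.
  rewrite -[RHS]E3 -[LHS]addr0 -E1 -[LHS]addr0 -E2.
  by rewrite (FC b c a) (FC b b c) (FC a a c); zmod.
apply/eqP; rewrite -subr_eq0 -[eqbRHS]H /F; apply/eqP; zmod.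
Qed.

Local Notation inner x y z := (x ∘ (y ∘ z) - y ∘ (x ∘ z)).

Lemma inner_derivation a b c d :
  inner a b (c ∘ d) = inner a b c ∘ d + c ∘ inner a b d.
Proof.
have T1 := jordan_polarized a c d b; have T2 := jordan_polarized b c d a.
have E : a ∘ (b ∘ (c ∘ d)) + c ∘ (b ∘ (a ∘ d)) + d ∘ (b ∘ (a ∘ c)) =
         b ∘ (a ∘ (c ∘ d)) + c ∘ (a ∘ (b ∘ d)) + d ∘ (a ∘ (b ∘ c)).
  rewrite (jmulC J b (c ∘ d)) (jmulC J b (a ∘ d)) (jmulC J b (a ∘ c)).
  rewrite (jmulC J a d) T1 (jmulC J a (c ∘ d)) (jmulC J a (b ∘ d)).
  rewrite (jmulC J a (b ∘ c)) (jmulC J b d) T2 (jmulC J b a) (jmulC J c a).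
  by rewrite (jmulC J b c) (jmulC J (d ∘ b)) (jmulC J (c ∘ b)); zmod.
rewrite !(jmulDl, jmulDr, jmulNl, jmulNr).
rewrite (jmulC J (a ∘ (b ∘ c)) d) (jmulC J (b ∘ (a ∘ c)) d).
by apply: (zmod_lincomb E (erefl 0)); zmod.
Qed.

Lemma jD_E x y z : jD J x y z = 2 *: ((x ∘ y) ∘ z + inner x y z).
Proof.
rewrite /jD /jquad !(jmulDl, jmulDr) !scaler_nat !mulr2n.
by rewrite (jmulC J z x) (jmulC J z y) (jmulC J z (x ∘ y)) (jmulC J (x ∘ z) y); zmod.
Qed.

Lemma jD_comm x y u v z :
  jD J x y (jD J u v z) - jD J u v (jD J x y z) =
  jD J (jD J x y u) v z - jD J u (jD J y x v) z.
Proof.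
pose d w := inner x y w; pose p := x ∘ y.
have dD w w' : d (w + w') = d w + d w'.
  by rewrite /d !(jmulDl, jmulDr); zmod.
have dN w : d (- w) = - d w.
  by rewrite /d !(jmulNl, jmulNr); zmod.
have dM w w' : d (w ∘ w') = d w ∘ w' + w ∘ d w'.
  exact: inner_derivation.
have E w : jD J x y w = 2 *: (p ∘ w + d w) by exact: jD_E.
have E' w : jD J y x w = 2 *: (p ∘ w - d w).
  by rewrite jD_E (jmulC J y x) -(opprB (x ∘ (y ∘ w))).
have dZ (k : R) w : d (k *: w) = k *: d w.
  by rewrite /d !jmulZr scalerBr.
clearbody d p; rewrite !E E' !jD_E !(jmulZl, jmulZr, dZ) -!(scalerDr, scalerBr).
congr (_ *: (_ *: _)).
rewrite !(dD, dN, dM, jmulDl, jmulDr, jmulNl, jmulNr).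
have H1 := jordan_polarized p u v z; have H2 := inner_derivation u v p z.
rewrite !(jmulDl, jmulNl, jmulDr, jmulNr) in H2.
rewrite (jmulC J v p) in H1 H2.
rewrite (jmulC J (p ∘ u) v) (jmulC J u p) in H1 H2 *.
apply: (zmod_lincomb H1 H2).
zmod.
Qed.

End Identities.

Section KKT.
Context (R : realType) (V : lmodType R) (J : jordan_algebra V).

Definition kkt0_gen : set ((V -> V) * (V -> V)) :=
  [set (id, - id)] `|` [set (jD J p.1 p.2, - jD J p.2 p.1) | p in [set: V * V]].

Definition kkt0_pred : {pred (V -> V) * (V -> V)} :=
  fun T => `[< lin_span kkt0_gen T >].

Lemma lin_span_closed (U : lmodType R) (S : set U) (k : R) u v :
  lin_span S u -> lin_span S v -> lin_span S (k *: u + v).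
Proof.
move=> Su Sv; elim: Su => [|c s w Ss _ IH]; first by rewrite scaler0 add0r.
by rewrite scalerDr -addrA scalerA; apply: lin_spanD.
Qed.

Lemma kkt0_submod_closed : submod_closed kkt0_pred.
Proof.
split=> [|k S T]; first by apply/asboolP; exact: lin_span0.
by move=> /asboolP ? /asboolP ?; apply/asboolP; exact: lin_span_closed.
Qed.

HB.instance Definition _ := GRing.isSubmodClosed.Build R _ kkt0_pred
  kkt0_submod_closed.

Record kkt0 := Kkt0 { kkt0_val : (V -> V) * (V -> V); _ : kkt0_val \in kkt0_pred }.

HB.instance Definition _ := [isSub for kkt0_val].
HB.instance Definition _ := [Choice of kkt0 by <:].
HB.instance Definition _ := [SubChoice_isSubLmodule of kkt0 by <:].

Definition endo_comm (A B : V -> V) : V -> V := (A \o B) - (B \o A).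

Lemma kkt0_linear T : lin_span kkt0_gen T ->
  (forall (k : R) u v, T.1 (k *: u + v) = k *: T.1 u + T.1 v) /\
  (forall (k : R) u v, T.2 (k *: u + v) = k *: T.2 u + T.2 v).
Proof.
have jDlin a b (k : R) u v :
    jD J a b (k *: u + v) = k *: jD J a b u + jD J a b v.
  rewrite !jD_E !(jmulDr, jmulZr) (scalerA k) (mulrC k) -scalerA -scalerDr.
  by congr (_ *: _); rewrite !(scalerDr, scalerN); zmod.
elim=> [|c s w Ss _ [IH1 IH2]].
  by split=> k u v; rewrite /= /0 /= scaler0 addr0.
have [s1 s2] : (forall (k : R) u v, s.1 (k *: u + v) = k *: s.1 u + s.1 v) /\
    (forall (k : R) u v, s.2 (k *: u + v) = k *: s.2 u + s.2 v).
  case: Ss => [->|[[x y] _ <-]] /=; split=> k u v //.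
  - by rewrite !opprfctE /= opprD scalerN.
  - by rewrite !opprfctE jDlin opprD scalerN.
split=> k u v.
- rewrite /= !addrfctE !scalrfctE s1 IH1 !(scalerDr, scalerA) (mulrC c).
  by zmod.
- rewrite /= !addrfctE !scalrfctE s2 IH2 !(scalerDr, scalerA) (mulrC c).
  by zmod.
Qed.

Lemma kkt0_comm_closed S T : lin_span kkt0_gen S -> lin_span kkt0_gen T ->
  lin_span kkt0_gen (endo_comm S.1 T.1, endo_comm S.2 T.2).
Proof.
move=> + HT; have [T1 T2] := kkt0_linear HT.
have lin0 (f : V -> V) :
    (forall (k : R) u v, f (k *: u + v) = k *: f u + f v) -> f 0 = 0.
  by move=> H; have := H (-1) 0 0; rewrite !scaleN1r !addNr.
have commDl (A B C : V -> V) (k : R) :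
    (forall (k : R) u v, C (k *: u + v) = k *: C u + C v) ->
    endo_comm (k *: A + B) C = k *: endo_comm A C + endo_comm B C.
  move=> H; apply/funext => u.
  change (k *: A (C u) + B (C u) - C (k *: A u + B u) =
          k *: (A (C u) - C (A u)) + (B (C u) - C (B u))).
  by rewrite H scalerBr; zmod.
have commC (A B : V -> V) : endo_comm A B = - endo_comm B A.
  by rewrite /endo_comm opprB.
have commDr (A B C : V -> V) (k : R) :
    (forall (k : R) u v, C (k *: u + v) = k *: C u + C v) ->
    endo_comm C (k *: A + B) = k *: endo_comm C A + endo_comm C B.
  by move=> H; rewrite (commC C) commDl // opprD -scalerN -!(commC C).
have comm0 (C : V -> V) : (forall (k : R) u v, C (k *: u + v) = k *: C u + C v) ->
    endo_comm 0 C = 0.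
  by move=> /lin0 C0; apply/funext => u; change (0 - C 0 = 0); rewrite C0 subrr.
elim=> [|c s w Ss _ IH]; first by rewrite /= !comm0 //; exact: lin_span0.
rewrite /= !commDl //; apply: (@lin_span_closed _ _ c (endo_comm s.1 T.1, endo_comm s.2 T.2) _ _ IH).
have [s1 s2] : (forall (k : R) u v, s.1 (k *: u + v) = k *: s.1 u + s.1 v) /\
    (forall (k : R) u v, s.2 (k *: u + v) = k *: s.2 u + s.2 v).
  rewrite -(addr0 s) -(scale1r s).
  by apply: kkt0_linear; apply: lin_spanD => //; exact: lin_span0.
elim: HT {T1 T2 IH} => [|k t v St _ IH].
  by rewrite /= 2!(commC _ 0) !comm0 // oppr0; exact: lin_span0.
rewrite /= !commDr //.
apply: (@lin_span_closed _ _ k (endo_comm s.1 t.1, endo_comm s.2 t.2) _ _ IH).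
have memD (a b : V) : lin_span kkt0_gen (jD J a b, - jD J b a).
  rewrite -[X in lin_span _ X]addr0 -[X in lin_span _ (X + _)]scale1r.
  by apply: lin_spanD; [right; exists (a, b)|exact: lin_span0].
have commid A : (forall (k : R) u v, A (k *: u + v) = k *: A u + A v) ->
   endo_comm id A = 0 /\ endo_comm (- id) A = 0.
  move=> H; split; apply/funext => u; rewrite /endo_comm !(addrfctE, opprfctE) /= ?subrr //.
  have := H (-1) u 0; rewrite (lin0 _ H) !addr0 !scaleN1r => ->.
  by rewrite opprK addNr.
have [t1 t2] : (forall (k : R) u v, t.1 (k *: u + v) = k *: t.1 u + t.1 v) /\
    (forall (k : R) u v, t.2 (k *: u + v) = k *: t.2 u + t.2 v).
  rewrite -(addr0 t) -(scale1r t).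
  by apply: kkt0_linear; apply: lin_spanD => //; exact: lin_span0.
case: Ss s1 s2 => [->|[[x y] _ <-]] /= s1 s2.
  by rewrite (commid _ t1).1 (commid _ t2).2; exact: lin_span0.
case: St t1 t2 => [->|[[a b] _ <-]] /= t1 t2.
  rewrite (commC _ id) (commC _ (- id)) (commid _ s1).1 (commid _ s2).2 oppr0.
  exact: lin_span0.
have -> : (endo_comm (jD J x y) (jD J a b), endo_comm (- jD J y x) (- jD J b a)) =
   (-1) *: (jD J a (jD J y x b), - jD J (jD J y x b) a) +
   (jD J (jD J x y a) b, - jD J b (jD J x y a)) :> (V -> V) * (V -> V).
  have jDN p q u : jD J p q (- u) = - jD J p q u.
    by rewrite !jD_E !jmulNr -scalerN !(opprD, opprK).
  congr (_, _); apply/funext => u.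
    change (jD J x y (jD J a b u) - jD J a b (jD J x y u) =
      -1 *: jD J a (jD J y x b) u + jD J (jD J x y a) b u).
    by rewrite scaleN1r jD_comm addrC.
  change (- jD J y x (- jD J b a u) - - jD J b a (- jD J y x u) =
    -1 *: - jD J (jD J y x b) a u + - jD J b (jD J x y a) u).
  by rewrite !jDN !opprK scaleN1r opprK jD_comm.
exact: lin_span_closed.
Qed.

(* [(u, (A, B), v)] stands for u^+ + (A, B) + v^-. *)
Definition kkt : Type := (V * kkt0 * V)%type.

Lemma kkt0_valP (T : kkt0) : lin_span kkt0_gen (kkt0_val T).
Proof. by case: T => T /= /asboolP. Qed.

Lemma kkt0_commP (S T : kkt0) :
  (endo_comm (kkt0_val S).1 (kkt0_val T).1,
   endo_comm (kkt0_val S).2 (kkt0_val T).2) \in kkt0_pred.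
Proof. by apply/asboolP; apply: kkt0_comm_closed; exact: kkt0_valP. Qed.

Definition kkt0_bracket (S T : kkt0) : kkt0 := Kkt0 (kkt0_commP S T).

Lemma kkt0_DP x y : (jD J x y, - jD J y x) \in kkt0_pred.
Proof.
apply/asboolP; rewrite -[X in lin_span _ X]addr0 -[X in lin_span _ (X + _)]scale1r.
by apply: lin_spanD; [right; exists (x, y)|exact: lin_span0].
Qed.

Definition kkt0_D (x y : V) : kkt0 := Kkt0 (kkt0_DP x y).

Definition kkt_bracket (X Y : kkt) : kkt :=
  let: (u, T, v) := X in
  let: (u', T', v') := Y in
  ((kkt0_val T).1 u' - (kkt0_val T').1 u,
   kkt0_bracket T T' - kkt0_D u v' + kkt0_D u' v,
   (kkt0_val T).2 v' - (kkt0_val T').2 v).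

Lemma kkt0_swapP (T : kkt0) : ((kkt0_val T).2, (kkt0_val T).1) \in kkt0_pred.
Proof.
apply/asboolP; elim: (kkt0_valP T) => [|k s u Ss _ IH]; first exact: lin_span0.
have [s' Ss' Es] : exists2 s', kkt0_gen s' & (s.2, s.1) = - s'.
  case: Ss => [->|[[x y] _ <-]].
    by exists (id, - id); [left|congr (_, _); rewrite opprK].
  by exists (jD J y x, - jD J x y); [right; exists (y, x)|congr (_, _); rewrite opprK].
have -> : ((k *: s + u).2, (k *: s + u).1) = (- k) *: s' + (u.2, u.1).
  by rewrite scaleNr -scalerN -Es.
exact: lin_spanD.
Qed.

Definition kkt_swap (X : kkt) : kkt :=
  let: (u, T, v) := X in (v, Kkt0 (kkt0_swapP T), u).

Definition kkt_plus (v : V) : kkt := (v, 0, 0).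

(* [ad v^+] raises the degree of the grading (V^-, L_0, V^+) by one, so its
   cube vanishes and three terms of the exponential series suffice. *)
Definition transl (v : V) : kkt -> kkt :=
  exp_nilpotent 3 (kkt_bracket (kkt_plus v)).

Definition cotransl (v : V) : kkt -> kkt := kkt_swap \o transl v \o kkt_swap.

End KKT.

Section Geometry.
Context (R : realType) (V : lmodType R) (J : jordan_algebra V).

Definition G0_gen : set (kkt J -> kkt J) :=
  [set f | exists v, f = transl v \/ f = cotransl v].

(* The generators are automorphisms of the Lie algebra, so the subgroup they
   generate in Aut(L) is the one they generate among the bijections of L. *)
Record G0 := MkG0 {
  G0_fun :> kkt J -> kkt J;
  G0P : generated G0_gen G0_fun
}.

Lemma G0_translP v : generated G0_gen (transl v).
Proof. by apply: generated_mem; exists v; left. Qed.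

Lemma G0_cotranslP v : generated G0_gen (cotransl v).
Proof. by apply: generated_mem; exists v; right. Qed.

Definition G0_transl (v : V) : G0 := MkG0 (G0_translP v).

Definition G0_cotransl (v : V) : G0 := MkG0 (G0_cotranslP v).

Definition G0_comp (g h : G0) : G0 := MkG0 (generated_comp (G0P g) (G0P h)).

(* [h] is the element of G_0 defined by the pair (Q_y, Q_y^-1). *)
Definition quad_elem (y : V) (h : G0) : Prop :=
  exists Qi : V -> V,
  [/\ cancel (jquad J y) Qi, cancel Qi (jquad J y)
    & forall u T v, let: (u', T', v') := h (u, T, v) in
      [/\ u' = jquad J y u,
          (kkt0_val T').1 = jquad J y \o (kkt0_val T).1 \o Qi,
          (kkt0_val T').2 = Qi \o (kkt0_val T).2 \o jquad J y
        & v' = Qi v]].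

Definition parabolic : set (kkt J -> kkt J) :=
  generated [set f | (exists v, f = cotransl v) \/
                     exists y h, [/\ jinvertible J y, quad_elem y h & f = h]].

Definition coset (g : G0) : set (kkt J -> kkt J) :=
  [set G0_fun g \o p | p in parabolic].

Record geometry := Geometry {
  geometry_coset : set (kkt J -> kkt J);
  geometryP : exists g, geometry_coset = coset g
}.

Lemma actP (g : G0) (x : geometry) :
  exists h, [set G0_fun g \o f | f in geometry_coset x] = coset h.
Proof.
have [h ->] := geometryP x; exists (G0_comp g h).
rewrite /coset image_comp.
by apply: eq_imagel.
Qed.

Definition act (g : G0) (x : geometry) : geometry := Geometry (actP g x).

Lemma baseP : exists g, parabolic = coset g.
Proof.
exists (MkG0 (generated_id _)); rewrite /coset.
by rewrite (_ : _ @` _ = id @` parabolic) ?image_id //; apply: eq_imagel.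
Qed.

Definition base : geometry := Geometry baseP.

Definition emb (v : V) : geometry := act (G0_transl v) base.

(* For the bracket [x^+, y^-] = - (D_{x,y}, - D_{y,x}), it is t_e t~_e t_e, and
   not t_e t~_{-e} t_e, that extends x |-> - x^-1 (see [weyl_plus]): already for
   V = R, t~_c acts on the projective line by x |-> x / (1 - c x). *)
Definition weyl : G0 :=
  G0_comp (G0_transl (junit J))
    (G0_comp (G0_cotransl (junit J)) (G0_transl (junit J))).

Lemma weyl_plus (u : V) : weyl (u, 0, 0) = (0, 0, u).
Proof.
have mul0r a : jmul J a 0 = 0 by rewrite jmulC jmul0l.
have D0l w z : jD J 0 w z = 0.
  by rewrite jD_E !jmul0l mul0r subrr addr0 scaler0.
have D0m w z : jD J w 0 z = 0.
  by rewrite jD_E mul0r !jmul0l mul0r subrr addr0 scaler0.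
have D0r w z : jD J w z 0 = 0 by rewrite jD_E !mul0r subrr addr0 scaler0.
have De w : jD J (junit J) u w = 2 *: jmul J u w.
  by rewrite jD_E !junitP subrr addr0.
have Du w : jD J u (junit J) w = 2 *: jmul J u w.
  by rewrite jD_E (jmulC J u (junit J)) !junitP subrr addr0.
have DZ b w : jD J (junit J) (b *: u) w = b *: jD J (junit J) u w.
  by rewrite De jD_E !junitP subrr addr0 jmulZl !scalerA mulrC.
have DZ' b w : jD J (b *: u) (junit J) w = b *: jD J u (junit J) w.
  rewrite Du jD_E (jmulC J _ (junit J)) !junitP subrr addr0 jmulZl.
  by rewrite !scalerA mulrC.
pose X (a c b : R) : kkt J := (a *: u, c *: kkt0_D J (junit J) u, b *: u).
have adE a c b :
    kkt_bracket (kkt_plus J (junit J)) (X a c b) = X (- (c * 2)) (- b) 0.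
  congr (_, _, _).
  - change (0 - c *: jD J (junit J) u (junit J) = - (c * 2) *: u).
    by rewrite De jmulC junitP sub0r scaleNr scalerA.
  - apply: val_inj; congr (_, _); apply/funext => w.
      change ((0 - c *: jD J (junit J) u 0) - jD J (junit J) (b *: u) w +
        jD J (a *: u) 0 w = - b *: jD J (junit J) u w).
      by rewrite D0r D0m DZ scaler0 subrr sub0r addr0 scaleNr.
    change ((0 - c *: - jD J u (junit J) 0) - - jD J (b *: u) (junit J) w +
      - jD J 0 (a *: u) w = - b *: - jD J u (junit J) w).
    by rewrite D0r D0l DZ' oppr0 scaler0 subrr addr0 sub0r opprK scaleNr scalerN opprK.
  - change (0 - c *: (- jD J u (junit J) 0) = 0 *: u).
    by rewrite D0r oppr0 scaler0 subrr scale0r.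
have swE a c b : kkt_swap (X a c b) = X b (- c) a.
  congr (_, _, _); apply: val_inj; congr (_, _); apply/funext => w.
    change (c *: - jD J u (junit J) w = - c *: jD J (junit J) u w).
    by rewrite Du De scalerN scaleNr.
  change (c *: jD J (junit J) u w = - c *: - jD J u (junit J) w).
  by rewrite Du De scalerN scaleNr opprK.
have XD a c b a' c' b' : X a c b + X a' c' b' = X (a + a') (c + c') (b + b').
  by rewrite /X !scalerDl.
have XZ k a c b : k *: X a c b = X (k * a) (k * c) (k * b).
  by rewrite /X -!scalerA.
have trE a c b : transl (junit J) (X a c b) = X (a - c * 2 + b) (c - b) b.
  rewrite /transl; set f := kkt_bracket _.
  have fE a' c' b' : f (X a' c' b') = X (- (c' * 2)) (- b') 0 by exact: adE.
  clearbody f; rewrite /exp_nilpotent !big_ord_recl big_ord0 /= !fE !XZ addr0.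
  have -> : (bump 0 0).+1`! = 2%N by [].
  by rewrite !XD factS fact0; congr X; field.
have ctE a c b : cotransl (junit J) (X a c b) = X a (a + c) (a + c * 2 + b).
  change (kkt_swap (transl (junit J) (kkt_swap (X a c b))) =
          X a (a + c) (a + c * 2 + b)).
  by rewrite swE trE swE; congr X; ring.
have E : (u, 0, 0) =  X 1 0 0 by rewrite /X scale1r !scale0r.
change (transl (junit J) (cotransl (junit J) (transl (junit J) (u, 0, 0))) =
  (0, 0, u) :> kkt J).
rewrite E trE ctE trE.
have -> : (0, 0, u) = X 0 0 1 by rewrite /X scale1r !scale0r.
by congr X; ring.
Qed.

Definition infty : geometry := act weyl base.

Definition cyclic_order (a x b : geometry) : Prop :=
  exists g, [/\ act g a = base, act g b = infty & (emb @` jcone J) (act g x)].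

Definition cyclic_interval (a b : geometry) : set geometry :=
  [set x | cyclic_order a x b].

Definition transverse (a b : geometry) : Prop :=
  exists g, a = act g base /\ b = act g infty.

HB.instance Definition _ := gen_eqMixin geometry.
HB.instance Definition _ := gen_choiceMixin geometry.

Definition interval_geometry : Type := geometry.
HB.instance Definition _ := Choice.on interval_geometry.
HB.instance Definition _ := @isSubBaseTopological.Build interval_geometry
  (set geometry)
  [set I | exists a b, transverse a b /\ I = cyclic_interval a b] id.

Definition cyclic_interval_open : set_system geometry := @open interval_geometry.

End Geometry.

Section UsualTopology.
Context (R : realType) (V : normedModType R) (J : jordan_algebra V).

Definition usual_open : set_system (geometry J) :=
  [set U | forall g : G0 J, open [set v : V | U (act g (emb J v))]].

End UsualTopology.

(* Main.v *)
(* Idea. Writing D_{x,y} for the Jordan triple operators, an invertible [z] and its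
   inverse [y] are characterized by D_{z,y} = D_{y,z} = 2 id ([jpair]), and then
   t_z t~_y t_z exchanges V^+ and V^-. Consequently an element of G_0 fixing o and
   infinity is a product of quadratic operators Q_y, so intervals are governed by
   the single fact Q_y(Omega) = Omega, and V is open in X because t~_c acts near o
   by inversions. Under either hypothesis, a = x^2 + y^2 + t e with t > 0 has
   uniformly bounded inverses along the segment from e to a inside a closed
   associative subalgebra, so [a] is the square of an invertible element; this
   makes Omega open, relatively closed in V^x, and stable under all Q_y. For a
   JB-algebra the bound comes from ||L e - x^2|| <= L, for a Euclidean algebra
   from <x^2, v^2> >= 0. Finally the Cayley transform
   y |-> eps (y - e) (y + e)^-1 carries Omega into a ball of radius O(eps), which
   makes intervals a basis of the usual topology. *)

Require Import Defs.
From mathcomp Require Import all_boot all_order all_algebra.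
From mathcomp Require Import all_classical all_reals all_analysis.
From mathcomp Require Import finmap ring lra.
Import Order.TTheory GRing.Theory Num.Theory.
Import numFieldNormedType.Exports.

Set Implicit Arguments.
Unset Strict Implicit.
Unset Printing Implicit Defensive.

Local Open Scope classical_set_scope.
Local Open Scope ring_scope.

(** * Deciding linear identities in a module *)

Section LinearExpressions.
Context (R : realType) (V : lmodType R).

(** The two kinds of algebra enter the comparison of topologies through four facts only: a bound |a
    b| <= C |a| |b|, convergence of sequences with geometric steps, the bound
    [square_sums_resolvent], and a bound for the solutions z of (e + x^2) z = e that is uniform in
    x. The constant C is there because the norm on a Euclidean algebra is arbitrary. No spectral
    theorem is used, so a sum of two squares is not known to be a square; the summand t e, t > 0,
    gives room to extract a root, and the shift is removed afterwards by letting t be small. The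
    main obstacle is Q_y(Omega) = Omega: y and a need not lie in a common associative subalgebra, so
    a root of Q_y a cannot be written down, and an infimum over shifts by multiples of e replaces
    it. The invariance D(Q_y a, Q_y^-1 b) Q_y = Q_y D(a, b), a heavy identity if expanded in the
    product, is read off from an automorphism of the Lie algebra. *)

Inductive lexp :=
  | LVar of nat | LZero | LAdd of lexp & lexp | LOpp of lexp | LScale of R & lexp.

Fixpoint leval (s : seq V) (t : lexp) : V :=
  match t with
  | LVar i => nth 0 s i
  | LZero => 0
  | LAdd t1 t2 => leval s t1 + leval s t2
  | LOpp t1 => - leval s t1
  | LScale k t1 => k *: leval s t1
  end.

(** The test [eqn] reduces under [cbn], so that only scalar equations remain for [ring] and
    [field]. *)
Fixpoint lcoef (i : nat) (t : lexp) : R :=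
  match t with
  | LVar j => if eqn i j then 1 else 0
  | LZero => 0
  | LAdd t1 t2 => lcoef i t1 + lcoef i t2
  | LOpp t1 => - lcoef i t1
  | LScale k t1 => k * lcoef i t1
  end.

Fixpoint lcoefs_eq (i : nat) (t1 t2 : lexp) : Prop :=
  if i is j.+1 then lcoef j t1 = lcoef j t2 /\ lcoefs_eq j t1 t2 else True.

Lemma leval_coef s t : leval s t = \sum_(i < size s) lcoef i t *: nth 0 s i.
Proof.
elim: t => [j||t1 IH1 t2 IH2|t1 IH1|k t1 IH1] /=.
- have [js|sj] := ltnP j (size s).
    rewrite (bigD1 (Ordinal js)) //= (introT eqnP erefl) scale1r.
    rewrite big1 ?addr0 // => i ij.
    by case: eqnP => [E|_]; [case/eqP: ij; apply: val_inj|rewrite scale0r].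
  rewrite nth_default // big1 // => i _.
  case: eqnP => [E|_]; last by rewrite scale0r.
  by move: (ltn_ord i); rewrite E ltnNge sj.
- by rewrite big1 // => i _; rewrite scale0r.
- by rewrite IH1 IH2 -big_split; apply: eq_bigr => i _; rewrite scalerDl.
- by rewrite IH1 -sumrN; apply: eq_bigr => i _; rewrite scaleNr.
- by rewrite IH1 scaler_sumr; apply: eq_bigr => i _; rewrite scalerA.
Qed.

(** Soundness of the reflection behind [lmod]: one scalar equation for each atom of the quoted
    identity. *)
Lemma leval_eq s t1 t2 : lcoefs_eq (size s) t1 t2 -> leval s t1 = leval s t2.
Proof.
move=> H; rewrite !leval_coef; apply: eq_bigr => i _.
suff -> : lcoef i t1 = lcoef i t2 by [].
move: (nat_of_ord i) (ltn_ord i) => {i}; elim: (size s) H => //= n IH [E /IH {}IH] i.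
by rewrite ltnS leq_eqVlt => /orP[/eqP->|/IH].
Qed.

End LinearExpressions.
Arguments LVar {R}.
Arguments LZero {R}.

Ltac lmod_mem x l :=
  lazymatch l with
  | nil => constr:(false)
  | cons ?y ?l' =>
    match constr:(O) with
    | _ => let _ := match constr:(O) with _ => constr_eq x y end in constr:(true)
    | _ => lmod_mem x l'
    end
  end.

Ltac lmod_atoms t l :=
  lazymatch t with
  | (?a + ?b)%R => let l' := lmod_atoms a l in lmod_atoms b l'
  | (- ?a)%R => lmod_atoms a l
  | (_ *: ?a)%R => lmod_atoms a l
  | (@GRing.zero _)%R => l
  | _ => let m := lmod_mem t l in
         lazymatch m with true => l | false => constr:(cons t l) end
  end.

Ltac lmod_index x l :=
  lazymatch l with
  | cons ?y ?l' =>
    match constr:(O) with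
    | _ => let _ := match constr:(O) with _ => constr_eq x y end in constr:(O)
    | _ => let i := lmod_index x l' in constr:(S i)
    end
  end.

Ltac lmod_quote R t l :=
  lazymatch t with
  | (?a + ?b)%R =>
    let a' := lmod_quote R a l in let b' := lmod_quote R b l in
    constr:(@LAdd R a' b')
  | (- ?a)%R => let a' := lmod_quote R a l in constr:(@LOpp R a')
  | (?k *: ?a)%R => let a' := lmod_quote R a l in constr:(@LScale R k a')
  | (@GRing.zero _)%R => constr:(@LZero R)
  | _ => let i := lmod_index t l in constr:(@LVar R i)
  end.

(** Atoms are compared by [constr_eq]: x ∘ y and y ∘ x are different atoms, which is why explicit
    [jmulC] rewrites precede most calls. *)
Ltac lmod :=
  lazymatch goal with
  | |- @eq ?T ?x ?y =>
    let l0 := constr:(@nil T) in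
    let l1 := lmod_atoms x l0 in let l := lmod_atoms y l1 in
    lazymatch goal with R : Real.type |- _ =>
    let V := constr:(T : GRing.Lmodule.type R) in
    let x' := lmod_quote R x l in let y' := lmod_quote R y l in
    refine (@leval_eq R V l x' y' _); cbn [lcoefs_eq lcoef size eqn];
    repeat split; first [ring | by field] end
  end.

(** Exhibits the goal as a multiple of a known identity; the remaining equation is linear in the
    atoms and goes to [lmod]. *)
Lemma lincomb1 (R : realType) (V : lmodType R) (k : R) (a b x y : V) :
  a = b -> x - y = k *: (a - b) -> x = y.
Proof. by move=> ->; rewrite subrr scaler0 => /eqP; rewrite subr_eq0 => /eqP. Qed.

Lemma lincomb2 (R : realType) (V : lmodType R) (k l : R) (a b c d x y : V) :
  a = b -> c = d -> x - y = k *: (a - b) + l *: (c - d) -> x = y.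
Proof.
by move=> -> ->; rewrite !subrr !scaler0 addr0 => /eqP; rewrite subr_eq0 => /eqP.
Qed.

(** * Jordan pair identities *)

Section JordanPair.
Context (R : realType) (V : lmodType R) (J : jordan_algebra V).
Local Notation "x ∘ y" := (jmul J x y) (at level 40, left associativity).
Local Notation D := (jD J).
Local Notation Q := (jquad J).
Local Notation e := (junit J).
Implicit Types a b c u v w x y z : V.

Lemma jDDl a b y z : D (a + b) y z = D a y z + D b y z.
Proof.
by rewrite !jD_E -scalerDr; congr (_ *: _); rewrite !(jmulDl, jmulDr); lmod.
Qed.

Lemma jDC x y z : D x y z = D z y x.
Proof.
rewrite !jD_E (jmulC J x y) (jmulC J z y) (jmulC J (y ∘ x)) (jmulC J x (y ∘ z)).
by rewrite (jmulC J x z); congr (_ *: _); lmod.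
Qed.

Lemma jDDr x y a b : D x y (a + b) = D x y a + D x y b.
Proof. by rewrite !(jDC x) jDDl. Qed.

Lemma jDDm x a b z : D x (a + b) z = D x a z + D x b z.
Proof.
by rewrite !jD_E -scalerDr; congr (_ *: _); rewrite !(jmulDl, jmulDr); lmod.
Qed.

Lemma jDZl (k : R) x y z : D (k *: x) y z = k *: D x y z.
Proof.
by rewrite !jD_E !(jmulZl, jmulZr) -scalerBr -scalerDr !scalerA mulrC.
Qed.

Lemma jDZm (k : R) x y z : D x (k *: y) z = k *: D x y z.
Proof.
by rewrite !jD_E !(jmulZl, jmulZr) -scalerBr -scalerDr !(jmulZl, scalerA) mulrC.
Qed.

Lemma jDZr (k : R) x y z : D x y (k *: z) = k *: D x y z.
Proof. by rewrite !(jDC x) jDZl. Qed.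

Lemma jDNl x y z : D (- x) y z = - D x y z.
Proof. by rewrite -scaleN1r jDZl scaleN1r. Qed.

Lemma jDNm x y z : D x (- y) z = - D x y z.
Proof. by rewrite -scaleN1r jDZm scaleN1r. Qed.

Lemma jDNr x y z : D x y (- z) = - D x y z.
Proof. by rewrite -scaleN1r jDZr scaleN1r. Qed.

Lemma jD0l y z : D 0 y z = 0.
Proof. by rewrite -(scale0r 0) jDZl !scale0r. Qed.

Lemma jD0m x z : D x 0 z = 0.
Proof. by rewrite -(scale0r 0) jDZm !scale0r. Qed.

Lemma jD0r x y : D x y 0 = 0.
Proof. by rewrite jDC jD0l. Qed.

Lemma jD_diag x y : D x y x = 2 *: Q x y.
Proof.
rewrite jD_E /jquad (jmulC J (x ∘ y)) (jmulC J y x) (jmulC J y (x ∘ x)).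
lmod.
Qed.

Lemma jquad_half x y : Q x y = 2^-1 *: D x y x.
Proof. by rewrite jD_diag scalerA mulVf ?pnatr_eq0 // scale1r. Qed.

Lemma jD_unitm x z : D x e z = 2 *: (x ∘ z).
Proof. by rewrite jD_E (jmulC J x e) !junitP subrr addr0. Qed.

Lemma jD_unitl x z : D e x z = 2 *: (x ∘ z).
Proof. by rewrite jD_E !junitP subrr addr0. Qed.

Lemma jquad_unit x : Q x e = x ∘ x.
Proof. by rewrite /jquad (jmulC J x e) (jmulC J _ e) !junitP; lmod. Qed.

Lemma jquad1 x : Q e x = x.
Proof. by rewrite /jquad !junitP; lmod. Qed.

Lemma jquadD z x y : Q z (x + y) = Q z x + Q z y.
Proof. by rewrite !jquad_half jDDm scalerDr. Qed.

Lemma jquadZ z (k : R) x : Q z (k *: x) = k *: Q z x.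
Proof. by rewrite !jquad_half jDZm !scalerA mulrC. Qed.

Lemma jquadN z x : Q z (- x) = - Q z x.
Proof. by rewrite -scaleN1r jquadZ scaleN1r. Qed.

Lemma jquadB z x y : Q z (x - y) = Q z x - Q z y.
Proof. by rewrite jquadD jquadN. Qed.

Lemma jquadDl x y z : Q (x + y) z = Q x z + Q y z + D x z y.
Proof.
by rewrite !jquad_half !(jDDl, jDDr) (jDC y z x); lmod.
Qed.

Lemma jquadZl (k : R) x z : Q (k *: x) z = (k * k) *: Q x z.
Proof. by rewrite !jquad_half jDZl jDZr; lmod. Qed.

(** The two instances of [jD_comm] differ by exchanging y and z and share the term D(x, D(y,x)z)x.
    Their difference is 6 times the claim. *)
Lemma jD_jquad_swap x y z : D x y (Q x z) = D x z (Q x y).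
Proof.
have EA := jD_comm J x y x z x; have EB := jD_comm J x z x y x.
rewrite (jDC (D x y x)) in EA; rewrite (jDC (D x z x)) (jDC z x y) in EB.
rewrite !jD_diag !jDZr in EA EB; move: (D x (D y x z) x) EA EB => C EA EB.
have E3 : (6 : R) != 0 by rewrite pnatr_eq0.
apply: (scalerI E3); apply: (lincomb2 (k := 1) (l := -1) EA EB); lmod.
Qed.

(** * Inverses as pairs with D = 2 id *)

Definition jpair z y := (forall x, D z y x = 2 *: x) /\ (forall x, D y z x = 2 *: x).

Lemma jpairC z y : jpair z y -> jpair y z.
Proof. by case. Qed.

(** In the commutator of D(u,y) and D(z,y) evaluated at z, the relation D(z,y) = 2 id turns every
    term into a multiple of u except the one containing Q_z Q_y u. *)
Lemma jpair_quadK z y : jpair z y -> cancel (Q y) (Q z).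
Proof.
move=> [zy yz] u.
have := jD_comm J u y z y z.
rewrite !zy (jDC u y) !(jDZr, jDZl, zy) (jDC u y) zy (jD_diag y) jDZm jDZl.
rewrite (jDC u y) zy jD_diag => E.
have E4 : (4 : R) != 0 by rewrite pnatr_eq0.
apply: (scalerI E4); apply: (lincomb1 (k := 1) E); lmod.
Qed.

Lemma jquad_jD x y z : Q x (D y x z) = D x y (Q x z).
Proof.
have := jD_comm J x y x z x.
rewrite !(jD_diag, jDZr, jDZl) (jD_jquad_swap x y z) (jDC (Q x y)) => E.
have E2 : (2 : R) != 0 by rewrite pnatr_eq0.
apply: (scalerI E2); apply: (lincomb1 (k := 1) E); lmod.
Qed.

Lemma jpair_quad z y : jpair z y -> Q z y = z.
Proof. by case=> zy yz; rewrite jquad_half zy scalerA mulVf ?scale1r ?pnatr_eq0. Qed.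

Lemma jpair_invertible z y : jpair z y -> jinvertible J z.
Proof.
by move=> P; exists (Q y); [exact: (jpair_quadK (jpairC P))|exact: jpair_quadK].
Qed.

(** For y = Q_z^-1 z, [jD_jquad_swap] gives D(z,y) Q_z x = D(z,x) Q_z y = D(z,x) z = 2 Q_z x, and
    Q_z is onto. The relation for D(y,z) follows by intertwining with Q_z, which is injective. *)
Lemma invertible_jpair z : jinvertible J z -> exists y, jpair z y.
Proof.
case=> Qi zK Kz; exists (Qi z).
have zz : Q z (Qi z) = z by rewrite Kz.
have zy x : D z (Qi z) x = 2 *: x.
  by rewrite -(Kz x) jD_jquad_swap zz jD_diag.
by split=> // x; apply: (can_inj zK); rewrite jquad_jD zy jquadZ.
Qed.

Lemma jpair_unique z y y' : jpair z y -> jpair z y' -> y = y'.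
Proof.
move=> P P'; have /bij_inj := jpair_invertible P; apply.
by rewrite !jpair_quad.
Qed.

(** Trades an argument of the form Q_z w in V^+ for w in V^-; this matches the L_0-components in
    [weyl_ofE]. *)
Lemma jpair_jDl z y w x : jpair z y -> D (Q z w) y x = D z w x.
Proof.
move=> [zy yz]; have := jD_comm J z w z y x.
rewrite !(jD_diag, jDZr, jDZl, zy) (jDC w z y) yz jDZm => E.
have E2 : (2 : R) != 0 by rewrite pnatr_eq0.
apply: (scalerI E2); apply: (lincomb1 (k := -1) E); lmod.
Qed.

Lemma jpair_jDm z y w x : jpair z y -> D y (Q z w) x = D w z x.
Proof.
move=> [zy yz]; have := jD_comm J w z y z x.
rewrite !(jD_diag, jDZr, jDZm, yz) (jDC w z y) yz jDZl => E.
have E2 : (2 : R) != 0 by rewrite pnatr_eq0.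
apply: (scalerI E2); apply: (lincomb1 (k := 1) E); lmod.
Qed.

Lemma jpair_e : jpair e e.
Proof. by split=> x; rewrite jD_unitl junitP. Qed.

Lemma jpairZ (k : R) z y : k != 0 -> jpair z y -> jpair (k *: z) (k^-1 *: y).
Proof.
move=> k0 [zy yz]; split=> x; rewrite jDZl jDZm ?zy ?yz scalerA.
  by rewrite mulfV // scale1r.
by rewrite mulVf // scale1r.
Qed.

Lemma jpairN z y : jpair z y -> jpair (- z) (- y).
Proof. by case=> zy yz; split=> x; rewrite jDNl jDNm opprK. Qed.

(** Commuting multiplication operators kill the derivation part of D(z,y), leaving twice the
    multiplication by z y = e. This is the bridge from product inverses in a subalgebra to inverses
    in the Jordan sense. *)
Lemma jpair_comm z y : z ∘ y = e -> (forall x, z ∘ (y ∘ x) = y ∘ (z ∘ x)) ->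
  jpair z y.
Proof.
move=> zy c; split=> x; rewrite jD_E ?(jmulC J y z) zy junitP c; lmod.
Qed.

Lemma jpair_mul z y : jpair z y -> z ∘ y = e.
Proof.
move=> [/(_ e)]; rewrite jD_E !(jmulC J _ e) !junitP.
by rewrite (jmulC J y z) subrr addr0 => /scalerI -> //; rewrite pnatr_eq0.
Qed.

End JordanPair.

(** * The Kantor-Koecher-Tits algebra *)

Section LieAlgebra.
Context (R : realType) (V : lmodType R) (J : jordan_algebra V).
Local Notation "x ∘ y" := (jmul J x y) (at level 40, left associativity).
Local Notation D := (jD J).
Local Notation Q := (jquad J).
Local Notation e := (junit J).
Local Notation L := (kkt J).
Local Notation p1 T := (kkt0_val T).1.
Local Notation p2 T := (kkt0_val T).2.
Local Notation DD := (kkt0_D J).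
Implicit Types (u v w x y z : V) (S T : kkt0 J).

Lemma kkt0_ext S T : (forall x, p1 S x = p1 T x) -> (forall x, p2 S x = p2 T x) ->
  S = T.
Proof.
move=> E1 E2; apply: val_inj; case: S E1 E2 => -[S1 S2] HS; case: T => -[T1 T2] HT.
by move=> /= E1 E2; congr (_, _); apply/funext.
Qed.

Lemma kkt_ext (X Y : L) : X.1.1 = Y.1.1 -> X.1.2 = Y.1.2 -> X.2 = Y.2 -> X = Y.
Proof. by case: X => -[u T] w; case: Y => -[u' T'] w' /= -> -> ->. Qed.

Lemma p1D S T x : p1 (S + T) x = p1 S x + p1 T x. Proof. by []. Qed.
Lemma p2D S T x : p2 (S + T) x = p2 S x + p2 T x. Proof. by []. Qed.
Lemma p1N T x : p1 (- T) x = - p1 T x. Proof. by []. Qed.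
Lemma p2N T x : p2 (- T) x = - p2 T x. Proof. by []. Qed.
Lemma p1Z (k : R) T x : p1 (k *: T) x = k *: p1 T x. Proof. by []. Qed.
Lemma p2Z (k : R) T x : p2 (k *: T) x = k *: p2 T x. Proof. by []. Qed.
Lemma p1_0 x : p1 (0 : kkt0 J) x = 0. Proof. by []. Qed.
Lemma p2_0 x : p2 (0 : kkt0 J) x = 0. Proof. by []. Qed.
Lemma p1DD u v x : p1 (DD u v) x = D u v x. Proof. by []. Qed.
Lemma p2DD u v x : p2 (DD u v) x = - D v u x. Proof. by []. Qed.
Lemma p1B S T x : p1 (kkt0_bracket S T) x = p1 S (p1 T x) - p1 T (p1 S x).
Proof. by []. Qed.
Lemma p2B S T x : p2 (kkt0_bracket S T) x = p2 S (p2 T x) - p2 T (p2 S x).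
Proof. by []. Qed.

Lemma p1_lin T (k : R) u v : p1 T (k *: u + v) = k *: p1 T u + p1 T v.
Proof. by have [+ _] := kkt0_linear (kkt0_valP T); apply. Qed.
Lemma p2_lin T (k : R) u v : p2 T (k *: u + v) = k *: p2 T u + p2 T v.
Proof. by have [_ +] := kkt0_linear (kkt0_valP T); apply. Qed.

Lemma p1_add T u v : p1 T (u + v) = p1 T u + p1 T v.
Proof. by rewrite -{1}(scale1r u) p1_lin scale1r. Qed.
Lemma p2_add T u v : p2 T (u + v) = p2 T u + p2 T v.
Proof. by rewrite -{1}(scale1r u) p2_lin scale1r. Qed.
Lemma p1_zero T : p1 T 0 = 0.
Proof. by apply: (addrI (p1 T 0)); rewrite -p1_add !addr0. Qed.
Lemma p2_zero T : p2 T 0 = 0.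
Proof. by apply: (addrI (p2 T 0)); rewrite -p2_add !addr0. Qed.
Lemma p1_scale T (k : R) u : p1 T (k *: u) = k *: p1 T u.
Proof. by rewrite -[k *: u]addr0 p1_lin p1_zero addr0. Qed.
Lemma p1_opp T u : p1 T (- u) = - p1 T u.
Proof. by rewrite -scaleN1r p1_scale scaleN1r. Qed.
(** L_0 acts by derivations of the Jordan pair (V, V): on the generator (id, -id) the three signs
    add up to one, on the others this is [jD_comm]. *)
Lemma kkt0_derivation T x y z :
  p1 T (D x y z) = D (p1 T x) y z + D x (p2 T y) z + D x y (p1 T z) /\
  p2 T (D x y z) = D (p2 T x) y z + D x (p1 T y) z + D x y (p2 T z).
Proof.
elim: (kkt0_valP T) x y z => [|k s t Ss _ IH] x y z /=.
  by split; change (0 = D 0 y z + D x 0 z + D x y 0); rewrite jD0l jD0m jD0r !addr0.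
have [IH1 IH2] := IH x y z; rewrite !(addrfctE, scalrfctE) IH1 IH2.
rewrite !(jDDl, jDDr, jDDm, jDZl, jDZr, jDZm).
case: Ss => [->|[[a b] _ <-]] /=.
  by rewrite !opprfctE /= !(jDNl, jDNr, jDNm); split; lmod.
rewrite !opprfctE /= !(jDNl, jDNr, jDNm); split.
  by apply: (lincomb1 (k := k) (jD_comm J a b x y z)); rewrite ?(jDC J (D _ _ _)); lmod.
by apply: (lincomb1 (k := - k) (jD_comm J b a x y z)); rewrite ?(jDC J (D _ _ _)); lmod.
Qed.

Lemma p1_jD T x y z :
  p1 T (D x y z) = D (p1 T x) y z + D x (p2 T y) z + D x y (p1 T z).
Proof. by have [] := kkt0_derivation T x y z. Qed.

Lemma p2_jD T x y z :
  p2 T (D x y z) = D (p2 T x) y z + D x (p1 T y) z + D x y (p2 T z).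
Proof. by have [] := kkt0_derivation T x y z. Qed.

Lemma p1_jquad T x y : p1 T (Q x y) = D (p1 T x) y x + Q x (p2 T y).
Proof. by rewrite !jquad_half p1_scale p1_jD (jDC J x y); lmod. Qed.

(** The quadratic term comes from half the square of ad v^+, since D(v,w) v = 2 Q_v w. *)
Lemma translE v u T w :
  transl v (u, T, w) = (u - p1 T v + Q v w, T - DD v w, w) :> L.
Proof.
have adE u' T' w' : kkt_bracket (kkt_plus J v) (u', T', w') =
    (- p1 T' v, - DD v w', 0) :> L.
  congr (_, _, _).
  - by change (0 - p1 T' v = - p1 T' v); rewrite sub0r.
  - apply: kkt0_ext => x; rewrite !(p1D, p2D, p1N, p2N, p1B, p2B, p1_0, p2_0, p1DD, p2DD).
      by rewrite p1_zero jD0m; lmod.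
    by rewrite p2_zero jD0l; lmod.
  - by change (0 - p2 T' 0 = 0); rewrite p2_zero subrr.
rewrite /transl; set f := kkt_bracket _.
have fE u' T' w' : f (u', T', w') = (- p1 T' v, - DD v w', 0) by exact: adE.
clearbody f; rewrite /exp_nilpotent !big_ord_recl big_ord0 /= !fE.
have -> : (bump 0 0).+1`! = 2%N by [].
rewrite fact0 factS fact0.
apply: kkt_ext => /=.
- change (1^-1 *: u + ((1 * 1)%:R^-1 *: - p1 T v +
    (2^-1 *: - p1 (- DD v w) v + 0)) = u - p1 T v + Q v w).
  by rewrite p1N p1DD jD_diag opprK; lmod.
- apply: kkt0_ext => x; rewrite !(p1D, p2D, p1Z, p2Z, p1N, p2N, p1_0, p2_0, p1DD, p2DD).
    by rewrite jD0m; lmod.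
  by rewrite jD0l; lmod.
- change (1^-1 *: w + ((1 * 1)%:R^-1 *: 0 + (2^-1 *: 0 + 0)) = w).
  by lmod.
Qed.

Lemma swapE u T w : kkt_swap (u, T, w) = (w, Kkt0 (kkt0_swapP T), u) :> L.
Proof. by []. Qed.

Lemma swapK : involutive (@kkt_swap R V J).
Proof. by move=> [[u T] w]; rewrite !swapE; congr (_, _, _); exact: kkt0_ext. Qed.

Lemma cotranslE v u T w :
  cotransl v (u, T, w) = (u, T + DD u v, w - p2 T v + Q v u) :> L.
Proof.
change (kkt_swap (transl v (kkt_swap (u, T, w))) =
  (u, T + DD u v, w - p2 T v + Q v u)).
rewrite swapE translE swapE; congr (_, _, _).
apply: kkt0_ext => x; rewrite !(p1D, p2D).
  by change (p1 T x - - D u v x = p1 T x + D u v x); rewrite opprK.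
by [].
Qed.

(** Bijectivity is kept apart: wherever an inverse is wanted, it is carried as an explicit two-sided
    inverse function. *)
Definition lie_aut (g : L -> L) : Prop :=
  (forall (k : R) X Y, g (k *: X + Y) = k *: g X + g Y) /\
  (forall X Y, g (kkt_bracket X Y) = kkt_bracket (g X) (g Y)).

Lemma lie_aut_comp g h : lie_aut g -> lie_aut h -> lie_aut (g \o h).
Proof.
by move=> [g1 g2] [h1 h2]; split=> [k X Y|X Y] /=; rewrite ?h1 ?g1 ?h2 ?g2.
Qed.

Lemma lie_aut_inv g h : lie_aut g -> cancel g h -> cancel h g -> lie_aut h.
Proof.
move=> [g1 g2] gK hK; split=> [k X Y|X Y]; apply: (can_inj gK).
  by rewrite g1 !hK.
by rewrite g2 !hK.
Qed.

Lemma bracketE u T w u' T' w' :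
  kkt_bracket (u, T, w) (u', T', w') =
  (p1 T u' - p1 T' u, kkt0_bracket T T' - DD u w' + DD u' w,
   p2 T w' - p2 T' w) :> L.
Proof. by []. Qed.

Lemma lie_aut_swap : lie_aut (@kkt_swap R V J).
Proof.
split=> [k [[u T] w] [[u' T'] w']|[[u T] w] [[u' T'] w']].
  by apply: kkt_ext => //; exact: kkt0_ext.
rewrite bracketE !swapE bracketE; congr (_, _, _).
apply: kkt0_ext => x.
  change (p2 T (p2 T' x) - p2 T' (p2 T x) - - D w' u x + - D w u' x =
    p2 T (p2 T' x) - p2 T' (p2 T x) - D w u' x + D w' u x); lmod.
change (p1 T (p1 T' x) - p1 T' (p1 T x) - D u w' x + D u' w x =
    p1 T (p1 T' x) - p1 T' (p1 T x) - - D u' w x + - D u w' x); lmod.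
Qed.

(** Compared degree by degree. For the bracket, the terms quadratic in v agree in L_0 by two
    instances of [jD_comm], with factors 1/2 because Q_v w is half of D(v,w) v; in V^+ they need
    [p1_jquad], and the remaining term is [jD_jquad_swap]. *)
Lemma lie_aut_transl v : lie_aut (transl v : L -> L).
Proof.
split=> [k [[u T] w] [[u' T'] w']|[[u T] w] [[u' T'] w']].
  have -> : k *: (u, T, w) + (u', T', w') =
      (k *: u + u', k *: T + T', k *: w + w') :> L.
    by [].
  rewrite !translE; apply: kkt_ext => /=.
  - change (k *: u + u' - p1 (k *: T + T') v + Q v (k *: w + w') =
      k *: (u - p1 T v + Q v w) + (u' - p1 T' v + Q v w')).
    by rewrite p1D p1Z jquadD jquadZ; lmod.
  - apply: kkt0_ext => x; rewrite !(p1D, p2D, p1Z, p2Z, p1N, p2N, p1DD, p2DD).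
      by rewrite jDDm jDZm; lmod.
    by rewrite jDDl jDZl; lmod.
  - by [].
rewrite bracketE !translE bracketE; congr (_, _, _).
- have E := jD_jquad_swap J v w w'.
  have ET := p1_jquad T v w'; have ET' := p1_jquad T' v w.
  rewrite jquadB; move: (Q v _) (Q v _) (Q v _) (Q v _) ET ET' E => q1 q2 q3 q4 ET ET' E.
  rewrite !(p1D, p1N, p1B, p1DD, p1_add, p1_opp, ET, ET') !(jDDr, jDNr).
  rewrite (jDC J u) (jDC J u') (jDC J (p1 T v)) (jDC J (p1 T' v)).
  apply: (lincomb1 (k := 1) E); lmod.
- apply: kkt0_ext => x; rewrite !(p1D, p2D, p1N, p2N, p1B, p2B, p1DD, p2DD).
    have E1 := jD_comm J v w v w' x; have E2' := jD_comm J v w' v w x.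
    have F1 := p1_jD T v w' x; have F2 := p1_jD T' v w x.
    rewrite !jD_diag !jDZl in E1 E2'; rewrite (jDC J w v w') in E1.
    move: (Q v w) (Q v w') E1 E2' => q q' E1 E2'.
    have addp S a b : p1 S (a - b) = p1 S a - p1 S b by rewrite p1_add p1_opp.
    rewrite (addp _ _ (D v w' x)) (addp _ _ (D v w x)) F1 F2.
    rewrite (jDDr _ _ _ (p1 T' x)) (jDDr _ _ _ (p1 T x)).
    rewrite !(jDDl, jDDm, jDNl, jDNm, jDNr).
    apply: (lincomb2 (k := -2^-1) (l := 2^-1) E1 E2'); lmod.
  have E1 := jD_comm J w v w' v x; have E2' := jD_comm J w' v w v x.
  have F1 := p2_jD T w' v x; have F2 := p2_jD T' w v x.
  rewrite !jD_diag !jDZm in E1 E2'; rewrite (jDC J w' v w) in E2'.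
  move: (Q v w) (Q v w') E1 E2' => q q' E1 E2'.
  have addp S a b : p2 S (a - - b) = p2 S a + p2 S b by rewrite opprK p2_add.
  rewrite (addp _ _ (D w' v x)) (addp _ _ (D w v x)) F1 F2 !opprK.
  rewrite (jDDr _ _ _ (p2 T' x)) (jDDr _ _ _ (p2 T x)).
  rewrite !(jDDl, jDDm, jDNl, jDNm, jDNr).
  by apply: (lincomb2 (k := -2^-1) (l := 2^-1) E1 E2'); lmod.
- rewrite !(p2D, p2N, p2DD) (jDC J w v w'); lmod.
Qed.

Lemma lie_aut_cotransl v : lie_aut (cotransl v : L -> L).
Proof.
by do 2 ?apply: lie_aut_comp; [exact: lie_aut_swap|exact: lie_aut_transl|exact: lie_aut_swap].
Qed.

Lemma transl_ad v X : transl v X =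
  X + kkt_bracket (kkt_plus J v) X +
  2^-1 *: kkt_bracket (kkt_plus J v) (kkt_bracket (kkt_plus J v) X).
Proof.
rewrite /transl; set f := kkt_bracket _; clearbody f.
rewrite /exp_nilpotent !big_ord_recl big_ord0 /=.
have -> : (bump 0 0).+1`! = 2%N by [].
by rewrite fact0 factS fact0 addr0 mul1n invr1 !scale1r addrA.
Qed.

(** g exp(ad X) = exp(ad gX) g, since [transl] is a polynomial in ad v^+. The three variants below
    reduce to it by composing with the swap. *)
Lemma lie_aut_conj_transl g v v' : lie_aut g -> g (v, 0, 0) = (v', 0, 0) ->
  forall X, g (transl v X) = transl v' (g X).
Proof.
move=> [g1 g2] gv X; rewrite !transl_ad.
have gD Y Z : g (Y + Z) = g Y + g Z by rewrite -[Y]scale1r g1 !scale1r.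
have g0 : g 0 = 0 by apply: (addrI (g 0)); rewrite -gD !addr0.
have gZ k Y : g (k *: Y) = k *: g Y by rewrite -[k *: Y]addr0 g1 g0 addr0.
by rewrite !gD gZ !g2 /kkt_plus gv.
Qed.

Lemma lie_aut_conj_cotransl g v v' : lie_aut g -> g (0, 0, v) = (0, 0, v') ->
  forall X, g (cotransl v X) = cotransl v' (g X).
Proof.
move=> ag gv X.
have := @lie_aut_conj_transl (@kkt_swap R V J \o g \o @kkt_swap R V J) v v'.
have s0 : Kkt0 (kkt0_swapP (0 : kkt0 J)) = 0 by exact: kkt0_ext.
move=> /(_ _ _ (kkt_swap X)) H.
rewrite /cotransl /= -[X in _ = kkt_swap (transl v' (kkt_swap (g X)))]swapK -H /=.
- by rewrite swapK.
- by apply: lie_aut_comp; [apply: lie_aut_comp => //|]; exact: lie_aut_swap.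
- by rewrite /= s0 gv /= s0.
Qed.

Lemma lie_aut_conj_swap g v v' : lie_aut g -> g (v, 0, 0) = (0, 0, v') ->
  forall X, g (transl v X) = cotransl v' (g X).
Proof.
move=> ag gv X.
have s0 : Kkt0 (kkt0_swapP (0 : kkt0 J)) = 0 by exact: kkt0_ext.
have := @lie_aut_conj_transl (@kkt_swap R V J \o g) v v'.
move=> /(_ _ _ X) /= H; rewrite /cotransl /= -H ?swapK //.
  by apply: lie_aut_comp => //; exact: lie_aut_swap.
by rewrite gv /= s0.
Qed.

Lemma lie_aut_conj_coswap g v v' : lie_aut g -> g (0, 0, v) = (v', 0, 0) ->
  forall X, g (cotransl v X) = transl v' (g X).
Proof.
move=> ag gv X.
have s0 : Kkt0 (kkt0_swapP (0 : kkt0 J)) = 0 by exact: kkt0_ext.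
have := @lie_aut_conj_transl (g \o @kkt_swap R V J) v v'.
move=> /(_ _ _ (kkt_swap X)) /= H; rewrite /cotransl /= H ?swapK //.
  by apply: lie_aut_comp => //; exact: lie_aut_swap.
by rewrite /= s0.
Qed.

Lemma translD u v X : transl u (transl v X) = transl (u + v) X :> L.
Proof.
case: X => -[x T] w; rewrite !translE; congr (_, _, _).
  by rewrite p1D p1N p1DD p1_add jquadDl (jDC J u) (jDC J v); lmod.
apply: kkt0_ext => y; rewrite !(p1D, p1N, p1DD, p2D, p2N, p2DD) ?jDDl ?jDDm; lmod.
Qed.

Lemma transl0 X : transl 0 X = X :> L.
Proof.
case: X => -[x T] w; rewrite translE; congr (_, _, _).
  by rewrite p1_zero jquad_half jD0l; lmod.
by apply: kkt0_ext => y; rewrite !(p1D, p1N, p1DD, p2D, p2N, p2DD) ?jD0l ?jD0m; lmod.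
Qed.

Lemma cotranslD u v X : cotransl u (cotransl v X) = cotransl (u + v) X :> L.
Proof. by rewrite /cotransl /= swapK translD. Qed.

Lemma cotransl0 X : cotransl 0 X = X :> L.
Proof. by rewrite /cotransl /= transl0 swapK. Qed.

Lemma translK v : cancel (transl v : L -> L) (transl (- v)).
Proof. by move=> X; rewrite translD addNr transl0. Qed.

Lemma translNK v : cancel (transl (- v) : L -> L) (transl v).
Proof. by move=> X; rewrite translD subrr transl0. Qed.

Lemma cotranslK v : cancel (cotransl v : L -> L) (cotransl (- v)).
Proof. by move=> X; rewrite cotranslD addNr cotransl0. Qed.

Lemma cotranslNK v : cancel (cotransl (- v) : L -> L) (cotransl v).
Proof. by move=> X; rewrite cotranslD subrr cotransl0. Qed.

(* For an invertible [z] with inverse [y], this extends x |-> - Q_z x^-1. *)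
Definition weyl_of z y : L -> L := transl z \o (cotransl y \o transl z).

Lemma lie_aut_weyl z y : lie_aut (weyl_of z y).
Proof.
by apply: lie_aut_comp; [|apply: lie_aut_comp]; rewrite ?lie_aut_transl //;
  [exact: lie_aut_transl|exact: lie_aut_cotransl|exact: lie_aut_transl].
Qed.

Lemma weyl_ofE z y u T w : jpair J z y ->
  weyl_of z y (u, T, w) = (Q z w, T - DD (p1 T z) y, Q y u).
Proof.
move=> P; have [zy yz] := P; have P' := jpairC P.
(* Obtained by letting the derivation T act on Q_z y = z. *)
have Tz : Q y (p1 T z) = - p2 T y.
  have := p1_jquad T z y; rewrite (jpair_quad P) (jDC J _ y z) zy => E.
  rewrite (_ : p1 T z = - Q z (p2 T y)) ?jquadN ?(jpair_quadK P') //.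
  by apply: (lincomb1 (k := -1) E); lmod.
rewrite /weyl_of /= translE cotranslE translE.
have E3 : w - p2 (T - DD z w) y + Q y (u - p1 T z + Q z w) = Q y u.
  rewrite p2D p2N p2DD (jDC J w) yz jquadD jquadB Tz (jpair_quadK P').
  by rewrite opprK; lmod.
congr (_, _, _).
- rewrite E3 !(p1D, p1N, p1DD) (jDC J _ y z) jD_diag zy (jpair_quadK P).
  by lmod.
- rewrite E3; apply: kkt0_ext => x; rewrite !(p1D, p1N, p1DD, p2D, p2N, p2DD).
    rewrite jDDl jDDl jDNl (jpair_jDl _ _ P) (jpair_jDm _ _ P'); lmod.
  rewrite (jDDm _ y) (jDDm _ y) jDNm (jpair_jDm _ _ P) (jpair_jDl _ _ P'); lmod.
- exact: E3.
Qed.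

Lemma weyl_plusE a a' u : jpair J a a' -> weyl_of a a' (u, 0, 0) = (0, 0, Q a' u) :> L.
Proof.
move=> P; rewrite (weyl_ofE _ _ _ P); congr (_, _, _).
  by rewrite jquad_half jD0m scaler0.
by apply: kkt0_ext => x; rewrite !(p1D, p2D, p1N, p2N, p1DD, p2DD, p1_0, p2_0) ?jD0l ?jD0m; lmod.
Qed.

Lemma weyl_minusE a a' w : jpair J a a' -> weyl_of a a' (0, 0, w) = (Q a w, 0, 0) :> L.
Proof.
move=> P; rewrite (weyl_ofE _ _ _ P); congr (_, _, _).
  by apply: kkt0_ext => x; rewrite !(p1D, p2D, p1N, p2N, p1DD, p2DD, p1_0, p2_0) ?jD0l ?jD0m; lmod.
by rewrite jquad_half jD0m scaler0.
Qed.

(** The product H of two Weyl elements acts by Q_y on V^+ and by Q_y' on V^-. Being a Lie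
    homomorphism, it preserves the triple bracket [[a^+, b^-], u^+] = -(D(a,b) u)^+. *)
Lemma jpair_jD_jquad y y' a b u : jpair J y y' ->
  D (Q y a) (Q y' b) (Q y u) = Q y (D a b u).
Proof.
move=> P; have Pe := jpair_e J; pose H := weyl_of e e \o weyl_of y' y.
have aH : lie_aut H by apply: lie_aut_comp; exact: lie_aut_weyl.
have Hp x : H (x, 0, 0) = (Q y x, 0, 0).
  by rewrite /H /= (weyl_plusE _ (jpairC P)) (weyl_minusE _ Pe) jquad1.
have Hm x : H (0, 0, x) = (0, 0, Q y' x).
  by rewrite /H /= (weyl_minusE _ (jpairC P)) (weyl_plusE _ Pe) jquad1.
have br x z w : kkt_bracket (kkt_bracket (x, 0, 0) (0, 0, z)) (w, 0, 0) =
    (- D x z w, 0, 0) :> L.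
  have -> : kkt_bracket (x, 0, 0) (0, 0, z) = (0, - DD x z, 0) :> L.
    rewrite bracketE !(p1_0, p2_0) subrr; congr (_, _, _).
    apply: kkt0_ext => v; rewrite !(p1D, p2D, p1N, p2N, p1B, p2B, p1_0, p2_0, p1DD, p2DD).
      by rewrite jD0m; lmod.
    by rewrite jD0l; lmod.
  rewrite bracketE p1N p1DD !(p1_0, p2_0) p2_zero subr0 subrr; congr (_, _, _).
  apply: kkt0_ext => v; rewrite !(p1D, p2D, p1N, p2N, p1B, p2B, p1_0, p2_0, p1DD, p2DD).
    by rewrite ?(jD0m, jD0l, jD0r); lmod.
  by rewrite ?(jD0m, jD0l, jD0r); lmod.
have {aH} [_ HB] := aH; clearbody H.
have := congr1 H (br a b u); rewrite !HB (Hp a) (Hm b) (Hp u) br (Hp (- D a b u)) => -[/eqP].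
by rewrite jquadN eqr_opp => /eqP.
Qed.

Lemma jpair_jquad y y' z z' : jpair J y y' -> jpair J z z' ->
  jpair J (Q y z) (Q y' z').
Proof.
move=> Py [zz zz']; have Py' := jpairC Py; split=> x.
  by rewrite -{1}(jpair_quadK Py x) (jpair_jD_jquad _ _ _ Py) zz jquadZ (jpair_quadK Py).
by rewrite -{1}(jpair_quadK Py' x) (jpair_jD_jquad _ _ _ Py') zz' jquadZ (jpair_quadK Py').
Qed.

End LieAlgebra.

(** * Points of the geometry *)

Section GeometryPoints.
Context (R : realType) (V : lmodType R) (J : jordan_algebra V).
Local Notation D := (jD J).
Local Notation Q := (jquad J).
Local Notation e := (junit J).
Local Notation L := (kkt J).
Local Notation p1 T := (kkt0_val T).1.
Local Notation p2 T := (kkt0_val T).2.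
Local Notation DD := (kkt0_D J).
Implicit Types (u v w y z a c : V) (T : kkt0 J) (g : G0 J) (h : L -> L) (A B : V -> V).

Lemma generated_bij (S : set (L -> L)) f :
  (forall f, S f -> lie_aut f /\ exists h, cancel f h /\ cancel h f) ->
  generated S f ->
  lie_aut f /\ exists h, [/\ generated S h, cancel f h & cancel h f].
Proof.
move=> HS; elim=> {f} [f Sf| |f g _ [af [f' [Sf' fK Kf]]] _ [ag [g' [Sg' gK Kg]]]|
  f g Sf [af [f' [Sf' fK Kf]]] fgK gfK].
- have [af [g [fK gK]]] := HS _ Sf; split=> //; exists g; split=> //.
  exact: generated_inv (generated_mem Sf) fK gK.
- by split=> //; exists id; split=> //; exact: generated_id.
- split; first exact: lie_aut_comp.
  exists (g' \o f'); split; [exact: generated_comp|exact: can_comp|exact: can_comp].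
- by split; [exact: lie_aut_inv af fgK gfK|exists f].
Qed.

Lemma G0_gen_aut f : G0_gen f -> lie_aut f /\ exists h, cancel f h /\ cancel h f.
Proof.
move=> [v [->|->]]; split; [exact: lie_aut_transl| |exact: lie_aut_cotransl|].
  by exists (transl (- v)); split; [exact: translK|exact: translNK].
by exists (cotransl (- v)); split; [exact: cotranslK|exact: cotranslNK].
Qed.

Lemma G0_aut g : lie_aut g.
Proof. by have [] := generated_bij G0_gen_aut (G0P g). Qed.

Lemma G0_inv g : exists h : G0 J, cancel g h /\ cancel h g.
Proof.
have [_ [h [Gh gK hK]]] := generated_bij G0_gen_aut (G0P g).
by exists (MkG0 Gh).
Qed.

Definition G0_weyl z y : G0 J :=
  G0_comp (G0_transl J z) (G0_comp (G0_cotransl J y) (G0_transl J z)).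

(** * Structure of the parabolic subgroup *)

Inductive qprod : (V -> V) -> Prop :=
| qprod_id : qprod id
| qprod_cons y A : jinvertible J y -> qprod A -> qprod (Q y \o A).

Lemma qprod1 y : jinvertible J y -> qprod (Q y).
Proof. by move=> iy; exact: (qprod_cons iy qprod_id). Qed.

Lemma qprod_comp A B : qprod A -> qprod B -> qprod (A \o B).
Proof. by move=> qA qB; elim: qA => // y A' iy _; exact: qprod_cons. Qed.

(* [A], [B] and [A'], [B'] are the actions of [h] and its inverse on V^+ and V^-. *)
Definition levi (h : L -> L) A B : Prop :=
  exists (hi : L -> L) A' B',
  [/\ lie_aut h, cancel h hi & cancel hi h] /\
  [/\ forall u, h (u, 0, 0) = (A u, 0, 0), forall w, h (0, 0, w) = (0, 0, A' w),
      forall u, hi (u, 0, 0) = (B u, 0, 0) & forall w, hi (0, 0, w) = (0, 0, B' w)] /\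
  (qprod A /\ qprod B).

Lemma levi_id : levi id id id.
Proof. by exists id, id, id; split=> //; split=> //; split; exact: qprod_id. Qed.

Lemma levi_comp h h' A B A' B' : levi h A B -> levi h' A' B' ->
  levi (h \o h') (A \o A') (B' \o B).
Proof.
move=> [hi [C [E [[a hK Kh] [[h1 h2 h3 h4] [qA qB]]]]]].
move=> [hi' [C' [E' [[a' hK' Kh'] [[h1' h2' h3' h4'] [qA' qB']]]]]].
exists (hi' \o hi), (C \o C'), (E' \o E); split.
  by split; [exact: lie_aut_comp|exact: can_comp|exact: can_comp].
split; last by split; exact: qprod_comp.
by split=> u /=; rewrite ?h1' ?h2' ?h3 ?h4 ?h1 ?h2 ?h3' ?h4'.
Qed.

Lemma leviE h A B : levi h A B -> forall u, h (u, 0, 0) = (A u, 0, 0).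
Proof. by case=> [hi [C [E [_ [[h1 _ _ _] _]]]]]. Qed.

Lemma levi_qprod h A B : levi h A B -> qprod A /\ qprod B.
Proof. by case=> [hi [C [E [_ [_ qAB]]]]]. Qed.

Lemma leviK h A B : levi h A B -> cancel A B /\ cancel B A.
Proof.
case=> [hi [C [E [[_ hK Kh] [[h1 _ h3 _] _]]]]]; split=> u.
  by have := hK (u, 0, 0); rewrite h1 h3 => -[].
by have := Kh (u, 0, 0); rewrite h3 h1 => -[].
Qed.

Lemma quad_elem_levi y (h : G0 J) : jinvertible J y -> quad_elem y h ->
  exists B, levi h (Q y) B.
Proof.
move=> iy [Qi [QK KQ HE]]; have [h' [hK Kh]] := G0_inv h.
have Qi0 : Qi 0 = 0 by apply: (can_inj QK); rewrite KQ -(scale0r 0) jquadZ !scale0r.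
have Q0 : Q y 0 = 0 by rewrite -{1}Qi0 KQ.
have h1 u w : h (u, 0, w) = (Q y u, 0, Qi w).
  have := HE u 0 w; case: (h _) => -[u' T'] w' [-> E1 E2 ->].
  congr (_, _, _); apply: kkt0_ext => x; rewrite ?E1 ?E2.
    by change (Q y 0 = 0).
  by change (Qi 0 = 0).
have [y' P] := invertible_jpair iy.
have QiE : Qi = Q y'.
  by apply/funext => x; apply: (can_inj QK); rewrite KQ (jpair_quadK P).
exists Qi, h', Qi, (Q y); split; first by split=> //; exact: G0_aut.
split.
  split=> u; [by rewrite h1 Qi0|by rewrite h1 Q0| |].
    by rewrite -[RHS]hK h1 KQ Qi0.
  by rewrite -[RHS]hK h1 QK Q0.
by split; [exact: qprod1|rewrite QiE; apply/qprod1/(jpair_invertible (jpairC P))].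
Qed.

(** Elements preserving the grading normalize the group of all t~_c, as h t~_c = t~_{h c} h; so
    products and inverses can again be sorted into this form. *)
Lemma parabolic_decomp (p : L -> L) : parabolic p ->
  exists c h A B, levi h A B /\ p = cotransl c \o h.
Proof.
elim=> {p} [p [[v ->]|[y [h [iy qh ->]]]]| |f g _ [c [h [A [B [lh ->]]]]]
  _ [c' [h' [A' [B' [lh' ->]]]]]|f g _ [c [h [A [B [lh ->]]]]] fK Kf].
- by exists v, id, id, id; split=> //; exact: levi_id.
- have [B lh] := quad_elem_levi iy qh; exists 0, h, (Q y), B; split=> //.
  by apply/funext => X /=; rewrite cotransl0.
- exists 0, id, id, id; split; first exact: levi_id.
  by apply/funext => X /=; rewrite cotransl0.
- have [hi [C [E [[ah hK Kh] [[h1 h2 h3 h4] qAB]]]]] := lh.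
  exists (c + C c'), (h \o h'), (A \o A'), (B' \o B); split; first exact: levi_comp.
  by apply/funext => X /=; rewrite (lie_aut_conj_cotransl ah (h2 c')) cotranslD.
- have [hi [C [E [[ah hK Kh] [[h1 h2 h3 h4] [qA qB]]]]]] := lh.
  have ahi := lie_aut_inv ah hK Kh.
  exists (E (- c)), hi, B, A; split; first by exists h, E, C.
  apply/funext => X /=; rewrite -(lie_aut_conj_cotransl ahi (h4 (- c))).
  by apply: (can_inj fK); rewrite Kf /= Kh cotranslNK.
Qed.

Lemma parabolic_inv (p : L -> L) : parabolic p ->
  exists q : L -> L, [/\ parabolic q, cancel p q & cancel q p].
Proof.
move=> Pp; have [c [h [A [B [[hi [C [E [[ah hK Kh] _]]]] Ep]]]]] := parabolic_decomp Pp.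
have fK : cancel p (hi \o cotransl (- c)).
  by move=> X; rewrite Ep /= cotranslK hK.
have Kf : cancel (hi \o cotransl (- c)) p by move=> X; rewrite Ep /= Kh cotranslNK.
by exists (hi \o cotransl (- c)); split=> //; exact: generated_inv Pp fK Kf.
Qed.

Lemma parabolic_cotransl v : parabolic (cotransl v : L -> L).
Proof. by apply: generated_mem; left; exists v. Qed.

(** The L_0-component of h X is recovered by bracketing with V^+ and V^-, so the action on the outer
    components determines the pair (Q_y, Q_y^-1). *)
Lemma parabolic_quad y y' (h : G0 J) : jpair J y y' ->
  (forall X, (h X).1.1 = Q y X.1.1 /\ (h X).2 = Q y' X.2) ->
  (forall u, h (u, 0, 0) = (Q y u, 0, 0)) -> (forall w, h (0, 0, w) = (0, 0, Q y' w)) ->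
  quad_elem y h /\ parabolic h.
Proof.
move=> P hE h1 h2.
have K := jpair_quadK P; have K' := jpair_quadK (jpairC P).
have [_ aB] := G0_aut h.
have qh : quad_elem y h.
  exists (Q y'); split=> // u T w.
  have := hE (u, T, w); case Eh : (h (u, T, w)) => [[u' T'] w'] /= [Eu Ew].
  split=> //; apply/funext => x /=.
    have := aB (u, T, w) (Q y' x, 0, 0); rewrite h1 Eh !bracketE K => E.
    have := congr1 (fun Y : L => Y.1.1) E; rewrite (hE _).1.
    by change (Q y (p1 T (Q y' x) - 0) = p1 T' x - 0 -> p1 T' x = Q y (p1 T (Q y' x)));
      rewrite !subr0.
  have := aB (u, T, w) (0, 0, Q y x); rewrite h2 Eh !bracketE K' => E.
  have := congr1 (fun Y : L => Y.2) E; rewrite (hE _).2.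
  by change (Q y' (p2 T (Q y x) - 0) = p2 T' x - 0 -> p2 T' x = Q y' (p2 T (Q y x)));
    rewrite !subr0.
split=> //; apply: generated_mem; right; exists y, h; split=> //.
exact: jpair_invertible P.
Qed.

(** Realizes the pair (Q_y, Q_y^-1) inside G_0 as a product of two Weyl elements. *)
Lemma quad_elem_weyl y y' : jpair J y y' ->
  quad_elem y (G0_comp (weyl J) (G0_weyl y' y)) /\
  parabolic (G0_comp (weyl J) (G0_weyl y' y)).
Proof.
move=> P; have P' := jpairC P; have Pe := jpair_e J.
apply: (parabolic_quad P) => [[[u T] w]|u|w].
- change ((weyl_of e e (weyl_of y' y (u, T, w))).1.1 = Q y u /\
    (weyl_of e e (weyl_of y' y (u, T, w))).2 = Q y' w).
  by rewrite (weyl_ofE _ _ _ P') (weyl_ofE _ _ _ Pe) !jquad1.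
- change (weyl_of e e (weyl_of y' y (u, 0, 0)) = (Q y u, 0, 0) :> L).
  by rewrite (weyl_plusE _ P') (weyl_minusE _ Pe) jquad1.
- change (weyl_of e e (weyl_of y' y (0, 0, w)) = (0, 0, Q y' w) :> L).
  by rewrite (weyl_minusE _ P') (weyl_plusE _ Pe) jquad1.
Qed.

Lemma parabolic_weyl_unit y y' : jpair J y y' ->
  parabolic (weyl_of y y' \o weyl_of e e : L -> L).
Proof.
move=> P; have Pe := jpair_e J.
have [|||_] := @parabolic_quad y y' (G0_comp (G0_weyl y y') (weyl J)) P; last by [].
- move=> [[u T] w]; change ((weyl_of y y' (weyl_of e e (u, T, w))).1.1 = Q y u /\
    (weyl_of y y' (weyl_of e e (u, T, w))).2 = Q y' w).
  by rewrite (weyl_ofE _ _ _ Pe) (weyl_ofE _ _ _ P) !jquad1.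
- move=> u; change (weyl_of y y' (weyl_of e e (u, 0, 0)) = (Q y u, 0, 0) :> L).
  by rewrite (weyl_plusE _ Pe) (weyl_minusE _ P) jquad1.
- move=> w; change (weyl_of y y' (weyl_of e e (0, 0, w)) = (0, 0, Q y' w) :> L).
  by rewrite (weyl_minusE _ Pe) (weyl_plusE _ P) jquad1.
Qed.

Lemma weyl_unitK : involutive (weyl_of e e : L -> L).
Proof.
move=> [[u T] w]; have Pe := jpair_e J.
rewrite !(weyl_ofE _ _ _ Pe) !jquad1; congr (_, _, _).
apply: kkt0_ext => x; rewrite !(p1D, p2D, p1N, p2N, p1DD, p2DD).
  rewrite (jD_unitm J _ e) (jmulC J _ e) junitP jDDl jDNl jDZl; lmod.
by rewrite (jD_unitm J _ e) (jmulC J _ e) junitP jDDm jDNm jDZm; lmod.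
Qed.

(** The involution [weyl_of e e] is inserted twice between the factors; each half is then a
    quadratic element. *)
Lemma parabolic_weyl_weyl a a' z z' : jpair J a a' -> jpair J z z' ->
  parabolic (weyl_of a a' \o weyl_of z z' : L -> L).
Proof.
move=> Pa Pz; have [_ Pw] := quad_elem_weyl (jpairC Pz).
have -> : weyl_of a a' \o weyl_of z z' =
    (weyl_of a a' \o weyl_of e e) \o (weyl_of e e \o weyl_of z z') :> (L -> L).
  by apply/funext => X /=; rewrite [in RHS](weyl_unitK).
by apply: generated_comp => //; exact: parabolic_weyl_unit Pa.
Qed.

(** W = [weyl_of z z'] conjugates t_z into t~_{z'}, because Q_{z'} z = z'. Hence W = t~_{z'} W
    t_{-z}, where the last factor t_z of W cancels. *)
Lemma weyl_braid z z' : jpair J z z' ->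
  weyl_of z z' = cotransl z' \o (transl z \o cotransl z') :> (L -> L).
Proof.
move=> P; apply/funext => X /=.
have := lie_aut_conj_swap (lie_aut_weyl J z z') (weyl_plusE z P) (transl (- z) X).
by rewrite (jpair_quad (jpairC P)) translNK /weyl_of /= translNK.
Qed.

(** * The action of G_0 in the chart V *)

Lemma geometry_ext (x y : geometry J) : geometry_coset x = geometry_coset y -> x = y.
Proof.
case: x => X HX; case: y => Y HY /= E; subst Y.
by rewrite (Prop_irrelevance HX HY).
Qed.

Lemma act_base_eq g (h : G0 J) :
  act g (base J) = act h (base J) <-> exists2 p : L -> L, parabolic p & G0_fun g = h \o p.
Proof.
split=> [E|[p Pp E]].
  have : coset g g by exists id => //; exact: generated_id.
  rewrite (_ : coset g = coset h); last exact: (congr1 (@geometry_coset R V J) E).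
  by case=> p Pp <-; exists p.
apply: geometry_ext; rewrite /=.
have [q [Pq pK qK]] := parabolic_inv Pp.
apply/seteqP; split=> _ [r Pr <-].
  by exists (p \o r); [exact: generated_comp|rewrite E].
exists (q \o r); first exact: generated_comp.
by rewrite E; apply/funext => X /=; rewrite qK.
Qed.

Lemma act_comp g (h : G0 J) x : act (G0_comp g h) x = act g (act h x).
Proof. by apply: geometry_ext; rewrite /= image_comp; apply: eq_imagel. Qed.

Lemma act_fun_eq g (h : G0 J) x : (g : L -> L) = h -> act g x = act h x.
Proof. by move=> E; apply: geometry_ext; rewrite /= E. Qed.

Lemma act_can g (h : G0 J) x : cancel h g -> act g (act h x) = x.
Proof.
move=> hK; apply: geometry_ext; rewrite /= image_comp -[RHS]image_id.
by apply: eq_imagel => f _ /=; apply/funext => X /=; rewrite hK.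
Qed.

Lemma geometry_act x : exists g, x = act g (base J).
Proof. by have [g E] := geometryP x; exists g; apply: geometry_ext. Qed.

(** P maps V^- into itself, whereas t_u sends e^- to a vector whose L_0-component takes e to -D(u,e)
    e = -2 u; here u = v - v'. *)
Lemma emb_inj : injective (emb J).
Proof.
move=> v v' /act_base_eq[p Pp E].
have [c [h [A [B [[hi [C [C' [_ [[_ h2 _ _] _]]]]] Ep]]]]] := parabolic_decomp Pp.
have : transl (- v') (transl v (0, 0, e)) = p (0, 0, e) :> L.
  have Ee := congr1 (@^~ (0, 0, e)) E.
  change (transl v (0, 0, e) = transl v' (p (0, 0, e))) in Ee.
  by rewrite Ee translK.
rewrite translD translE Ep /= h2 cotranslE.
move=> /(congr1 (fun X : L => p1 X.1.2 e)).
change (p1 (0 - DD (- v' + v) e) e = p1 (0 + DD 0 c) e -> v = v').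
rewrite !(p1D, p1N, p1DD, p1_0) jD_unitm jmulC junitP jD0l => E'.
have E2 : (2 : R) != 0 by rewrite pnatr_eq0.
by apply: (scalerI E2); apply: (lincomb1 (k := -1) E'); lmod.
Qed.

Lemma act_transl u v : act (G0_transl J u) (emb J v) = emb J (u + v).
Proof.
rewrite /emb -act_comp; apply: act_fun_eq; apply/funext => X /=.
exact: translD.
Qed.

Lemma emb0 : emb J 0 = base J.
Proof.
apply: geometry_ext; rewrite /= -[RHS]image_id; apply: eq_imagel => f _.
by apply/funext => X /=; rewrite transl0.
Qed.

Lemma act_levi g A B v : parabolic g -> levi g A B ->
  act g (emb J v) = emb J (A v).
Proof.
move=> Pg lg; rewrite /emb -act_comp; apply/act_base_eq; exists g => //.
by apply/funext => X /=; exact: (lie_aut_conj_transl (G0_aut g) (leviE lg v)).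
Qed.

(* By the braid relation, t_z = t~_{-z'} W t~_{-z'} where W = [weyl_of z z']. *)
Lemma act_weyl a a' z z' : jpair J a a' -> jpair J z z' ->
  act (G0_weyl a a') (emb J z) = emb J (- Q a z').
Proof.
move=> Pa Pz; rewrite /emb -act_comp; apply/act_base_eq.
exists ((weyl_of a a' \o weyl_of z z') \o cotransl (- z')).
  by apply: generated_comp; [exact: parabolic_weyl_weyl|exact: parabolic_cotransl].
apply/funext => X /=.
have -> : transl z X = cotransl (- z') (weyl_of z z' (cotransl (- z') X)).
  by rewrite (weyl_braid Pz) /= cotranslK cotranslNK.
change (weyl_of a a' (cotransl (- z') (weyl_of z z' (cotransl (- z') X))) =
  transl (- Q a z') (weyl_of a a' (weyl_of z z' (cotransl (- z') X)))).
have := lie_aut_conj_coswap (lie_aut_weyl J a a') (weyl_minusE (- z') Pa).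
by move=> ->; rewrite jquadN.
Qed.

Lemma act_weyl_unit z z' : jpair J z z' -> act (weyl J) (emb J z) = emb J (- z').
Proof. by move=> P; rewrite (act_weyl (jpair_e J) P) jquad1. Qed.

(** From [weyl_of a c] = t_a t~_c t_a, the map t~_c is t_{-a}, then the Weyl element, then t_{-a}
    again. *)
Lemma act_cotransl c a v z' : jpair J a c -> jpair J (v - a) z' ->
  act (G0_cotransl J c) (emb J v) = emb J (- a - Q a z').
Proof.
move=> Pa Pz; rewrite -(act_transl _ (- Q a z')) -(act_weyl Pa Pz).
rewrite (addrC v) -act_transl -!act_comp; apply: act_fun_eq; apply/funext => X /=.
by rewrite translK translNK.
Qed.

(** Fixing o gives g = t~_c h with h preserving the grading. Fixing infinity puts the conjugate of g
    by w into P, which preserves V^-; so g maps V^+, the image of V^- under w, into V^+. As t~_c e^+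
    has the L_0-component D(e,c), whose value at e is 2 c, this forces c = 0. *)
Lemma stabilizer_levi g :
  act g (base J) = base J -> act g (infty J) = infty J ->
  parabolic g /\ exists A B, levi g A B.
Proof.
move=> go gi.
have Pg : parabolic g.
  have [_ H] := act_base_eq g (G0_transl J 0).
  have /act_base_eq[p Pp Ep] : act g (base J) = act (G0_transl J 0) (base J).
    by rewrite go -[LHS]emb0.
  by rewrite (_ : G0_fun g = p) // Ep; apply/funext => X /=; rewrite transl0.
split=> //; have [c [h [A [B [lh Eg]]]]] := parabolic_decomp Pg.
have /act_base_eq[p Pp Ep] : act (G0_comp g (weyl J)) (base J) = act (weyl J) (base J).
  by rewrite act_comp.
have [c' [h' [A' [B' [[hi' [C [C' [_ [[_ h2 _ _] _]]]]] E']]]]] := parabolic_decomp Pp.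
have Pe := jpair_e J; have [_ BK] := leviK lh.
(* [B e] is chosen so that h sends (B e)^+ to e^+. *)
have /= := congr1 (@^~ (0, 0, B e)) Ep; rewrite E' /= h2.
change (g (weyl_of e e (0, 0, B e)) = weyl_of e e (cotransl c' (0, 0, C (B e))) ->
  exists A B, levi g A B).
rewrite (lie_aut_conj_coswap (lie_aut_weyl J e e) (weyl_minusE c' Pe)).
rewrite !(weyl_minusE _ Pe) !jquad1 Eg /= (leviE lh) BK cotranslE translE.
move=> /(congr1 (fun X : L => p1 X.1.2 e)) E.
change (p1 (0 + DD e c) e = p1 (0 - DD c' 0) e) in E.
have c0 : c = 0.
  have E2 : (2 : R) != 0 by rewrite pnatr_eq0.
  move: E; rewrite !(p1D, p1N, p1DD, p1_0) jD0m jD_unitl jmulC junitP => E.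
  by apply: (scalerI E2); apply: (lincomb1 (k := 1) E); lmod.
exists A, B; rewrite (_ : cotransl c \o h = h) //.
by apply/funext => X /=; rewrite c0 cotransl0.
Qed.

End GeometryPoints.

(** * Strongly associative subalgebras *)

Section BanachJordan.
Context (R : realType) (V : normedModType R) (J : jordan_algebra V).
Local Notation "x ∘ y" := (jmul J x y) (at level 40, left associativity).
Local Notation D := (jD J).
Local Notation Q := (jquad J).
Local Notation e := (junit J).
Implicit Types (a b c h k s u v w x y z : V) (A : set V).

(** The form of completeness that fixed-point iteration consumes; the ratio 1/2 is the contraction
    factor in [contraction_fixpoint]. *)
Definition geometric_complete : Prop := forall (u : nat -> V) (K : R),
  (forall n, `|u n.+1 - u n| <= K * 2^-1 ^+ n) ->
  exists l, forall eps : R, 0 < eps -> exists N, forall n, (N <= n)%N -> `|u n - l| < eps.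

(* Closed subalgebras whose multiplication operators commute on all of [V]. *)
Definition strongly_associative A : Prop :=
  [/\ A e, (forall (k : R) a b, A a -> A b -> A (k *: a + b)),
      (forall a b, A a -> A b -> A (a ∘ b)),
      (forall a b x, A a -> A b -> a ∘ (b ∘ x) = b ∘ (a ∘ x))
    & (forall b, (forall eps : R, 0 < eps -> exists2 a, A a & `|b - a| < eps) -> A b)].

Lemma jmulBl a b c : (a - b) ∘ c = a ∘ c - b ∘ c.
Proof. by rewrite jmulDl jmulNl. Qed.

Lemma jmulBr a b c : a ∘ (b - c) = a ∘ b - a ∘ c.
Proof. by rewrite jmulDr jmulNr. Qed.

Lemma junitr a : a ∘ e = a.
Proof. by rewrite jmulC junitP. Qed.

Section StronglyAssociative.
Variables (A : set V) (hA : strongly_associative A).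

Lemma sassoc1 : A e. Proof. by case: hA. Qed.
Lemma sassoc0 : A 0.
Proof.
by case: hA => A1 AD _ _ _; have := AD (-1) e e A1 A1; rewrite scaleN1r addNr.
Qed.
Lemma sassocZ (k : R) a : A a -> A (k *: a).
Proof. by case: hA => _ AD _ _ _ Aa; rewrite -[_ *: _]addr0; apply: AD => //; exact: sassoc0. Qed.
Lemma sassocD a b : A a -> A b -> A (a + b).
Proof. by case: hA => _ AD _ _ _ Aa Ab; rewrite -(scale1r a); exact: AD. Qed.
Lemma sassocB a b : A a -> A b -> A (a - b).
Proof. by move=> Aa Ab; apply: sassocD => //; rewrite -scaleN1r; exact: sassocZ. Qed.
Lemma sassocM a b : A a -> A b -> A (a ∘ b).
Proof. by case: hA => _ _ + _ _; apply. Qed.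
Lemma sassocC a b x : A a -> A b -> a ∘ (b ∘ x) = b ∘ (a ∘ x).
Proof. by case: hA => _ _ _ + _; apply. Qed.
Lemma sassocA a b c : A a -> A b -> A c -> a ∘ (b ∘ c) = (a ∘ b) ∘ c.
Proof. by move=> Aa Ab Ac; rewrite (jmulC J b) (sassocC _ Aa Ac) jmulC. Qed.
Lemma sassocACA a b c d : A a -> A b -> A c -> A d ->
  (a ∘ b) ∘ (c ∘ d) = (a ∘ c) ∘ (b ∘ d).
Proof.
move=> Aa Ab Ac Ad.
rewrite -(sassocA Aa Ab (sassocM Ac Ad)) (sassocC _ Ab Ac).
by rewrite (sassocA Aa Ac (sassocM Ab Ad)).
Qed.
Lemma sassoc_closed b : (forall eps : R, 0 < eps -> exists2 a, A a & `|b - a| < eps) -> A b.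
Proof. by case: hA => _ _ _ _; apply. Qed.

Lemma sassoc_jpair a b : A a -> A b -> a ∘ b = e -> jpair J a b.
Proof. by move=> Aa Ab E; apply: jpair_comm => // x; exact: sassocC. Qed.

Lemma sassoc_cone s z : A s -> A z -> (s ∘ s) ∘ z = e -> jcone J (s ∘ s).
Proof.
move=> As Az E; exists s => //.
apply: (@jpair_invertible _ _ _ _ (s ∘ z)); apply: sassoc_jpair => //.
  exact: sassocM.
by rewrite (sassocA As As Az).
Qed.

End StronglyAssociative.

Fixpoint jpow a n : V := if n is m.+1 then a ∘ jpow a m else e.

Lemma jpow_sqr a n : (a ∘ a) ∘ jpow a n = jpow a n.+2.
Proof.
elim: n => [|n IH] /=; first by rewrite !junitr.
by rewrite -jordan_identity IH.
Qed.

(** The polarized Jordan identity expresses multiplication by a^(m+2) through multiplications by a,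
    a^2, a^m and a^(m+1). Commutation with the first two therefore propagates by a two-step
    induction. *)
Lemma jpow_commute (f : V -> V) a :
  (forall (k : R) x y, f (k *: x + y) = k *: f x + f y) ->
  (forall x, f (a ∘ x) = a ∘ f x) ->
  (forall x, f ((a ∘ a) ∘ x) = (a ∘ a) ∘ f x) ->
  forall n x, f (jpow a n ∘ x) = jpow a n ∘ f x.
Proof.
move=> fl fa faa n x.
suff H m : (forall y, f (jpow a m ∘ y) = jpow a m ∘ f y) /\
           (forall y, f (jpow a m.+1 ∘ y) = jpow a m.+1 ∘ f y) by have [] := H n.
elim: m => [|m [IH1 IH2]]; first by split=> y; rewrite /= ?junitP ?junitr.
split=> // y; rewrite -jpow_sqr; set p := jpow a m in IH1 *.
have E v : ((a ∘ a) ∘ p) ∘ v =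
    (-2) *: (a ∘ (p ∘ (a ∘ v))) + (2 *: ((a ∘ p) ∘ (a ∘ v)) + (a ∘ a) ∘ (p ∘ v)).
  have := jordan_polarized J v a a p.
  rewrite (jmulC J a v) (jmulC J v ((a ∘ a) ∘ p)) (jmulC J (v ∘ a) p).
  rewrite (jmulC J v p) (jmulC J (v ∘ a) (a ∘ p)) (jmulC J v a) => E.
  by apply: (lincomb1 (k := 1) E); lmod.
rewrite !E !fl faa IH1 fa.
have -> : f ((a ∘ p) ∘ (a ∘ y)) = (a ∘ p) ∘ (a ∘ f y) by rewrite -fa IH2.
have -> : f (p ∘ (a ∘ y)) = p ∘ (a ∘ f y) by rewrite IH1 fa.
by [].
Qed.

Lemma jpow_comm a m n x : jpow a m ∘ (jpow a n ∘ x) = jpow a n ∘ (jpow a m ∘ x).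
Proof.
have lin b (k : R) y z : b ∘ (k *: y + z) = k *: (b ∘ y) + b ∘ z.
  by rewrite jmulDr jmulZr.
have c1 i y : a ∘ (jpow a i ∘ y) = jpow a i ∘ (a ∘ y).
  by apply: (jpow_commute (f := jmul J a)) => // z; rewrite jordan_identity.
have c2 i y : (a ∘ a) ∘ (jpow a i ∘ y) = jpow a i ∘ ((a ∘ a) ∘ y).
  by apply: (jpow_commute (f := jmul J (a ∘ a))) => // z; rewrite jordan_identity.
by apply: (jpow_commute (f := jmul J (jpow a m))) => // z; rewrite ?c1 ?c2.
Qed.

Lemma jpowD a m n : jpow a m ∘ jpow a n = jpow a (m + n).
Proof.
elim: n => [|n IH] /=; first by rewrite junitr addn0.
by rewrite addnS /= -IH; have := jpow_comm a m 1 (jpow a n); rewrite /= junitr.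
Qed.

Variables (C : R) (C_ge1 : 1 <= C).
Hypothesis jnormM : forall a b, `|a ∘ b| <= C * `|a| * `|b|.

Let C_gt0 : 0 < C. Proof. exact: lt_le_trans ltr01 C_ge1. Qed.

Lemma norm_small_eq0 (K : R) x : (forall eps : R, 0 < eps -> eps < 1 -> `|x| <= K * eps) -> x = 0.
Proof.
move=> H; apply/eqP; rewrite -normr_eq0; apply/eqP/le_anti; rewrite normr_ge0 andbT.
have K0 : 0 <= K by have := H 2^-1; have := normr_ge0 x; lra.
rewrite leNgt; apply/negP => x0.
pose d := `|x| / (2 * (K + `|x| + 1)).
have P : 0 < 2 * (K + `|x| + 1) by lra.
have d0 : 0 < d by apply: divr_gt0.
have dE : d * (2 * (K + `|x| + 1)) = `|x| by rewrite /d divfK // gt_eqF.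
have d1 : d < 1 by rewrite ltr_pdivrMr //; lra.
have := H d d0 d1; nra.
Qed.

(** A is the closure of the span of the powers of a. Operator commutation holds on powers by
    [jpow_comm], extends by linearity, and passes to limits by the norm bound. *)
Lemma strongly_associative_closure a : exists2 A, strongly_associative A & A a.
Proof.
pose S := lin_span (range (jpow a)).
have SD (k : R) s u : S s -> S u -> S (k *: s + u) by exact: lin_span_closed.
have Spow n : S (jpow a n).
  rewrite -[jpow a n]addr0 -[X in X + 0]scale1r; apply: lin_spanD; last exact: lin_span0.
  by exists n.
have S0 : S 0 by exact: lin_span0.
have Sind (P : V -> Prop) : P 0 -> (forall (k : R) n u, P u -> P (k *: jpow a n + u)) ->
    forall u, S u -> P u.
  by move=> P0 PD u; elim=> // k _ t [m _ <-] _; exact: PD.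
have m0 x : x ∘ 0 = 0 by rewrite jmulC jmul0l.
have SM s u : S s -> S u -> S (s ∘ u).
  move=> + Su; apply: (Sind (fun s => S (s ∘ u))) => [|k m t IH]; first by rewrite jmul0l.
  rewrite jmulDl jmulZl; apply: (SD k) => // {IH}; move: u Su.
  apply: (Sind (fun u => S (jpow a m ∘ u))) => [|l n r IH]; first by rewrite m0.
  by rewrite jmulDr jmulZr jpowD; exact: SD.
have SC s u x : S s -> S u -> s ∘ (u ∘ x) = u ∘ (s ∘ x).
  move=> + Su; apply: (Sind (fun s => s ∘ (u ∘ x) = u ∘ (s ∘ x))) => [|k m t IH].
    by rewrite !jmul0l m0.
  rewrite !(jmulDl, jmulDr, jmulZl, jmulZr) IH; congr (_ *: _ + _).
  move: u Su {IH}.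
  apply: (Sind (fun u => jpow a m ∘ (u ∘ x) = u ∘ (jpow a m ∘ x))) => [|l n r IH].
    by rewrite !jmul0l m0.
  by rewrite !(jmulDl, jmulDr, jmulZl, jmulZr) jpow_comm IH.
pose A : set V := [set b | forall eps : R, 0 < eps -> exists2 s, S s & `|b - s| < eps].
have SA s : S s -> A s by move=> Ss eps e0; exists s => //; rewrite subrr normr0.
exists A; last by apply: SA; rewrite -(junitr a); exact: (Spow 1%N).
have nz (x : V) : 0 <= `|x| by [].
split.
- exact: (SA _ (Spow 0%N)).
- move=> k b c Ab Ac eps e0.
  have k0 : 0 < `|k| + 1 by have := normr_ge0 k; lra.
  have [s Ss sb] := Ab (eps / 2 / (`|k| + 1)) ltac:(by rewrite !divr_gt0).
  have [t St tc] := Ac (eps / 2) ltac:(lra).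
  exists (k *: s + t); first exact: SD.
  have -> : k *: b + c - (k *: s + t) = k *: (b - s) + (c - t) by lmod.
  apply: (le_lt_trans (ler_normD _ _)); rewrite normrZ.
  have : `|k| * `|b - s| <= eps / 2.
    rewrite ltr_pdivlMr // in sb; have := nz (b - s); have := normr_ge0 k; nra.
  by lra.
- move=> b c Ab Ac eps e0.
  (* [M] dominates C (|c| + |s|) for s within distance 1 of b, so an approximation up to [d] changes
     b ∘ c by at most d M <= eps / 2. *)
  pose M := C * (`|b| + `|c| + 1).
  have M0 : 0 < M by rewrite mulr_gt0 //; have := nz b; have := nz c; lra.
  pose d := Num.min 1 (eps / 2 / M).
  have d0 : 0 < d by rewrite lt_min ltr01 !divr_gt0.
  have d1 : d <= 1 by rewrite ge_min lexx.
  have dM : d * M <= eps / 2 by rewrite -ler_pdivlMr // ge_min lexx orbT.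
  have [s Ss sb] := Ab d d0; have [t St tc] := Ac d d0.
  exists (s ∘ t); first exact: SM.
  have -> : b ∘ c - s ∘ t = (b - s) ∘ c + s ∘ (c - t).
    by rewrite jmulBl jmulBr; lmod.
  apply: (le_lt_trans (ler_normD _ _)).
  have sn : `|s| <= `|b| + 1.
    have -> : s = b - (b - s) by lmod.
    by apply: (le_trans (ler_normB _ _)); lra.
  have H1 := jnormM (b - s) c; have H2 := jnormM s (c - t).
  have H3 : C * `|b - s| * `|c| <= C * d * `|c|.
    by rewrite ler_wpM2r // ler_wpM2l // ltW.
  have H4 : C * `|s| * `|c - t| <= C * (`|b| + 1) * d.
    apply: ler_pM => //; [by rewrite mulr_ge0 // ltW|by rewrite ler_wpM2l // ltW|].
    exact: ltW.
  have H5 : C * d * `|c| + C * (`|b| + 1) * d = d * M by rewrite /M; ring.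
  by lra.
- move=> b c x Ab Ac; apply/eqP; rewrite -subr_eq0; apply/eqP.
  apply: (@norm_small_eq0 (2 * C * C * (`|b| + `|c| + 1) * `|x|)) => d d0 d1.
  have [s Ss sb] := Ab d d0; have [t St tc] := Ac d d0.
  have -> : b ∘ (c ∘ x) - c ∘ (b ∘ x) =
    ((b - s) ∘ (c ∘ x) + s ∘ ((c - t) ∘ x)) - ((c - t) ∘ (b ∘ x) + t ∘ ((b - s) ∘ x)).
    by rewrite !(jmulBl, jmulBr) (SC s t x Ss St); lmod.
  have sn : `|s| <= `|b| + 1.
    have -> : s = b - (b - s) by lmod.
    by apply: (le_trans (ler_normB _ _)); lra.
  have tn : `|t| <= `|c| + 1.
    have -> : t = c - (c - t) by lmod.
    by apply: (le_trans (ler_normB _ _)); lra.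
  have bnd p q (P q' : R) : `|p| <= P -> `|q| <= q' -> `|p ∘ (q ∘ x)| <= C * C * P * q' * `|x|.
    move=> pP qP; apply: (le_trans (jnormM _ _)).
    have -> : C * C * P * q' * `|x| = (C * P) * (C * q' * `|x|) by ring.
    apply: ler_pM => //; first by rewrite mulr_ge0 // ltW.
      by rewrite ler_wpM2l // ltW.
    by apply: (le_trans (jnormM _ _)); rewrite ler_wpM2r // ler_wpM2l // ltW.
  apply: (le_trans (ler_normB _ _)).
  have H1 := ler_normD ((b - s) ∘ (c ∘ x)) (s ∘ ((c - t) ∘ x)).
  have H2 := ler_normD ((c - t) ∘ (b ∘ x)) (t ∘ ((b - s) ∘ x)).
  have B1 := bnd _ _ _ _ (ltW sb) (lexx `|c|).
  have B2 := bnd _ _ _ _ sn (ltW tc).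
  have B3 := bnd _ _ _ _ (ltW tc) (lexx `|b|).
  have B4 := bnd _ _ _ _ tn (ltW sb).
  have -> : 2 * C * C * (`|b| + `|c| + 1) * `|x| * d =
    (C * C * d * `|c| * `|x| + C * C * (`|b| + 1) * d * `|x|) +
    (C * C * d * `|b| * `|x| + C * C * (`|c| + 1) * d * `|x|) by ring.
  by lra.
- move=> b H eps e0; have [c Ac bc] := H (eps / 2) ltac:(lra).
  have [s Ss cs] := Ac (eps / 2) ltac:(lra).
  exists s => //; have -> : b - s = (b - c) + (c - s) by lmod.
  by apply: (le_lt_trans (ler_normD _ _)); lra.
Qed.

End BanachJordan.

(** * Square roots and inverses *)

Section ConeAnalysis.
Context (R : realType) (V : normedModType R) (J : jordan_algebra V).
Local Notation "x ∘ y" := (jmul J x y) (at level 40, left associativity).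
Local Notation D := (jD J).
Local Notation Q := (jquad J).
Local Notation e := (junit J).
Implicit Types (a b c h k s u v w x y z : V) (A : set V).

Variables (C : R) (C_ge1 : 1 <= C).
Hypothesis jnormM : forall a b, `|a ∘ b| <= C * `|a| * `|b|.
Hypothesis complete : geometric_complete V.

Let C_gt0 : 0 < C. Proof. exact: lt_le_trans ltr01 C_ge1. Qed.

(** The fixed point stays in A; this keeps roots and inverses inside the associative subalgebra. *)
Lemma contraction_fixpoint A (F : V -> V) (r : R) :
  (forall b, (forall eps : R, 0 < eps -> exists2 a, A a & `|b - a| < eps) -> A b) ->
  0 <= r -> A 0 ->
  (forall u, A u -> `|u| <= r -> A (F u) /\ `|F u| <= r) ->
  (forall u v, `|u| <= r -> `|v| <= r -> `|F u - F v| <= 2^-1 * `|u - v|) ->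
  exists u, [/\ A u, `|u| <= r & F u = u].
Proof.
move=> clA r0 A0 FA Fc; pose u n := iter n F 0.
have uA n : A (u n) /\ `|u n| <= r.
  by elim: n => [|n [IH1 IH2]]; [rewrite /= normr0|exact: FA].
have du n : `|u n.+1 - u n| <= r * 2^-1 ^+ n.
  elim: n => [|n IH].
    by rewrite expr0 mulr1 /u /= subr0; have [|_] := FA 0 A0; rewrite ?normr0.
  apply: (le_trans (Fc _ _ (uA n.+1).2 (uA n).2)).
  by rewrite exprS mulrCA ler_wpM2l // invr_ge0.
have [l ul] := complete du.
have lr : `|l| <= r.
  rewrite leNgt; apply/negP => rl.
  have [N /(_ N (leqnn N)) H] := ul (`|l| - r) ltac:(lra).
  have := (uA N).2; have := ler_normB (u N) (u N - l).
  by rewrite (_ : u N - (u N - l) = l); [lra|lmod].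
exists l; split=> //.
  apply: clA => eps e0; have [N /(_ N (leqnn N)) H] := ul eps e0.
  by exists (u N); [exact: (uA N).1|rewrite distrC].
apply/eqP; rewrite -subr_eq0; apply/eqP/(@norm_small_eq0 _ _ 2) => eps e0 _.
have [N H] := ul eps e0.
have H1 := H N (leqnn N); have H2 := H N.+1 (leqnSn N).
have -> : F l - l = (F l - F (u N)) + (u N.+1 - l) by rewrite /u /=; lmod.
apply: (le_trans (ler_normD _ _)).
have := Fc _ _ lr (uA N).2; rewrite (distrC l); lra.
Qed.

(** The radius within which multiplication by h has operator norm at most 1/2. *)
Let etaC : R := (2 * C)^-1.
Let etaC_gt0 : 0 < etaC. Proof. by rewrite invr_gt0 mulr_gt0. Qed.
Let etaCE : C * etaC = 2^-1.
Proof. by rewrite /etaC invfM mulrCA mulfV ?mulr1 // gt_eqF. Qed.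

Lemma sqrt_near_unit A h : strongly_associative J A -> A h -> `|h| <= etaC ->
  exists2 k, A k & (e + k) ∘ (e + k) = e + h.
Proof.
(* (e + k)^2 = e + h is equivalent to k = (h - k^2) / 2. *)
move=> hA Ah hs; pose F k := 2^-1 *: (h - k ∘ k).
have half0 : 0 <= (2^-1 : R) by rewrite invr_ge0.
have nF v : `|(2^-1 : R) *: v| = 2^-1 * `|v| by rewrite normrZ ger0_norm.
have sq u : `|u| <= etaC -> C * `|u| <= 2^-1.
  by move=> us; rewrite -etaCE ler_wpM2l // ltW.
have [||||k [Ak _ Fk]] := @contraction_fixpoint A F etaC (sassoc_closed hA).
- exact: ltW.
- exact: sassoc0 hA.
- move=> u Au us; split.
    by apply: (sassocZ hA); apply: (sassocB hA) => //; exact: (sassocM hA).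
  rewrite nF; have := ler_normB h (u ∘ u); have := jnormM u u; have := sq _ us.
  have := normr_ge0 u; nra.
- move=> u v us vs.
  have -> : F u - F v = 2^-1 *: - ((u - v) ∘ (u + v)).
    by rewrite /F !(jmulBl, jmulDr) (jmulC J v u); lmod.
  rewrite nF normrN ler_wpM2l //.
  apply: (le_trans (jnormM _ _)); have := ler_normD u v.
  have := sq _ us; have := sq _ vs; have := normr_ge0 (u - v) => d0 s1 s2 s3.
  have : C * `|u + v| <= 1.
    apply: (le_trans (_ : _ <= C * (`|u| + `|v|))); last by rewrite mulrDr; lra.
    by rewrite ler_wpM2l // ltW.
  by rewrite mulrAC => s4; rewrite ler_piMl.
exists k => //; rewrite !(jmulDl, jmulDr) !junitP junitr.
have {Fk} : 2 *: k = 2 *: F k by rewrite Fk.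
by rewrite /F => Fk; apply: (lincomb1 (k := 1) Fk); lmod.
Qed.

Lemma inverse_near_unit A h : strongly_associative J A -> A h -> `|h| <= etaC ->
  exists2 z, A z & (e + h) ∘ z = e.
Proof.
move=> hA Ah hs; pose F z := e - h ∘ z.
have Chs : C * `|h| <= 2^-1 by rewrite -etaCE ler_wpM2l // ltW.
have hM u : `|h ∘ u| <= 2^-1 * `|u|.
  by apply: (le_trans (jnormM _ _)); rewrite ler_wpM2r.
(* The radius 2 |e| is stable because |F z| <= |e| + |z| / 2. *)
have [||||z [Az _ Fz]] := @contraction_fixpoint A F (2 * `|e|) (sassoc_closed hA).
- by rewrite mulr_ge0.
- exact: sassoc0 hA.
- move=> u Au us; split.
    by apply: (sassocB hA); [exact: sassoc1 hA|exact: (sassocM hA)].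
  by have := ler_normB e (h ∘ u); have := hM u; rewrite /F; lra.
- move=> u v _ _; have -> : F u - F v = - (h ∘ (u - v)).
    by rewrite /F jmulBr; lmod.
  by rewrite normrN hM.
by exists z => //; rewrite jmulDl junitP -{1}Fz /F; lmod.
Qed.

(* Multiplying by square roots of elements near [e] propagates a square root and an
   inverse from [e] to [a] in steps whose length depends only on the bound [M]. *)
Lemma path_sqrt A a (M : R) : strongly_associative J A -> A a ->
  (forall (t : R) z, 0 <= t <= 1 -> (e + t *: (a - e)) ∘ z = e -> `|z| <= M) ->
  exists s z, [/\ A s, A z, s ∘ s = a & a ∘ z = e].
Proof.
move=> hA Aa HM; have A1 := sassoc1 hA.
have M0 : 0 <= M.
  apply: (le_trans _ (HM 0 e _ _)); rewrite ?lexx ?ler01 // scale0r addr0.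
  exact: junitP.
(* With more than [B] steps, each ratio of consecutive points on the segment is e + h with |h| <=
   [etaC]. *)
pose B := 2 * C * (C * `|a - e| * M).
have B0 : 0 <= B by rewrite !mulr_ge0 // ltW.
pose N := (Num.truncn B).+1.
have NB : B < N%:R by rewrite truncnS_gt // num_real.
have N0 : (0 : R) < N%:R by rewrite ltr0n.
pose p n := e + (n%:R / N%:R) *: (a - e).
suff H n : (n <= N)%N -> exists s z, [/\ A s, A z, s ∘ s = p n & p n ∘ z = e].
  by have := H N (leqnn N); rewrite /p mulfV ?gt_eqF // scale1r addrC subrK.
elim: n => [_|n IH nN].
  by exists e, e; rewrite /p mul0r scale0r addr0 junitP.
have [s [z [As Az sE zE]]] := IH (ltnW nN).
have zM : `|z| <= M.
  apply: (HM (n%:R / N%:R)) => //.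
  rewrite divr_ge0 //= ler_pdivrMr // mul1r ler_nat; exact: ltnW.
have Ap : A (p n) by rewrite -sE; exact: sassocM hA _ _ _ _.
have Aae : A (a - e) by exact: (sassocB hA).
pose h := (N%:R^-1 : R) *: ((a - e) ∘ z).
have Ah : A h by apply: (sassocZ hA); exact: (sassocM hA).
have hs : `|h| <= etaC.
  rewrite /h normrZ ger0_norm ?invr_ge0 ?ler0n // ler_pdivrMl //.
  apply: (le_trans (jnormM _ _)).
  apply: (le_trans (_ : _ <= C * `|a - e| * M)).
    by rewrite ler_wpM2l // mulr_ge0 // ltW.
  rewrite /etaC ler_pdivlMr ?mulr_gt0 //; rewrite /B in NB; lra.
have pE : p n.+1 = p n ∘ (e + h).
  rewrite jmulDr junitr /h jmulZr (jmulC J _ z) (sassocA hA Ap Az Aae) zE junitP.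
  by rewrite /p -(addn1 n) natrD mulrDl mul1r; lmod.
have [k Ak kE] := sqrt_near_unit hA Ah hs.
have [y Ay yE] := inverse_near_unit hA Ah hs.
have Aek : A (e + k) by exact: sassocD hA _ _ _ _.
have Aeh : A (e + h) by exact: sassocD hA _ _ _ _.
exists (s ∘ (e + k)), (z ∘ y); split; [exact: sassocM hA _ _ _ _|exact: sassocM hA _ _ _ _| |].
  by rewrite (sassocACA hA As Aek As Aek) sE kE pE.
by rewrite pE (sassocACA hA Ap Aeh Az Ay) zE yE junitP.
Qed.

Lemma norm_jquad_le a b : `|Q a b| <= 3 * C * C * `|a| * `|a| * `|b|.
Proof.
have n2 v : `|(2 : R) *: v| = 2 * `|v| by rewrite normrZ ger0_norm.
apply: (le_trans (ler_normB _ _)); rewrite n2.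
have H1 : `|a ∘ (a ∘ b)| <= C * C * `|a| * `|a| * `|b|.
  apply: (le_trans (jnormM _ _)).
  have -> : C * C * `|a| * `|a| * `|b| = C * `|a| * (C * `|a| * `|b|) by ring.
  by rewrite ler_wpM2l // mulr_ge0 // ltW.
have H2 : `|(a ∘ a) ∘ b| <= C * C * `|a| * `|a| * `|b|.
  apply: (le_trans (jnormM _ _)).
  have -> : C * C * `|a| * `|a| * `|b| = C * (C * `|a| * `|a|) * `|b| by ring.
  by rewrite ler_wpM2r // ler_wpM2l // ltW.
lra.
Qed.

Lemma norm_jD_le a b c : `|D a b c| <= 6 * C * C * `|a| * `|b| * `|c|.
Proof.
have bnd u v w : `|u ∘ (v ∘ w)| <= C * C * `|u| * `|v| * `|w|.
  apply: (le_trans (jnormM _ _)).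
  have -> : C * C * `|u| * `|v| * `|w| = C * `|u| * (C * `|v| * `|w|) by ring.
  by rewrite ler_wpM2l // mulr_ge0 // ltW.
rewrite jD_E normrZ ger0_norm // (jmulC J (a ∘ b)).
have H1 := bnd c a b; have H2 := bnd a b c; have H3 := bnd b a c.
have := ler_normD (c ∘ (a ∘ b)) (a ∘ (b ∘ c) - b ∘ (a ∘ c)).
have := ler_normB (a ∘ (b ∘ c)) (b ∘ (a ∘ c)).
have E1 : C * C * `|c| * `|a| * `|b| = C * C * `|a| * `|b| * `|c| by ring.
have E2 : C * C * `|b| * `|a| * `|c| = C * C * `|a| * `|b| * `|c| by ring.
rewrite E1 in H1; rewrite E2 in H3; lra.
Qed.

(** With k = z' - z, Q_z' = Q_z (id + E), where E = Q_y (Q_k + D(z, -) k) is small; so Q_z' is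
    bijective by a contraction, and the inverse y' satisfies (id + E)(y' - y) = -Q_y (k + Q_k y). *)
Lemma inverse_continuous z y : jpair J z y -> forall eps : R, 0 < eps ->
  exists2 d : R, 0 < d & forall z', `|z' - z| < d ->
    exists2 y', jpair J z' y' & `|y' - y| < eps.
Proof.
move=> P eps e0.
(* For |k| <= 1: [K] bounds Q_y, [G] |k| bounds E, and [H] |k| will bound y' - y once the operator
   norm of E is at most 1/2. *)
pose K := 3 * C * C * `|y| * `|y|; pose G := K * (3 * C * C + 6 * C * C * `|z|).
pose H := 2 * K * (1 + 3 * C * C * `|y|).
have K0 : 0 <= K by rewrite !mulr_ge0 // ltW.
have CC0 : 0 <= 3 * C * C by rewrite !mulr_ge0 // ltW.
have G0 : 0 <= G.
  by apply: mulr_ge0 => //; apply: addr_ge0 => //; rewrite !mulr_ge0 // ltW.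
have H0 : 0 <= H.
  by apply: mulr_ge0; [rewrite mulr_ge0|apply: addr_ge0 => //; rewrite mulr_ge0].
exists (Num.min 1 (Num.min (2 * (G + 1))^-1 (eps / (H + 1)))).
  by rewrite !lt_min ltr01 invr_gt0 mulr_gt0 ?divr_gt0 //; lra.
move=> z'; rewrite !lt_min => /and3P[]; set k := z' - z => k1 kG kH.
have {}kG : G * `|k| <= 2^-1.
  have := kG; rewrite -[_^-1]mul1r ltr_pdivlMr; last lra.
  by have := normr_ge0 k; nra.
have {}kH : H * `|k| < eps.
  by have := kH; rewrite ltr_pdivlMr; [have := normr_ge0 k; nra|lra].
have z'E : z' = z + k by rewrite /k; lmod.
pose E u := Q y (Q k u + D z u k).
have Q'E u : Q z' u = Q z u + (Q k u + D z u k).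
  by rewrite z'E jquadDl; lmod.
have EB u v : E (u - v) = E u - E v.
  rewrite /E -jquadB; congr (Q y _).
  by rewrite jquadB jDDm jDNm; lmod.
have En u : `|E u| <= 2^-1 * `|u|.
  apply: (le_trans (norm_jquad_le _ _)); rewrite -/K.
  apply: (le_trans (_ : _ <= K * ((3 * C * C + 6 * C * C * `|z|) * `|k| * `|u|))).
    rewrite ler_wpM2l //; apply: (le_trans (ler_normD _ _)).
    have := norm_jquad_le k u; have := norm_jD_le z u k.
    have : 3 * C * C * `|k| * `|k| * `|u| <= 3 * C * C * `|k| * `|u|.
      rewrite ler_wpM2r // -[leRHS]mulr1 ler_wpM2l ?mulr_ge0 //; exact: ltW.
    by nra.
  by rewrite /G in kG; rewrite !mulrA ler_wpM2r.
have solve b : exists u, Q z' u = b.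
  have [|||||u [_ _ Fu]] := @contraction_fixpoint setT (fun u => Q y b - E u) (2 * `|Q y b|).
  - by [].
  - by rewrite mulr_ge0.
  - by [].
  - move=> u _ us; split=> //.
    by have := ler_normB (Q y b) (E u); have := En u; lra.
  - move=> u v _ _.
    have -> : Q y b - E u - (Q y b - E v) = - E (u - v) by rewrite EB; lmod.
    by rewrite normrN.
  exists u; rewrite Q'E -{1}Fu jquadB /E !(jpair_quadK P); lmod.
have E0 u : Q z' u = 0 -> u = 0.
  move=> Qu; have : u + E u = 0.
    have := congr1 (Q y) Qu; rewrite Q'E jquadD (jpair_quadK (jpairC P)) -/(E u) => ->.
    by rewrite jquad_half jD0m scaler0.
  move/eqP; rewrite addr_eq0 => /eqP uE; apply/eqP; rewrite -normr_eq0.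
  have := En u; rewrite -normrN -uE => H1.
  by apply/eqP; have := normr_ge0 u; lra.
have inv : jinvertible J z'.
  have ch b := cid (solve b).
  exists (fun b => sval (ch b)) => b; last exact: (svalP (ch b)).
  apply/eqP; rewrite -subr_eq0; apply/eqP/E0.
  by rewrite jquadB (svalP (ch _)) subrr.
have [y' P'] := invertible_jpair inv; exists y' => //.
(* Q_z' y' = z + k, while Q_z' y = z + Q_k y + 2 k. *)
have : (y' - y) + E (y' - y) = Q y (- (k + Q k y)).
  rewrite -[y' - y in X in X + _](jpair_quadK (jpairC P)) -jquadD -Q'E (jquadB J z').
  rewrite (jpair_quad P') Q'E (jpair_quad P) (proj1 P).
  by congr (Q y _); rewrite {1}z'E; lmod.
move=> yE; have := En (y' - y); have := norm_jquad_le y (- (k + Q k y)); rewrite -/K -yE.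
have := ler_normB (y' - y + E (y' - y)) (E (y' - y)); rewrite addrK normrN.
have := ler_normD k (Q k y); have := norm_jquad_le k y.
have : 3 * C * C * `|k| * `|k| * `|y| <= 3 * C * C * `|k| * `|y|.
  rewrite ler_wpM2r // -[leRHS]mulr1 ler_wpM2l ?mulr_ge0 //; exact: ltW.
rewrite /H in kH; have := normr_ge0 k; move: `|k + Q k y| => q n0 q1 q2 q3 q4 q5 q6.
have : K * q <= K * ((1 + 3 * C * C * `|y|) * `|k|) by rewrite ler_wpM2l //; lra.
by lra.
Qed.

End ConeAnalysis.

(** * The symmetric cone *)

Section SymmetricCone.
Context (R : realType) (V : normedModType R) (J : jordan_algebra V).
Local Notation "x ∘ y" := (jmul J x y) (at level 40, left associativity).
Local Notation D := (jD J).
Local Notation Q := (jquad J).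
Local Notation e := (junit J).
Implicit Types (a b c h k s u v w x y z : V) (A : set V).

(** Positivity expressed as a bound on product inverses along the segment from e, uniform in r as
    [path_sqrt] demands. Two squares are allowed so that [cone_open] and [jquad_cone] can add a
    second square to a given one. *)
Definition square_sums_resolvent : Prop := forall x y (t : R), 0 < t ->
  exists M, forall (r : R) z, 0 <= r <= 1 ->
    (e + r *: (x ∘ x + y ∘ y + t *: e - e)) ∘ z = e -> `|z| <= M.

Variables (C : R) (C_ge1 : 1 <= C).
Hypothesis jnormM : forall a b, `|a ∘ b| <= C * `|a| * `|b|.
Hypothesis complete : geometric_complete V.
Hypothesis resolvent : square_sums_resolvent.

Let C_gt0 : 0 < C. Proof. exact: lt_le_trans ltr01 C_ge1. Qed.

Lemma norm_unit_gt0 : 0 < `|e|.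
Proof. by rewrite normr_gt0 junit_neq0. Qed.

Lemma square_sum_sqrt A x y (t : R) : strongly_associative J A -> 0 < t ->
  A (x ∘ x + y ∘ y + t *: e) ->
  exists s z, [/\ A s, A z, s ∘ s = x ∘ x + y ∘ y + t *: e &
    (x ∘ x + y ∘ y + t *: e) ∘ z = e].
Proof.
move=> hA t0 Aa; have [M HM] := resolvent x y t0.
exact: (path_sqrt C_ge1 jnormM complete hA Aa HM).
Qed.

Lemma cone_square_sum x y (t : R) : 0 < t -> jcone J (x ∘ x + y ∘ y + t *: e).
Proof.
move=> t0; have [A hA Aa] := strongly_associative_closure C_ge1 jnormM (x ∘ x + y ∘ y + t *: e).
have [s [z [As Az sE zE]]] := square_sum_sqrt hA t0 Aa.
by rewrite -sE; apply: (sassoc_cone hA As Az); rewrite sE.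
Qed.

Lemma cone_inverse a : jcone J a -> exists z, jpair J a z.
Proof.
move=> [x /invertible_jpair[y P] <-]; exists (Q y e).
by rewrite -jquad_unit; exact: (jpair_jquad P (jpair_e J)).
Qed.

Lemma cone_invertible a : jcone J a -> jinvertible J a.
Proof. by move=> /cone_inverse[z /jpair_invertible]. Qed.

Lemma coneZ (k : R) a : 0 < k -> jcone J a -> jcone J (k *: a).
Proof.
move=> k0 [x /invertible_jpair[y P] <-].
have s0 : Num.sqrt k != 0 by rewrite gt_eqF // sqrtr_gt0.
exists (Num.sqrt k *: x); first exact: (jpair_invertible (jpairZ s0 P)).
by rewrite jmulZl jmulZr scalerA -expr2 sqr_sqrtr // ltW.
Qed.

Lemma cone_add_unit (t : R) a : 0 < t -> jcone J a -> jcone J (a + t *: e).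
Proof.
move=> t0 [x _ <-]; rewrite -[x ∘ x]addr0 -(jmul0l J 0).
exact: cone_square_sum.
Qed.

Lemma square_near_unit h : `|h| <= (2 * C)^-1 -> exists2 n, jinvertible J n & n ∘ n = e + h.
Proof.
move=> hs; have [A hA Ah] := strongly_associative_closure C_ge1 jnormM h.
have [k Ak kE] := sqrt_near_unit C_ge1 jnormM complete hA Ah hs.
have [z Az zE] := inverse_near_unit C_ge1 jnormM complete hA Ah hs.
have Aek : A (e + k) by apply: (sassocD hA) => //; exact: sassoc1 hA.
exists (e + k) => //; apply: (@jpair_invertible _ _ _ _ ((e + k) ∘ z)).
apply: (sassoc_jpair hA) => //; first exact: (sassocM hA).
by rewrite (sassocA hA) // kE.
Qed.

Lemma cone_near_unit h : `|h| <= (2 * C)^-1 -> jcone J (e + h).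
Proof. by move=> /square_near_unit[n ni nE]; exists n. Qed.

(* b - t e = (b + t e) (e - 2 t (b + t e)^-1), and (b + t e)^-1 stays bounded as t
   tends to 0. *)
Lemma cone_shrink b : jinvertible J b ->
  (forall t : R, 0 < t -> jcone J (b + t *: e)) ->
  exists2 d : R, 0 < d & jcone J (b - d *: e).
Proof.
move=> /invertible_jpair[b' P] Hb; have e0 := norm_unit_gt0.
have [A hA Ab] := strongly_associative_closure C_ge1 jnormM b.
have Ae := sassoc1 hA.
have [d d0 Hd] := inverse_continuous C_ge1 jnormM complete P ltr01.
pose M := `|b'| + 1; have M0 : 0 < M by have := normr_ge0 b'; rewrite /M; lra.
(* The first bound keeps the inverse of b + t e within 1 of b', hence below [M]; the second puts e -
   2 t (b + t e)^-1 within reach of [sqrt_near_unit]. *)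
pose t := Num.min (d / 2 / `|e|) ((2 * C)^-1 / (2 * M)).
have eta0 : 0 < (2 * C)^-1 by rewrite invr_gt0 mulr_gt0.
have t0 : 0 < t by rewrite lt_min !divr_gt0 // mulr_gt0.
have tn : `|t *: e| < d.
  rewrite normrZ gtr0_norm //.
  have : t <= d / 2 / `|e| by rewrite ge_min lexx.
  by rewrite ler_pdivlMr //; lra.
have tM : 2 * t * M <= (2 * C)^-1.
  have : t <= (2 * C)^-1 / (2 * M) by rewrite ge_min lexx orbT.
  by rewrite ler_pdivlMr ?mulr_gt0 //; lra.
exists t => //.
(* Only half of t is absorbed into the square x^2 = b + (t / 2) e; the other half is the positive
   shift required by [square_sum_sqrt]. *)
have th0 : 0 < t / 2 by lra.
have [x _ xE] := Hb _ th0.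
have bt : b + t *: e = x ∘ x + 0 ∘ 0 + (t / 2) *: e.
  by rewrite xE jmul0l; lmod.
have Abt : A (b + t *: e) by apply: (sassocD hA) => //; exact: (sassocZ hA).
have [|s [z [As Az sE zE]]] := @square_sum_sqrt A x 0 (t / 2) hA th0; first by rewrite -bt.
rewrite -bt in sE zE.
have zM : `|z| <= M.
  have [|y' P' y'n] := Hd (b + t *: e); first by rewrite (addrC b) addrK.
  have -> : z = y' by exact: (jpair_unique (sassoc_jpair hA Abt Az zE) P').
  have -> : y' = (y' - b') + b' by lmod.
  by apply: (le_trans (ler_normD _ _)); rewrite /M; lra.
pose h := (- (2 * t)) *: z.
have hs : `|h| <= (2 * C)^-1.
  rewrite normrZ normrN ger0_norm; last lra.
  by apply: (le_trans _ tM); rewrite ler_wpM2l //; lra.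
have Ah : A h by exact: (sassocZ hA).
have [k Ak kE] := sqrt_near_unit C_ge1 jnormM complete hA Ah hs.
have [y Ay yE] := inverse_near_unit C_ge1 jnormM complete hA Ah hs.
have Aek : A (e + k) by exact: (sassocD hA).
have Aeh : A (e + h) by exact: (sassocD hA).
have sq : (s ∘ (e + k)) ∘ (s ∘ (e + k)) = (b + t *: e) ∘ (e + h).
  by rewrite (sassocACA hA) // sE kE.
have -> : b - t *: e = (s ∘ (e + k)) ∘ (s ∘ (e + k)).
  by rewrite sq jmulDr junitr /h jmulZr zE; lmod.
apply: (@sassoc_cone _ _ _ _ hA _ (z ∘ y)); [exact: (sassocM hA)|exact: (sassocM hA)|].
by rewrite sq (sassocACA hA) // zE yE junitP.
Qed.

Lemma cone_shrink_cone a : jcone J a -> exists2 d : R, 0 < d & jcone J (a - d *: e).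
Proof.
move=> ca; apply: cone_shrink; first exact: cone_invertible.
by move=> t t0; exact: cone_add_unit.
Qed.

(* c = Q_y a satisfies c + t e = Q_y (a + t y^-2), which is invertible for t >= 0;
   by [cone_shrink] the set of t >= 0 with c + t e in the cone then has infimum 0
   and contains it. *)
Lemma jquad_cone y a : jinvertible J y -> jcone J a -> jcone J (Q y a).
Proof.
move=> iy ca; have [y' P] := invertible_jpair iy; set c := Q y a.
have [d d0 [m im mE]] := cone_shrink_cone ca.
have Qyy' : Q y (y' ∘ y') = e by rewrite -jquad_unit (jpair_quadK P).
have inv t : 0 <= t -> jinvertible J (c + t *: e).
  move=> t0; have -> : c + t *: e = Q y (a + t *: (y' ∘ y')).
    by rewrite jquadD jquadZ Qyy'.
  have [|z Pz] := @cone_inverse (a + t *: (y' ∘ y')); last first.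
    exact: (jpair_invertible (jpair_jquad P Pz)).
  (* a + t y'^2 = m^2 + (sqrt t y')^2 + d e, where m^2 = a - d e. *)
  have := cone_square_sum m (Num.sqrt t *: y') d0.
  rewrite mE jmulZl jmulZr scalerA -expr2 sqr_sqrtr //.
  by rewrite (_ : _ + d *: e = a + t *: (y' ∘ y')) //; lmod.
pose S := [set t : R | 0 <= t /\ jcone J (c + t *: e)].
have eta0 : 0 < (2 * C)^-1 by rewrite invr_gt0 mulr_gt0.
have hS : has_inf S.
  split; last by exists 0 => t [].
  (* Large enough that c / t lies in the ball of [cone_near_unit], which shows that S is
     inhabited. *)
  pose t := (`|c| + 1) / (2 * C)^-1.
  have t0 : 0 < t by rewrite divr_gt0 //; have := normr_ge0 c; lra.
  exists t; split; first exact: ltW.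
  have -> : c + t *: e = t *: (e + t^-1 *: c).
    by rewrite scalerDr scalerA mulfV ?gt_eqF // scale1r addrC.
  apply: coneZ => //; apply: cone_near_unit.
  rewrite normrZ gtr0_norm ?invr_gt0 // ler_pdivrMl //.
  by rewrite /t divfK ?gt_eqF //; lra.
have T0 : 0 <= inf S by apply: lb_le_inf; [case: hS|move=> t []].
set T := inf S in T0.
have HT t : 0 < t -> jcone J (c + T *: e + t *: e).
  move=> t0; have [s [s0 cs] sT] := inf_adherent t0 hS.
  have -> : c + T *: e + t *: e = (c + s *: e) + (T + t - s) *: e by lmod.
  by apply: cone_add_unit => //; rewrite /T; lra.
have [r r0 cr] := cone_shrink (inv _ T0) HT.
have {}cr : jcone J (c + (T - r) *: e).
  by rewrite (_ : c + _ = c + T *: e - r *: e) //; lmod.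
(* If r <= T, then T - r belongs to S and lies below its infimum; otherwise c is an element of the
   cone plus a positive multiple of e. *)
have [rT|Tr] := leP r T.
  have : T <= T - r by apply: ge_inf => //; [case: hS|split; [lra|]].
  by lra.
have -> : c = (c + (T - r) *: e) + (r - T) *: e by lmod.
by apply: cone_add_unit => //; lra.
Qed.

(** Writing a = m^2 + t e, a nearby b equals m^2 + (t / 2) n^2 + (t / 2) e, where n^2 = e + (2 /
    t)(b - a) exists since b - a is small. *)
Lemma cone_open a : jcone J a ->
  exists2 d : R, 0 < d & forall b, `|b - a| < d -> jcone J b.
Proof.
move=> ca; have [t t0 [m im mE]] := cone_shrink_cone ca.
have eta0 : 0 < (2 * C)^-1 by rewrite invr_gt0 mulr_gt0.
have th0 : 0 < t / 2 by lra.
exists (t / 2 * (2 * C)^-1); first exact: mulr_gt0.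
move=> b ba; pose h := (t / 2)^-1 *: (b - a).
have [|n _ nE] := @square_near_unit h.
  by rewrite normrZ gtr0_norm ?invr_gt0 // ler_pdivrMl // ltW.
have := cone_square_sum m (Num.sqrt (t / 2) *: n) th0.
rewrite mE jmulZl jmulZr scalerA -expr2 sqr_sqrtr ?ltW // nE scalerDr.
rewrite /h scalerA mulfV ?gt_eqF // scale1r.
by rewrite (_ : _ + (t / 2) *: e = b) //; lmod.
Qed.

Lemma cone_unit : jcone J e.
Proof. by exists e; [exact: (jpair_invertible (jpair_e J))|rewrite junitP]. Qed.

Lemma qprod_cone (f : V -> V) a : qprod J f -> jcone J a -> jcone J (f a).
Proof. by elim=> // y B iy _ IH ca; apply: jquad_cone => //; exact: IH. Qed.

Lemma qprod_bounded (f : V -> V) : qprod J f ->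
  exists2 K : R, 0 <= K & forall u, `|f u| <= K * `|u|.
Proof.
elim=> [|y B iy _ [K K0 HK]]; first by exists 1 => // u; rewrite mul1r.
pose K' := 3 * C * C * `|y| * `|y|.
have K'0 : 0 <= K' by rewrite !mulr_ge0 // ltW.
exists (K' * K); first exact: mulr_ge0.
move=> u /=; apply: (le_trans (norm_jquad_le C_ge1 jnormM _ _)).
by rewrite -/K' -mulrA ler_wpM2l.
Qed.

End SymmetricCone.

(** * Comparison of the topologies *)

Lemma open_normP (R : realType) (V : normedModType R) (W : set V) :
  open W <-> forall v, W v -> exists2 d : R, 0 < d & forall v', `|v' - v| < d -> W v'.
Proof.
rewrite openE; split=> [H v /H /nbhs_normP[d d0 dW]|H v /H[d d0 dW]].
  by exists d => // v' v'd; apply: dW; rewrite /= distrC.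
by apply/nbhs_normP; exists d => // v'; rewrite /= distrC => /dW.
Qed.

Section Topologies.
Context (R : realType) (V : normedModType R) (J : jordan_algebra V).
Local Notation "x ∘ y" := (jmul J x y) (at level 40, left associativity).
Local Notation Q := (jquad J).
Local Notation e := (junit J).
Implicit Types (c k v y z : V) (g : G0 J) (x : geometry J).

Lemma cyclic_interval_openP (U : set (geometry J)) : cyclic_interval_open U <->
  forall x, U x -> exists F : {fset (set (geometry J))},
    (forall I, I \in F -> exists a b, transverse a b /\ I = cyclic_interval a b) /\
    (\bigcap_(I in [set` F]) I) x /\ (\bigcap_(I in [set` F]) I `<=` U).
Proof.
split=> [|H].
  case=> D' sD' <- x [B D'B Bx]; have [F sF EF] := sD' _ D'B.
  exists F; rewrite EF; split; first by move=> I /sF /set_mem.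
  by split=> // y By; exists B.
exists [set B | finI_from
    [set I | exists a b, transverse a b /\ I = cyclic_interval a b] id B /\ B `<=` U].
  by move=> B [].
apply/seteqP; split=> [x [B [_ BU] Bx]|x /H[F [HF [Fx FU]]]]; first exact: BU.
exists (\bigcap_(I in [set` F]) I) => //; split=> //.
by exists F => // I /HF HI; apply/mem_set.
Qed.

Variables (C : R) (C_ge1 : 1 <= C).
Hypothesis jnormM : forall a b, `|a ∘ b| <= C * `|a| * `|b|.
Hypothesis complete : geometric_complete V.
Hypothesis resolvent : square_sums_resolvent J.
(** Elements of the cone are squares, so this bounds (e + y)^-1 over the whole cone and makes its
    Cayley image bounded. *)
Hypothesis inverse_bounded : exists M : R, forall x z : V, (e + x ∘ x) ∘ z = e -> `|z| <= M.

(** * Continuity of the action in the chart V *)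

Lemma act_cotransl_near0_inv c : jinvertible J c -> forall eps : R, 0 < eps ->
  exists2 d : R, 0 < d & forall k, `|k| < d ->
    exists2 k', `|k'| < eps & act (G0_cotransl J c) (emb J k) = emb J k'.
Proof.
move=> /invertible_jpair[a P] eps e0; have P' := jpairC P.
pose K := 3 * C * C * `|a| * `|a|.
have C0 : 0 <= C by apply: le_trans C_ge1.
have K0 : 0 <= K by rewrite !mulr_ge0.
have [|d d0 Hd] := inverse_continuous C_ge1 jnormM complete (jpairN P') (eps := eps / (K + 1)).
  by rewrite divr_gt0 //; lra.
exists d => // k kd; have [|z Pz zc] := Hd (k - a); first by rewrite opprK subrK.
exists (- a - Q a z); last exact: act_cotransl.
(* Uses Q_a c = a; the inverse z of k - a is close to the inverse -c of -a. *)
have -> : - a - Q a z = - Q a (z - - c).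
  by rewrite opprK jquadD (jpair_quad P'); lmod.
rewrite normrN; apply: (le_lt_trans (norm_jquad_le C_ge1 jnormM _ _)); rewrite -/K.
rewrite ltr_pdivlMr in zc; last lra.
by have := normr_ge0 (z - - c); nra.
Qed.

(** A general c is the sum of the invertible elements c + l e and -l e. As l exceeds 2 C |c|, c + l
    e is a multiple of an element near the unit. *)
Lemma act_cotransl_near0 c (eps : R) : 0 < eps ->
  exists2 d : R, 0 < d & forall k, `|k| < d ->
    exists2 k', `|k'| < eps & act (G0_cotransl J c) (emb J k) = emb J k'.
Proof.
move=> e0; have C0 : 0 < C by apply: lt_le_trans C_ge1.
pose l := 2 * C * `|c| + 1.
have l0 : 0 < l by rewrite ltr_wpDl // !mulr_ge0 // ltW.
have i1 : jinvertible J (c + l *: e).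
  apply: cone_invertible.
  have -> : c + l *: e = l *: (e + l^-1 *: c).
    by rewrite scalerDr scalerA mulfV ?gt_eqF // scale1r addrC.
  apply: coneZ => //; apply: (cone_near_unit C_ge1 jnormM complete).
  rewrite normrZ gtr0_norm ?invr_gt0 // ler_pdivrMl //.
  by rewrite ler_pdivlMr ?mulr_gt0 // /l; lra.
have i2 : jinvertible J (- l *: e).
  by apply: (jpair_invertible (jpairZ _ (jpair_e J))); rewrite oppr_eq0 gt_eqF.
have [d1 d10 H1] := act_cotransl_near0_inv i1 e0.
have [d2 d20 H2] := act_cotransl_near0_inv i2 d10.
exists d2 => // k /H2[k1 k1d E1]; have [k2 k2d E2] := H1 _ k1d; exists k2 => //.
rewrite -E2 -E1 -act_comp; apply: act_fun_eq; apply/funext => X /=.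
by rewrite cotranslD; congr (cotransl _ X); lmod.
Qed.

(** Translations move v0 and v1 to o, which places the conjugated element in P; there it is some
    t~_c after a bounded linear map. *)
Lemma act_emb_continuous g v0 v1 (eps : R) : act g (emb J v0) = emb J v1 -> 0 < eps ->
  exists2 d : R, 0 < d & forall v, `|v - v0| < d ->
    exists2 v', `|v' - v1| < eps & act g (emb J v) = emb J v'.
Proof.
move=> gv e0.
pose p := G0_comp (G0_transl J (- v1)) (G0_comp g (G0_transl J v0)).
have po : act p (base J) = base J.
  by rewrite -[in LHS]emb0 !act_comp !act_transl addr0 gv act_transl addNr emb0.
have Pp : parabolic p.
  have /act_base_eq[q Pq Eq] : act p (base J) = act (G0_transl J 0) (base J).
    by rewrite po -[LHS]emb0.
  by rewrite (_ : G0_fun p = q) // Eq; apply/funext => X /=; rewrite transl0.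
have [c [h [A [B [lh Ep]]]]] := parabolic_decomp Pp.
(* [parabolic_decomp] yields h as a mere map of L; this presents it as an element of G_0 lying in P,
   so that it acts on points. *)
pose h' := G0_comp (G0_cotransl J (- c)) p.
have Eh : G0_fun h' = h.
  by apply/funext => X; change (cotransl (- c) (p X) = h X); rewrite Ep /= cotranslK.
have Ph : parabolic h' by apply: generated_comp => //; exact: parabolic_cotransl.
rewrite -Eh in lh.
have [qA _] := levi_qprod lh.
have [K K0 HK] := qprod_bounded C_ge1 jnormM qA.
have [d d0 Hd] := act_cotransl_near0 c e0.
exists (d / (K + 1)); first by rewrite divr_gt0 //; lra.
move=> v vd; have [|k' k'e E] := Hd (A (v - v0)).
  apply: (le_lt_trans (HK _)); rewrite ltr_pdivlMr in vd; last lra.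
  by have := normr_ge0 (v - v0); nra.
exists (v1 + k'); first by rewrite (addrC v1) addrK.
rewrite -act_transl -E -(act_levi _ Ph lh).
have -> : emb J v = act (G0_transl J v0) (emb J (v - v0)).
  by rewrite act_transl addrC subrK.
move: (emb J (v - v0)) => x; rewrite -!act_comp.
apply: act_fun_eq; apply/funext => X.
change (g (transl v0 X) = transl v1 (cotransl c (cotransl (- c) (p X)))).
by rewrite cotranslNK /= translNK.
Qed.

Lemma usual_open_emb (W : set V) : open W -> usual_open (emb J @` W).
Proof.
move=> /open_normP oW g; apply/open_normP => v0 [v1 Wv1 /esym E].
have [eps e0 He] := oW _ Wv1.
have [d d0 Hd] := act_emb_continuous E e0.
exists d => // v /Hd[v' v'e Ev]; exists v' => //; exact: He.
Qed.

Lemma open_cone : open (jcone J).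
Proof.
by apply/open_normP => v /(cone_open C_ge1 jnormM complete resolvent)[d d0 H]; exists d.
Qed.

Lemma usual_open_interval (a b : geometry J) : usual_open (cyclic_interval a b).
Proof.
move=> g; apply/open_normP => v0 [g' [ga gb gx]].
have /open_normP := usual_open_emb open_cone (G0_comp g' g).
move=> /(_ v0); rewrite /= act_comp => /(_ gx)[d d0 Hd].
by exists d => // v /Hd; rewrite act_comp => Hv; exists g'.
Qed.

Lemma cone_stable g A B a : parabolic g -> levi g A B -> jcone J a ->
  exists2 b, jcone J b & act g (emb J b) = emb J a.
Proof.
move=> Pg lg ca; have [_ qB] := levi_qprod lg; have [_ BK] := leviK lg.
exists (B a); first exact: (qprod_cone C_ge1 jnormM complete resolvent).
by rewrite (act_levi _ Pg lg) BK.
Qed.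

(* [k] is the Cayley transform y |-> eps (y - e) (y + e)^-1, which maps the cone
   onto the interval from - eps e to eps e. *)
Lemma cayley_transform (eps : R) : 0 < eps ->
  exists k : G0 J, forall y z, jpair J (e + y) z ->
    act k (emb J y) = emb J (eps *: e - (2 * eps) *: z).
Proof.
(* Q_{l e} is the scalar l^2 = 2 eps. *)
move=> e0; pose l := Num.sqrt (2 * eps).
have l2 : l * l = 2 * eps by rewrite -expr2 sqr_sqrtr //; lra.
have l0 : l != 0 by rewrite gt_eqF // sqrtr_gt0; lra.
have P := jpairZ l0 (jpair_e J).
have [qe Pq] := quad_elem_weyl P; set q := G0_comp _ _ in qe Pq.
have [B lq] := quad_elem_levi (jpair_invertible P) qe.
exists (G0_comp (G0_transl J (eps *: e))
  (G0_comp q (G0_comp (weyl J) (G0_transl J e)))) => y z Pz.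
clearbody q; rewrite act_comp (act_comp q) (act_comp (weyl J)) act_transl.
rewrite (act_weyl_unit Pz) (act_levi _ Pq lq) act_transl.
by rewrite jquadZl l2 jquad1; congr (emb J _); lmod.
Qed.

(** The interval is g k (Omega) with k the Cayley transform, which sends e to 0. Any witness [k1] of
    membership makes k1 g k fix o and infinity, hence stabilize Omega. *)
Lemma interval_basis (U : set (geometry J)) x : usual_open U -> U x ->
  exists a b, [/\ transverse a b, cyclic_interval a b x & cyclic_interval a b `<=` U].
Proof.
move=> oU Ux; have [g xE] := geometry_act x.
have /open_normP/(_ 0) := oU g; rewrite /= emb0 -xE => /(_ Ux)[d d0 Hd].
have [M HM] := inverse_bounded.
have M0 : 0 <= M.
  apply: (le_trans (normr_ge0 e)); apply: (HM 0).
  by rewrite jmul0l addr0 junitP.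
(* Since |eps e - 2 eps z| <= eps (|e| + 2 M) < d; the summand 1 makes the inequality strict. *)
pose eps := d / (`|e| + 2 * M + 1).
have den0 : 0 < `|e| + 2 * M + 1 by have := normr_ge0 e; lra.
have e0 : 0 < eps by rewrite divr_gt0.
have epsE : eps * (`|e| + 2 * M + 1) = d by rewrite divfK // gt_eqF.
clearbody eps; have [k kE] := cayley_transform e0.
have [k' [kK k'K]] := G0_inv k; have [g' [gK g'K]] := G0_inv g.
exists (act g (act k (base J))), (act g (act k (infty J))); split.
- by exists (G0_comp g k); rewrite !act_comp.
- exists (G0_comp k' g'); rewrite !act_comp xE !(act_can _ gK) !(act_can _ kK); split=> //.
  exists e; first exact: cone_unit.
  have two0 : (2 : R) != 0 by rewrite pnatr_eq0.
  have Pe : jpair J (e + e) (2^-1 *: e).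
    rewrite (_ : e + e = 2 *: e); last by lmod.
    exact: (jpairZ two0 (jpair_e J)).
  rewrite -(act_can (emb J e) kK) (kE _ _ Pe) -emb0; congr (act _ (emb J _)).
  by lmod.
- move=> x1 [k1 [ka kb [y0 cy0 ky0]]].
  pose s := G0_comp k1 (G0_comp g k).
  have so : act s (base J) = base J by rewrite !act_comp.
  have si : act s (infty J) = infty J by rewrite !act_comp.
  have [Ps [A [B ls]]] := stabilizer_levi so si.
  have [y cy sy] := cone_stable Ps ls cy0.
  have [z Pz] : exists z, jpair J (e + y) z.
    apply: cone_inverse.
    rewrite addrC -[e]scale1r; exact: (cone_add_unit C_ge1 jnormM complete resolvent).
  have -> : x1 = act g (act k (emb J y)).
    have [k1' [k1K _]] := G0_inv k1.
    rewrite -(act_can x1 k1K) -ky0 -sy act_comp (act_can _ k1K) act_comp.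
    by [].
  rewrite (kE _ _ Pz); apply: Hd; rewrite subr0.
  have [m _ mE] := cy; have zM : `|z| <= M by apply: (HM m); rewrite mE (jpair_mul Pz).
  apply: (le_lt_trans (ler_normB _ _)); rewrite !normrZ !gtr0_norm ?mulr_gt0 //.
  have : eps * `|z| <= eps * M by rewrite ler_wpM2l // ltW.
  by rewrite -epsE; lra.
Qed.

Lemma cyclic_interval_open_usual (U : set (geometry J)) :
  cyclic_interval_open U <-> usual_open U.
Proof.
split=> [/cyclic_interval_openP oU g|oU].
  rewrite openE => v /= /oU[F [HF [Fv FU]]].
  have : nbhs v (\bigcap_(I in [set` F]) [set v | I (act g (emb J v))]).
    apply: filter_bigI => I IF; have [a [b [_ IE]]] := HF _ IF.
    apply: open_nbhs_nbhs; split; last exact: Fv.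
    by rewrite IE; exact: usual_open_interval.
  by apply: filterS => w Hw; apply: FU => I IF; exact: Hw.
apply/cyclic_interval_openP => x Ux; have [a [b [tab Ix IU]]] := interval_basis oU Ux.
exists [fset (cyclic_interval a b)]%fset; split.
  by move=> I; rewrite inE => /eqP ->; exists a, b.
split; first by move=> I /=; rewrite inE => /eqP ->.
by move=> y /(_ (cyclic_interval a b)) Hy; apply: IU; apply: Hy; rewrite /= inE.
Qed.

Lemma usual_topology_restriction (W : set V) :
  (exists2 U : set (geometry J), cyclic_interval_open U & W = emb J @^-1` U) <-> open W.
Proof.
split=> [[U /cyclic_interval_open_usual oU ->]|oW].
  have := oU (G0_transl J 0); congr open; apply/funext => v /=.
  by rewrite act_transl add0r.
exists (emb J @` W); first exact/cyclic_interval_open_usual/usual_open_emb.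
by apply/seteqP; split=> [v Wv|v [v' Wv' /emb_inj <-]] //; exists v.
Qed.

End Topologies.

(** * JB-algebras *)

Section JBAlgebras.
Context (R : realType).

Lemma half_expn_small (K eps : R) : 0 < eps -> exists N, forall n, (N <= n)%N ->
  K * 2^-1 ^+ n < eps.
Proof.
move=> e0; have B : 0 <= `|K| / eps by rewrite divr_ge0 // ltW.
pose N := (Num.truncn (`|K| / eps)).+1.
have BN : `|K| / eps < N%:R by rewrite truncnS_gt // num_real.
exists N => n nN.
have p0 : 0 < (2 : R) ^+ n by rewrite exprn_gt0.
rewrite exprVn ltr_pdivrMr //; apply: (le_lt_trans (ler_norm K)).
rewrite mulrC -ltr_pdivrMr //; apply: (lt_le_trans BN).
rewrite -natrX ler_nat; apply: (leq_trans nN); exact/ltnW/ltn_expl.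
Qed.

Lemma geometric_dist (V : normedModType R) (u : nat -> V) (K : R) :
  (forall n, `|u n.+1 - u n| <= K * 2^-1 ^+ n) ->
  forall n m, `|u (n + m)%N - u n| <= 2 * K * 2^-1 ^+ n.
Proof.
move=> du n m.
have p0 i : 0 < (2^-1 : R) ^+ i by rewrite exprn_gt0.
have K0 : 0 <= K by have := du 0%N; have := normr_ge0 (u 1%N - u 0%N); rewrite expr0; lra.
have : `|u (n + m)%N - u n| <= 2 * K * 2^-1 ^+ n * (1 - 2^-1 ^+ m).
  elim: m => [|m IH]; first by rewrite addn0 !subrr normr0 mulr0.
  rewrite addnS; have -> : u (n + m).+1 - u n =
      (u (n + m).+1 - u (n + m)%N) + (u (n + m)%N - u n) by lmod.
  apply: (le_trans (ler_normD _ _)); have := du (n + m)%N; rewrite exprD exprS.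
  by move: IH; set q := 2^-1 ^+ n; set r := 2^-1 ^+ m; lra.
have := mulr_ge0 (mulr_ge0 K0 (ltW (p0 n))) (ltW (p0 m)); lra.
Qed.

Lemma cauchy_geometric_complete (V : normedModType R) :
  (forall F : set_system V, ProperFilter F -> cauchy F -> cvg F) -> geometric_complete V.
Proof.
move=> HV u K du.
have cu : cauchy (u @ \oo).
  apply: cauchy_exP => eps e0; have [N HN] := half_expn_small (2 * K) e0.
  exists (u N); exists N => // n /= Nn; rewrite -ball_normE /= distrC -(subnKC Nn).
  apply: (le_lt_trans (geometric_dist du _ _)); exact: HN.
have ul : cvg (u @ \oo) by exact: HV.
exists (lim (u @ \oo)) => eps e0; have /cvgrPdist_lt/(_ _ e0)[N _ HN] := ul.
by exists N => n Nn; rewrite distrC; exact: HN.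
Qed.

Context (V : normedModType R) (J : jordan_algebra V).
Local Notation "x ∘ y" := (jmul J x y) (at level 40, left associativity).
Local Notation e := (junit J).
Hypothesis HJ : JB_algebra J.

Lemma JB_norm1M (a b : V) : `|a ∘ b| <= 1 * `|a| * `|b|.
Proof. by rewrite mul1r; exact: (JB_normM HJ). Qed.

Lemma JB_geometric_complete : geometric_complete V.
Proof. by apply: cauchy_geometric_complete => F FF; exact: (JB_complete HJ). Qed.

Lemma JB_norm_unit : `|e| = 1.
Proof.
have := JB_norm_sqr HJ e; rewrite junitP expr2 => E.
have e0 := norm_unit_gt0 J; apply: (mulfI (lt0r_neq0 e0)).
by rewrite mulr1 -E.
Qed.

(** As |x^2 / L| < 1, a Neumann bound and [path_sqrt] give e - x^2 / L = s^2. With b = x / sqrt L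
    this reads s^2 + b^2 = e, and the axiom |s^2| <= |s^2 + b^2| bounds |s^2| by 1. *)
Lemma JB_square_dist x (L : R) : `|x ∘ x| < L -> `|L *: e - x ∘ x| <= L.
Proof.
move=> xL; have L0 : 0 < L by apply: le_lt_trans xL.
pose h := - (L^-1 *: (x ∘ x)).
have hn : `|h| < 1.
  by rewrite normrN normrZ gtr0_norm ?invr_gt0 // mulrC ltr_pdivrMr // mul1r.
have [A hA Ah] := strongly_associative_closure (lexx 1) JB_norm1M h.
have Aeh : A (e + h) by apply: (sassocD hA) => //; exact: sassoc1 hA.
have [|s [z [_ _ sE _]]] := path_sqrt (lexx 1) JB_norm1M JB_geometric_complete
  (M := (1 - `|h|)^-1) hA Aeh.
  move=> t z /andP[t0 t1]; rewrite (addrC e h) addrK => zE.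
  rewrite -[leRHS]mul1r ler_pdivlMr ?subr_gt0 //.
  have zE' : z = e - t *: (h ∘ z).
    by rewrite -[e in RHS]zE jmulDl junitP jmulZl addrK.
  have hz := JB_norm1M h z.
  have : `|z| <= 1 + t * `|h ∘ z|.
    rewrite {1}zE'; apply: (le_trans (ler_normB _ _)).
    by rewrite JB_norm_unit normrZ ger0_norm.
  by have := normr_ge0 (h ∘ z); nra.
pose b := (Num.sqrt L)^-1 *: x.
have bE : b ∘ b = L^-1 *: (x ∘ x).
  by rewrite jmulZl jmulZr scalerA -invfM -expr2 sqr_sqrtr // ltW.
have := JB_norm_sqrD HJ s b; rewrite sE bE /h subrK JB_norm_unit.
have -> : L *: e - x ∘ x = L *: (e - L^-1 *: (x ∘ x)).
  by rewrite scalerBr scalerA mulfV ?scale1r // gt_eqF.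
by move=> le1; rewrite normrZ gtr0_norm // ler_piMr // ltW.
Qed.

Lemma JB_shift_bound (k L : R) g z : 0 < k -> 0 <= L -> `|g| <= L ->
  ((k + L) *: e - g) ∘ z = e -> `|z| <= k^-1.
Proof.
move=> k0 L0 gL zE.
have zE' : (k + L) *: z = e + g ∘ z.
  by rewrite -[e in RHS]zE jmulBl jmulZl junitP; lmod.
have : (k + L) * `|z| <= 1 + L * `|z|.
  rewrite -(@ger0_norm _ (k + L)); last lra.
  rewrite -normrZ zE'; apply: (le_trans (ler_normD _ _)).
  rewrite JB_norm_unit lerD2l; apply: (le_trans (JB_norm1M _ _)).
  by rewrite mul1r ler_wpM2r.
move=> H; rewrite -[leRHS]mul1r ler_pdivlMr //; lra.
Qed.

Lemma JB_square_sums_resolvent : square_sums_resolvent J.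
Proof.
move=> x y t t0; pose L := (`|x ∘ x| + 1) + (`|y ∘ y| + 1).
pose g := ((`|x ∘ x| + 1) *: e - x ∘ x) + ((`|y ∘ y| + 1) *: e - y ∘ y).
have gL : `|g| <= L.
  apply: (le_trans (ler_normD _ _)); apply: lerD; apply: JB_square_dist; lra.
have L0 : 0 <= L by apply: le_trans gL.
exists (Num.min 1 t)^-1 => r z /andP[r0 r1] zE.
(* The point on the segment is (k + r L) e - r g, and k >= min(1, t). *)
pose k := (1 - r) + r * t.
have m0 : 0 < Num.min 1 t by rewrite lt_min ltr01.
have mk : Num.min 1 t <= k.
  have : Num.min 1 t <= 1 by rewrite ge_min lexx.
  have : Num.min 1 t <= t by rewrite ge_min lexx orbT.
  rewrite /k; nra.
have k0 : 0 < k by apply: lt_le_trans mk.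
apply: (le_trans (_ : _ <= k^-1)); last by rewrite lef_pV2 ?posrE.
apply: (@JB_shift_bound k (r * L) (r *: g)) => //; first exact: mulr_ge0.
  by rewrite normrZ ger0_norm // ler_wpM2l.
by rewrite -[RHS]zE; congr (_ ∘ z); rewrite /g /k /L; lmod.
Qed.

Lemma JB_inverse_bounded : exists M : R, forall x z : V, (e + x ∘ x) ∘ z = e -> `|z| <= M.
Proof.
exists 1 => x z zE; rewrite -[leRHS]invr1.
have xL : `|x ∘ x| < `|x ∘ x| + 1 by lra.
apply: (@JB_shift_bound 1 (`|x ∘ x| + 1) ((`|x ∘ x| + 1) *: e - x ∘ x)) => //.
- exact: JB_square_dist.
- by rewrite -[RHS]zE; congr (_ ∘ z); lmod.
Qed.

End JBAlgebras.

(** * Finite dimension *)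

Section FiniteDimension.
Context (R : realType) (V : normedModType R).

Lemma linear_sum_scale (W : lmodType R) (phi : V -> W) :
  (forall (k : R) x y, phi (k *: x + y) = k *: phi x + phi y) ->
  forall n (c : 'I_n -> R) (b : 'I_n -> V),
  phi (\sum_i c i *: b i) = \sum_i c i *: phi (b i).
Proof.
move=> lin n c b.
have phi0 : phi 0 = 0.
  by have := lin (-1) 0 0; rewrite !scaleN1r oppr0 addr0 addNr.
by elim/big_rec2: _ => // i y x _ <-; rewrite lin.
Qed.

Variables (n : nat) (f : {linear V -> 'rV[R]_n}) (f_bij : bijective f).

Lemma findim_inverse : exists g : 'rV[R]_n -> V,
  [/\ cancel f g, cancel g f & forall (k : R) u v, g (k *: u + v) = k *: g u + g v].
Proof.
have [g fK gK] := f_bij; exists g; split=> // k u v.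
by apply: (can_inj fK); rewrite linearP !gK.
Qed.

Lemma coord_le_norm (u : 'rV[R]_n) i : `|u 0 i| <= `|u|.
Proof.
rewrite [leRHS]/Num.norm /= mx_normrE.
exact: (le_bigmax _ (fun ij => `|u ij.1 ij.2|) (0, i)).
Qed.

Lemma bounded_linear_continuous (U W : normedModType R) (phi : U -> W) (K : R) :
  (forall x y, phi (x - y) = phi x - phi y) -> (forall x, `|phi x| <= K * `|x|) ->
  continuous phi.
Proof.
move=> phiB HK x; apply/cvgrPdist_lt => eps e0; apply/nbhs_normP.
have K0 : 0 <= `|K| by [].
exists (eps / (`|K| + 1)); first by rewrite /= divr_gt0 //; lra.
move=> y /=; rewrite ltr_pdivlMr; last lra.
rewrite -phiB; have := HK (x - y); have := ler_norm K; have := normr_ge0 (x - y).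
by move=> h1 h2 h3; nra.
Qed.

Lemma findim_norm_equiv (g : 'rV[R]_n -> V) :
  cancel f g -> cancel g f -> (forall (k : R) u v, g (k *: u + v) = k *: g u + g v) ->
  continuous g /\ exists2 K : R, 0 <= K & forall v, `|f v| <= K * `|v|.
Proof.
move=> fK gK gl.
have gE u : g u = \sum_i u 0 i *: g (delta_mx 0 i).
  apply: (can_inj fK); rewrite gK linear_sum [LHS]row_sum_delta.
  by apply: eq_bigr => i _; rewrite linearZ /= gK.
have gB u v : g (u - v) = g u - g v.
  by rewrite addrC -scaleN1r gl scaleN1r addrC.
pose K1 := \sum_i `|g (delta_mx 0 i)|.
have gK1 u : `|g u| <= K1 * `|u|.
  rewrite gE; apply: (le_trans (ler_norm_sum _ _ _)).
  rewrite /K1 mulr_suml; apply: ler_sum => i _; rewrite normrZ mulrC.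
  by rewrite ler_wpM2l // coord_le_norm.
have cg : continuous g by apply: bounded_linear_continuous gB gK1.
split=> //.
have g0 : g 0 = 0 by have := gB 0 0; rewrite !subrr.
pose S := [set u : 'rV[R]_n | `|u| = 1].
(* The unit sphere is empty in dimension 0, where no minimum exists. *)
have [S0|/set0P Sn0] := eqVneq S set0.
  exists 0 => // v; rewrite mul0r normr_le0; apply/negPn/negP => fv0.
  have : S (`|f v|^-1 *: f v).
    by rewrite /S /= normrZ normfV normr_id mulVf // normr_eq0.
  by rewrite S0.
have Sc : closed S.
  apply: (@closed_comp _ _ (fun u : 'rV[R]_n => `|u|) [set x | x = 1]).
    by move=> u _; exact: norm_continuous.
  exact: closed_eq.
have Sb : bounded_set S.
  by exists 1; split; rewrite ?num_real // => x x1 u /= ->; exact: ltW.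
have cS := bounded_closed_compact Sb Sc.
have cN : {within S, continuous (fun u => `|g u|)}.
  apply: continuous_subspaceT => u.
  by apply: continuous_comp; [exact: cg|exact: norm_continuous].
have [u0 /set_mem Su0 Hu0] := compact_EVT_min Sn0 cS cN.
have m0 : 0 < `|g u0|.
  rewrite normr_gt0; apply/eqP => gu0.
  have u00 : u0 = 0 by apply: (can_inj gK); rewrite gu0 g0.
  by move: Su0; rewrite /S /= u00 normr0 => /eqP; rewrite eq_sym oner_eq0.
exists `|g u0|^-1; first by rewrite invr_ge0.
move=> v; have [->|fv0] := eqVneq (f v) 0; first by rewrite normr0 mulr_ge0 ?invr_ge0.
have nf0 : 0 < `|f v| by rewrite normr_gt0.
have Sv : S (`|f v|^-1 *: f v).
  by rewrite /S /= normrZ normfV normr_id mulVf // gt_eqF.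
have := Hu0 _ (mem_set Sv).
have -> : g (`|f v|^-1 *: f v) = `|f v|^-1 *: v.
  by rewrite -[_ *: f v]addr0 gl g0 addr0 fK.
rewrite normrZ normfV normr_id => H.
by rewrite ler_pdivlMl // mulrC -ler_pdivlMl.
Qed.

End FiniteDimension.

Lemma findim_basis (R : realType) (V : normedModType R) :
  (exists n (f : {linear V -> 'rV[R]_n}), bijective f) ->
  geometric_complete V /\
  (forall S : set V, closed S -> (exists M : R, forall v, S v -> `|v| <= M) -> compact S) /\
  exists n (b : 'I_n -> V) (c : V -> 'I_n -> R) (K : R),
    [/\ 0 <= K, forall v, v = \sum_i c v i *: b i & forall v i, `|c v i| <= K * `|v|].
Proof.
move=> [n [f f_bij]]; have [g [fK gK gl]] := findim_inverse f_bij.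
have [cg [K K0 HK]] := findim_norm_equiv fK gK gl.
split; [|split].
- have crV : geometric_complete 'rV[R]_n.
    by apply: cauchy_geometric_complete => F FF; exact: cauchy_cvg.
  move=> u L du; have [|l ul] := crV (f \o u) (K * L).
    by move=> i /=; rewrite -linearB (le_trans (HK _)) // -mulrA ler_wpM2l.
  exists (g l) => eps e0.
  have /(_ l)/cvgrPdist_lt/(_ _ e0)/nbhs_normP[d /= d0 Hd] := cg.
  have [N HN] := ul _ d0; exists N => i Ni.
  by rewrite distrC -(fK (u i)); apply: Hd; rewrite /= distrC; exact: HN.
- move=> S cS [M HM].
  have -> : S = g @` (g @^-1` S).
    by apply/seteqP; split=> [v Sv|_ [u Su <-]] //; exists (f v); rewrite /= fK.
  apply: continuous_compact; first by apply: continuous_subspaceT.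
  apply: bounded_closed_compact.
    exists (K * M); split; rewrite ?num_real // => x Mx u /= /HM Sv.
    by rewrite -(gK u) (le_trans (HK _)) // (le_trans _ (ltW Mx)) // ler_wpM2l.
  by apply: (@closed_comp _ _ g S) => // u _; exact: cg.
- exists n, (fun i => g (delta_mx 0 i)), (fun v i => f v 0 i), K; split=> //.
    move=> v; apply: (can_inj fK); rewrite linear_sum {1}(row_sum_delta (f v)).
    by apply: eq_bigr => i _; rewrite linearZ /= gK.
  by move=> v i; apply: (le_trans (coord_le_norm _ _)).
Qed.

Lemma findim_bilinear_bounded (R : realType) (V W : normedModType R) (B : V -> V -> W) :
  (exists n (f : {linear V -> 'rV[R]_n}), bijective f) ->
  (forall (k : R) x y z, B (k *: x + y) z = k *: B x z + B y z) ->
  (forall (k : R) x y z, B z (k *: x + y) = k *: B z x + B z y) ->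
  exists2 K : R, 0 <= K & forall x y, `|B x y| <= K * `|x| * `|y|.
Proof.
move=> /findim_basis[_ [_ [n [b [c [K [K0 vE cK]]]]]]] Bl Br.
pose S := \sum_i \sum_j `|B (b i) (b j)|.
exists (K * K * S); first by rewrite !mulr_ge0 // sumr_ge0 // => i _; rewrite sumr_ge0.
move=> x y.
have Kx : 0 <= K * `|x| by rewrite mulr_ge0.
have -> : K * K * S * `|x| * `|y| = \sum_i \sum_j (K * `|x|) * ((K * `|y|) * `|B (b i) (b j)|).
  transitivity ((K * `|x|) * (K * `|y|) * S); first by ring.
  rewrite /S mulr_sumr; apply: eq_bigr => i _; rewrite mulr_sumr.
  by apply: eq_bigr => j _; rewrite [RHS]mulrA.
rewrite {1}(vE x) (linear_sum_scale (phi := B^~ y)); last by move=> k u v; exact: Bl.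
apply: (le_trans (ler_norm_sum _ _ _)); apply: ler_sum => i _.
rewrite normrZ {1}(vE y) (linear_sum_scale (phi := B (b i))); last by move=> k u v; exact: Br.
rewrite -mulr_sumr; apply: ler_pM => //.
apply: (le_trans (ler_norm_sum _ _ _)); apply: ler_sum => j _.
by rewrite normrZ ler_wpM2r.
Qed.

Lemma bilinear_continuous (R : realType) (V W : normedModType R) (B : V -> V -> W) (K : R) :
  (forall x y z, B (x - y) z = B x z - B y z) ->
  (forall x y z, B z (x - y) = B z x - B z y) ->
  (forall x y, `|B x y| <= K * `|x| * `|y|) ->
  forall (T : topologicalType) (p q : T -> V), continuous p -> continuous q ->
  continuous (fun t => B (p t) (q t)).
Proof.
move=> Bl Br HK T p q cp cq t0; apply/cvgrPdist_lt => eps e0.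
pose M := `|K| * (`|p t0| + `|q t0| + 1) + 1.
have M0 : 0 < M.
  by have : 0 <= `|K| * (`|p t0| + `|q t0| + 1) by []; rewrite /M; lra.
pose d := Num.min 1 (eps / M).
have d0 : 0 < d by rewrite lt_min ltr01 divr_gt0.
have /cvgrPdist_lt/(_ _ d0) Hp := cp t0; have /cvgrPdist_lt/(_ _ d0) Hq := cq t0.
near=> t.
have pt : `|p t0 - p t| < d by near: t.
have qt : `|q t0 - q t| < d by near: t.
have d1 : d <= 1 by rewrite ge_min lexx.
have dM : d * M <= eps by rewrite -ler_pdivlMr // ge_min lexx orbT.
have -> : B (p t0) (q t0) - B (p t) (q t) = B (p t0 - p t) (q t0) + B (p t) (q t0 - q t).
  by rewrite Bl Br; lmod.
apply: (le_lt_trans (ler_normD _ _)).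
have HK' x y : `|B x y| <= `|K| * `|x| * `|y|.
  by apply: (le_trans (HK x y)); rewrite -!mulrA ler_wpM2r ?mulr_ge0 // ler_norm.
have ptn : `|p t| <= `|p t0| + 1.
  have -> : p t = p t0 - (p t0 - p t) by lmod.
  by apply: (le_trans (ler_normB _ _)); lra.
have H1 : `|B (p t0 - p t) (q t0)| <= `|K| * d * `|q t0|.
  by apply: (le_trans (HK' _ _)); rewrite ler_wpM2r // ler_wpM2l // ltW.
have H2 : `|B (p t) (q t0 - q t)| <= `|K| * (`|p t0| + 1) * d.
  by apply: (le_trans (HK' _ _)); apply: ler_pM; rewrite ?mulr_ge0 ?ler_wpM2l // ltW.
have H3 : `|K| * d * `|q t0| + `|K| * (`|p t0| + 1) * d + d = d * M by rewrite /M; ring.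
lra.
Unshelve. all: by end_near. Qed.

(** * Euclidean algebras *)

Section SelfDuality.
Context (R : realType) (V : normedModType R) (J : jordan_algebra V).
Local Notation "x ∘ y" := (jmul J x y) (at level 40, left associativity).
Local Notation e := (junit J).
Implicit Types (u v w x y z : V).

Variable ip : V -> V -> R.
Hypothesis ipC : forall x y, ip x y = ip y x.
Hypothesis ip_lin : forall (k : R) x y z, ip (k *: x + y) z = k * ip x z + ip y z.
Hypothesis ip_gt0 : forall x, x != 0 -> 0 < ip x x.
Hypothesis ipM : forall a x y, ip (a ∘ x) y = ip x (a ∘ y).
Hypothesis Vfin : exists n (f : {linear V -> 'rV[R]_n}), bijective f.

Lemma ipD x y z : ip (x + y) z = ip x z + ip y z.
Proof. by rewrite -{1}(scale1r x) ip_lin mul1r. Qed.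
Lemma ip0 z : ip 0 z = 0.
Proof. by apply: (addrI (ip 0 z)); rewrite -ipD !addr0. Qed.
Lemma ipZ (k : R) x z : ip (k *: x) z = k * ip x z.
Proof. by rewrite -[k *: x]addr0 ip_lin ip0 addr0. Qed.
Lemma ipDr x y z : ip z (x + y) = ip z x + ip z y.
Proof. by rewrite !(ipC z) ipD. Qed.
Lemma ipZr (k : R) x z : ip z (k *: x) = k * ip z x.
Proof. by rewrite !(ipC z) ipZ. Qed.
Lemma ipB x y z : ip (x - y) z = ip x z - ip y z.
Proof. by rewrite ipD -scaleN1r ipZ mulN1r. Qed.
Lemma ipBr x y z : ip z (x - y) = ip z x - ip z y.
Proof. by rewrite !(ipC z) ipB. Qed.
Lemma ip_ge0 x : 0 <= ip x x.
Proof. by have [->|/ip_gt0/ltW//] := eqVneq x 0; rewrite ip0. Qed.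
Lemma ip_eq0 x : ip x x = 0 -> x = 0.
Proof.
by move=> xx; apply/eqP/negPn/negP => /ip_gt0; rewrite xx ltxx.
Qed.
Lemma ipMM x y : ip (x ∘ x) (y ∘ y) = ip (x ∘ x ∘ y) y.
Proof. by rewrite -ipM (jmulC J y). Qed.

(** * Minimization of Rayleigh quotients *)

Lemma rayleigh_eigen (E : set V) (T : V -> V) (mu : R) v :
  (forall (k : R) x y, E x -> E y -> E (k *: x + y)) ->
  (forall (k : R) x y, T (k *: x + y) = k *: T x + T y) ->
  (forall x y, ip (T x) y = ip x (T y)) ->
  (forall x, E x -> mu * ip x x <= ip (T x) x) ->
  E v -> E (T v) -> ip (T v) v = mu * ip v v -> T v = mu *: v.
Proof.
move=> EL TL Tsym Tge Ev ETv Tv; apply/eqP; rewrite -subr_eq0; apply/eqP/ip_eq0.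
have [w wE] : exists w, w = T v - mu *: v by exists (T v - mu *: v).
have Ew : E w by rewrite wE addrC -scaleNr; exact: EL.
rewrite -wE.
pose b := ip (T w) w - mu * ip w w.
have b0 : 0 <= b by rewrite subr_ge0; exact: Tge.
have H (s : R) : 0 <= 2 * s * ip w w + s * s * b.
  have Es : E (s *: w + v) by exact: EL.
  have := Tge _ Es; rewrite TL !(ipD, ipDr, ipZ, ipZr) Tv.
  have E1 : ip (T w) v = ip w (T v) by rewrite Tsym.
  have E2 : ip (T v) w = ip w (T v) by rewrite ipC.
  have E3 : ip w w = ip w (T v) - mu * ip w v by rewrite {2}wE ipBr ipZr.
  have E4 : ip v w = ip w v by rewrite ipC.
  rewrite E1 E2 E4 /b => H; clear -H E3; nra.
have w0 := ip_ge0 w; apply/le_anti; rewrite w0 andbT leNgt; apply/negP => wp.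
(* For this s the expression in [H] equals s <w,w> - s^2, which is negative. *)
pose s := - (ip w w / (b + 1)).
have b1 : 0 < b + 1 by lra.
have sE : s * (b + 1) = - ip w w by rewrite /s mulNr divfK // gt_eqF.
have s0 : s < 0 by rewrite oppr_lt0 divr_gt0.
have := H s; have -> : 2 * s * ip w w + s * s * b = s * ip w w - s * s.
  have -> : s * s * b = s * (s * (b + 1)) - s * s by ring.
  by rewrite sE; ring.
nra.
Qed.

(** With x fixed, <x^2, v^2> = <x^2 v, v> is the Rayleigh quotient of multiplication by x^2, and v
    minimizes it. *)
Lemma min_pair_eigen (mu : R) x v : 
  (forall x v, mu * (ip x x * ip v v) <= ip (x ∘ x) (v ∘ v)) ->
  ip x x = 1 -> ip v v = 1 -> ip (x ∘ x) (v ∘ v) = mu ->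
  x ∘ x ∘ v = mu *: v.
Proof.
move=> Hmin x1 v1 xv.
apply: (@rayleigh_eigen setT (jmul J (x ∘ x)) mu v) => //.
- by move=> k y z; rewrite jmulDr jmulZr.
- by move=> y _; have := Hmin x y; rewrite x1 mul1r ipMM.
- by rewrite v1 mulr1 -xv ipMM.
Qed.

(** In both cases <v^2, v^2> = mu < 0. If beta = 0, then x v = 0, and the polarized identity gives
    mu v^2 = x^2 v^2 = mu x^2, so v^2 = x^2. Otherwise v (v^2 x) = v^2 (v x) gives v^2 v = mu v. *)
Lemma min_pair_absurd (mu beta : R) x v : mu < 0 -> ip v v = 1 ->
  x ∘ x ∘ v = mu *: v -> v ∘ v ∘ x = mu *: x -> x ∘ v = beta *: v -> False.
Proof.
move=> mu0 v1 Ev Ex Eb.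
have [b0|b0] := eqVneq beta 0.
  have xv0 : x ∘ v = 0 by rewrite Eb b0 scale0r.
  have vx0 : v ∘ x = 0 by rewrite jmulC.
  have m0 y : y ∘ 0 = 0 by rewrite jmulC jmul0l.
  have := jordan_polarized J x x v v; have := jordan_polarized J v v x x.
  rewrite !(vx0, xv0, jmul0l, m0, add0r, addr0) Ev Ex !jmulZr.
  rewrite (jmulC J (v ∘ v)) => <- /scalerI E.
  have vv : v ∘ v = x ∘ x by apply: E; rewrite lt_eqF.
  have : ip (v ∘ v) (v ∘ v) = mu by rewrite {1}vv ipMM Ev ipZ v1 mulr1.
  by have := ip_ge0 (v ∘ v); lra.
have v3 : v ∘ v ∘ v = mu *: v.
  have := jordan_identity J v x; rewrite Ex jmulZr (jmulC J v x) Eb jmulZr => E.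
  by apply: (scalerI b0); rewrite -E scalerA mulrC -scalerA.
have : ip (v ∘ v) (v ∘ v) = mu by rewrite ipMM v3 ipZ v1 mulr1.
by have := ip_ge0 (v ∘ v); lra.
Qed.

Lemma ip_bounded : exists2 K : R, 0 <= K & forall x y, `|ip x y| <= K * `|x| * `|y|.
Proof.
apply: (@findim_bilinear_bounded R V R^o ip Vfin) => k x y z.
  exact: ip_lin.
by rewrite ipDr ipZr.
Qed.

Lemma jmul_bounded : exists2 K : R, 0 <= K & forall x y, `|x ∘ y| <= K * `|x| * `|y|.
Proof.
apply: (findim_bilinear_bounded Vfin) => k x y z; first by rewrite jmulDl jmulZl.
by rewrite jmulDr jmulZr.
Qed.

Lemma ip_continuous (T : topologicalType) (p q : T -> V) :
  continuous p -> continuous q -> continuous (fun t => ip (p t) (q t) : R).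
Proof.
have [K _ HK] := ip_bounded.
apply: (@bilinear_continuous R V R^o ip K) => // x y z; [exact: ipB|exact: ipBr].
Qed.

Lemma jmul_continuous (T : topologicalType) (p q : T -> V) :
  continuous p -> continuous q -> continuous (fun t => p t ∘ q t).
Proof.
have [K _ HK] := jmul_bounded.
apply: (bilinear_continuous _ _ HK) => x y z; [exact: jmulBl|exact: jmulBr].
Qed.

Lemma norm_le_ip : exists2 M : R, 0 <= M & forall v, `|v| * `|v| <= M * ip v v.
Proof.
have [_ [cpt _]] := findim_basis Vfin.
pose S := [set v : V | `|v| = 1].
have cS : compact S.
  apply: cpt; last by exists 1 => v ->.
  apply: (@closed_comp _ _ (fun u : V => `|u|) [set x | x = 1]).
    by move=> u _; exact: norm_continuous.
  exact: closed_eq.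
have e0 := norm_unit_gt0 J.
have S0 : S !=set0.
  by exists (`|e|^-1 *: e); rewrite /S /= normrZ normfV normr_id mulVf // gt_eqF.
have cN : {within S, continuous (fun v => ip v v : R)}.
  by apply: continuous_subspaceT; apply: ip_continuous => v; exact: cvg_id.
have [u /set_mem Su Hu] := compact_EVT_min S0 cS cN.
have m0 : 0 < ip u u.
  by apply: ip_gt0; rewrite -normr_eq0 Su oner_neq0.
exists (ip u u)^-1; first by rewrite invr_ge0 ltW.
move=> v; have [->|v0] := eqVneq v 0; first by rewrite normr0 ip0 !mulr0.
have nv : 0 < `|v| by rewrite normr_gt0.
have Sv : S (`|v|^-1 *: v) by rewrite /S /= normrZ normfV normr_id mulVf // gt_eqF.
have := Hu _ (mem_set Sv); rewrite ipZ ipZr mulrA -invfM.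
by rewrite ler_pdivlMl ?mulr_gt0 // => H; rewrite ler_pdivlMl // mulrC.
Qed.

Lemma ip_sphere_compact : compact [set v | ip v v = 1].
Proof.
have [_ [cpt _]] := findim_basis Vfin; have [M M0 HM] := norm_le_ip.
apply: cpt.
  apply: (@closed_comp _ _ (fun v : V => ip v v : R) [set x | x = 1]).
    by move=> u _; apply: ip_continuous => v; exact: cvg_id.
  exact: closed_eq.
exists (M + 1) => v v1; have := HM v; rewrite v1 mulr1.
by have := normr_ge0 v; nra.
Qed.

(* The minimum of <x^2, v^2> over unit vectors, if negative, would be attained at
   a common eigenvector [v] of L_x and L_(x^2), and the Jordan identities rule this
   out. *)
Lemma ip_square_ge0 x v : 0 <= ip (x ∘ x) (v ∘ v).
Proof.
rewrite leNgt; apply/negP => xv_lt0.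
pose S := [set v | ip v v = 1].
pose F (p : V * V) : R := ip (p.1 ∘ p.1) (p.2 ∘ p.2).
have cF : continuous F.
  apply: ip_continuous; apply: jmul_continuous => p; solve [exact: cvg_fst|exact: cvg_snd].
have scale1 y : y != 0 -> S ((Num.sqrt (ip y y))^-1 *: y).
  move=> /ip_gt0 y0; rewrite /S /= ipZ ipZr mulrA -invfM -expr2 sqr_sqrtr ?ltW //.
  by rewrite mulVf // gt_eqF.
have S0 : (S `*` S) !=set0.
  by exists ((Num.sqrt (ip e e))^-1 *: e, (Num.sqrt (ip e e))^-1 *: e); split;
    apply: scale1; exact: junit_neq0.
have cSS : compact (S `*` S) by apply: compact_setX; exact: ip_sphere_compact.
have [[x0 v0] /set_mem[/= Sx0 Sv0] Hmin] :=
  compact_EVT_min S0 cSS (continuous_subspaceT cF).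
set mu := F (x0, v0) in Hmin.
have Hmu y z : mu * (ip y y * ip z z) <= ip (y ∘ y) (z ∘ z).
  have [->|y0] := eqVneq y 0; first by rewrite jmul0l !ip0 mul0r mulr0.
  have [->|z0] := eqVneq z 0; first by rewrite jmul0l (ipC _ 0) !ip0 !mulr0.
  have Syz : (S `*` S) ((Num.sqrt (ip y y))^-1 *: y, (Num.sqrt (ip z z))^-1 *: z).
    by split; exact: scale1.
  have := Hmin _ (mem_set Syz); rewrite /F /=.
  rewrite !(jmulZl, jmulZr, scalerA) ipZ ipZr -!invfM -!expr2 !sqr_sqrtr ?ip_ge0 //.
  move=> H; rewrite mulrA -ler_pdivlMr ?ip_gt0 // -ler_pdivlMr ?ip_gt0 //.
  by apply: (le_trans H); rewrite mulrCA mulrA mulrC mulrA.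
have mu0 : mu < 0.
  have := Hmu x v; have := ip_ge0 x; have := ip_ge0 v.
  move=> v_ge0 x_ge0 H; rewrite ltNge; apply/negP => mu_ge0.
  by have := mulr_ge0 mu_ge0 (mulr_ge0 x_ge0 v_ge0); lra.
(* A second minimization, of <x0 v, v> among the minimizers for x0, makes v an eigenvector of
   multiplication by x0 as well. *)
pose S1 := [set v | ip v v = 1] `&` [set v | ip (x0 ∘ x0) (v ∘ v) = mu].
have cid' : continuous (fun v : V => v) by move=> w; exact: cvg_id.
have cst' (a : V) : continuous (fun _ : V => a) by move=> w; exact: cvg_cst.
have cS1 : compact S1.
  apply: compact_closedI; first exact: ip_sphere_compact.
  apply: (@closed_comp _ _ (fun v : V => ip (x0 ∘ x0) (v ∘ v) : R) [set x | x = mu]).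
    by move=> w _; apply: ip_continuous => //; exact: jmul_continuous.
  exact: closed_eq.
have S10 : S1 !=set0 by exists v0; split.
have cG : {within S1, continuous (fun v => ip (x0 ∘ v) v : R)}.
  by apply: continuous_subspaceT; apply: ip_continuous => //; exact: jmul_continuous.
have [v1 /set_mem[Sv1 Fv1] Hv1] := compact_EVT_min S10 cS1 cG.
set beta := ip (x0 ∘ v1) v1 in Hv1.
have Ev1 := min_pair_eigen Hmu Sx0 Sv1 Fv1.
have Ex0 : v1 ∘ v1 ∘ x0 = mu *: x0.
  by apply: min_pair_eigen => //; rewrite ipC.
(* Unit vectors of E lie in [S1], so beta is a lower bound for the Rayleigh quotient on E; the
   Jordan identity puts x0 ∘ v1 in E. *)
pose E := [set u | x0 ∘ x0 ∘ u = mu *: u].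
have EL (k : R) y z : E y -> E z -> E (k *: y + z).
  by rewrite /E /= => Ey Ez; rewrite jmulDr jmulZr Ey Ez; lmod.
apply: (@min_pair_absurd mu beta x0 v1) => //.
apply: (@rayleigh_eigen E (jmul J x0) beta v1) => //.
- by move=> k y z; rewrite jmulDr jmulZr.
- move=> y Ey; have [->|y0] := eqVneq y 0; first by rewrite ipC !ip0 mulr0.
  have S1y : S1 ((Num.sqrt (ip y y))^-1 *: y).
    split; first exact: scale1.
    rewrite /= ipMM jmulZr Ey; have := scale1 _ y0; rewrite /S /=.
    by rewrite !(ipZ, ipZr) => E1; rewrite mulrCA E1 mulr1.
  have := Hv1 _ (mem_set S1y).
  rewrite jmulZr ipZ ipZr mulrA -invfM -expr2 sqr_sqrtr ?ip_ge0 //.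
  by rewrite ler_pdivlMl ?ip_gt0 // mulrC.
- by rewrite /E /= -jordan_identity Ev1 jmulZr.
- by rewrite Sv1 mulr1.
Qed.

Lemma coercive_inverse_bounded (k : R) : 0 < k -> exists M : R, forall a z,
  (forall z, k * ip z z <= ip (a ∘ z) z) -> a ∘ z = e -> `|z| <= M.
Proof.
move=> k0; have [M M0 HM] := norm_le_ip.
(* The summand 1 avoids a square root: |z|^2 <= m implies |z| <= m + 1. *)
exists (M * (ip e e / (k * k)) + 1) => a z Ha az.
have H1 : k * ip z z <= ip e z by rewrite -az.
(* Stands in for the Cauchy-Schwarz inequality: combined with [H1] it gives k^2 <z,z> <= <e,e>. *)
have H2 : 0 <= ip (e - k *: z) (e - k *: z) by exact: ip_ge0.
rewrite !(ipB, ipBr, ipZ, ipZr) (ipC z e) in H2.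
have H3 : ip z z <= ip e e / (k * k).
  by rewrite ler_pdivlMr ?mulr_gt0 //; nra.
have H4 := le_trans (HM z) (ler_wpM2l M0 H3).
by have := normr_ge0 z; nra.
Qed.

Lemma square_sum_coercive x y z (t : R) :
  t * ip z z <= ip ((x ∘ x + y ∘ y + t *: e) ∘ z) z.
Proof.
rewrite !jmulDl jmulZl junitP !ipD ipZ -!ipMM.
by have := ip_square_ge0 x z; have := ip_square_ge0 y z; lra.
Qed.

Lemma euclidean_resolvent : square_sums_resolvent J.
Proof.
move=> x y t t0; have m0 : 0 < Num.min 1 t by rewrite lt_min ltr01.
have [M HM] := coercive_inverse_bounded m0.
exists M => r z /andP[r0 r1]; apply: HM => w.
set a := x ∘ x + y ∘ y + t *: e.
have -> : e + r *: (a - e) = (1 - r) *: e + r *: a by lmod.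
rewrite jmulDl !jmulZl junitP ipD !ipZ.
have H := square_sum_coercive x y w t; rewrite -/a in H.
have : Num.min 1 t <= 1 by rewrite ge_min lexx.
have : Num.min 1 t <= t by rewrite ge_min lexx orbT.
have w0 := ip_ge0 w; move: (Num.min 1 t) => m mt m1.
have h1 : r * (t * ip w w) <= r * ip (a ∘ w) w by rewrite ler_wpM2l.
have h2 : m * ip w w <= ((1 - r) + r * t) * ip w w.
  by rewrite ler_wpM2r //; nra.
lra.
Qed.

Lemma euclidean_inverse_bounded :
  exists M : R, forall x z : V, (e + x ∘ x) ∘ z = e -> `|z| <= M.
Proof.
have [M HM] := coercive_inverse_bounded (@ltr01 R).
exists M => x z; apply: HM => w.
have -> : e + x ∘ x = x ∘ x + 0 ∘ 0 + (1 : R) *: e by rewrite jmul0l; lmod.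
exact: square_sum_coercive.
Qed.

End SelfDuality.

Theorem theorem4p7 (R : realType) (V : normedModType R) (J : jordan_algebra V)
    (HJ : euclidean J \/ JB_algebra J) :
  (forall U : set (geometry J), cyclic_interval_open U <-> usual_open U) /\
  (forall W : set V,
     (exists2 U : set (geometry J), cyclic_interval_open U & W = emb J @^-1` U) <->
     open W).
Proof.
have [C [C1 HC] [cV [rJ bJ]]] : exists2 C : R,
    1 <= C /\ (forall a b : V, `|jmul J a b| <= C * `|a| * `|b|) &
    geometric_complete V /\ square_sums_resolvent J /\
    exists M : R, forall x z : V,
      jmul J (junit J + jmul J x x) z = junit J -> `|z| <= M.
  case: HJ => [[Vfin [ip [ipC ip_lin ip_gt0 ipM]]]|HJ].
    have [K K0 HK] := jmul_bounded J Vfin.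
    have [cV _] := findim_basis Vfin.
    (* The added 1 secures 1 <= C. *)
    exists (K + 1); last first.
      split=> //; split; first exact: (euclidean_resolvent ipC ip_lin ip_gt0 ipM Vfin).
      exact: (euclidean_inverse_bounded ipC ip_lin ip_gt0 ipM Vfin).
    split=> [|a b]; first by lra.
    by apply: (le_trans (HK a b)); rewrite -!mulrA ler_wpM2r ?mulr_ge0 //; lra.
  exists 1; first by split=> // a b; exact: JB_norm1M.
  split; first exact: JB_geometric_complete HJ.
  by split; [exact: JB_square_sums_resolvent|exact: JB_inverse_bounded].
by split=> [U|W]; [exact: cyclic_interval_open_usual C1 HC cV rJ bJ U|
  exact: usual_topology_restriction C1 HC cV rJ bJ W].
Qed.
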